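(* Let $\psi:\mathbb{N}\to[0,\infty)$ be any function such that $S_\psi:=\sum_{q=1}^{\infty}\psi(q)^2$ converges. Let $0<\delta<1$ and let $\kappa=\kappa(\delta)$ be a real number with $$\kappa<\min\left\{\frac{1}{6\max_{n\in\mathbb{N}}\psi(n)},\ \frac{\delta}{\sqrt{S_\psi}}\cdot\frac{2\sqrt6\,(5\log 2)^4}{3\pi^3\sqrt{\zeta\left(\frac{12}{11}\right)}\,11^4},\ \sqrt{\frac{\delta}{S_\psi}}\cdot\frac{1}{\sqrt{18}\,\pi},\ \left(\frac{\delta}{S_\psi}\right)^{\frac23}\left(\frac{1}{2\pi^2\sqrt{12}}\right)^{\frac23}\left(A_1+A_2+A_3\right)^{-\frac23}\right\},$$ where $$A_1=99684\cdot 4.19253564643679,$$ $$A_2=27\cdot 4^{\frac{3}{16}+\frac{0.11237+0.11237^2}{2}}\,3^{\frac52}\left(e^{e^8}-10^5\right)e^{\frac{5\log(2)e^8}{2(8-1.39177)}}\left(\frac{1}{e\cdot 0.11237}\right)^{1+\frac{0.11237}{2}},$$ $$A_3=5\cdot 4^{\frac{3}{16}+\frac{0.00218819+0.00218819^2}{2}+\frac{5}{2\cdot 57}}\left(\frac{57}{\log 2}\right)^{\frac{7\cdot 176846309399143769411680}{2}}\left(\frac{1}{e\cdot 0.00218819}\right)^{1+\frac{0.00218819}{2}}.$$ Then $$\lambda\left(\mathcal{B}'(\psi,\kappa)\right)\geq 1-\delta .$$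
   Context: $\mathbb{N}=\{1,2,3,\dots\}$; $\lambda$ is Lebesgue measure on $\mathbb{R}$; $\lVert y\rVert$ denotes the distance from the real number $y$ to the nearest integer; $\zeta$ is the Riemann zeta function; $\log$ is the natural logarithm. For $\psi:\mathbb{N}\to[0,\infty)$ and real $\kappa$, $$\mathcal{B}'(\psi,\kappa):=\left\{x\in[0,1]:\ \max\left(\lVert qx\rVert,\lVert qx^2\rVert\right)>\kappa\,\psi(q)\ \text{ for all } q\in\mathbb{N}\right\}.$$ No monotonicity of $\psi$ is assumed. If $\psi$ is identically zero, quotients with zero denominator are read as $+\infty$. *)

(* Defs.v *)
From HB Require Import structures.
From mathcomp Require Import all_boot all_order all_algebra.
From mathcomp Require Import all_classical all_reals all_analysis.

Set Implicit Arguments.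
Unset Strict Implicit.
Unset Printing Implicit Defensive.

Import Order.TTheory GRing.Theory Num.Theory.
Import numFieldNormedType.Exports.

Local Open Scope classical_set_scope.
Local Open Scope ring_scope.

(* Sequences indexed by {1, 2, 3, ...} are represented by functions on [nat]
   whose value at 0 is never used. *)

Definition dist_int (R : realType) (y : R) : R :=
  inf [set `|y - m%:~R| | m in [set: int]].

Definition badB (R : realType) (psi : nat -> R) (kappa : R) : set R :=
  [set x : R | 0 <= x <= 1 /\
     forall q : nat, (0 < q)%N ->
       kappa * psi q <
         Num.max (dist_int (q%:R * x)) (dist_int (q%:R * x ^+ 2))].

Definition psi_sq (R : realType) (psi : nat -> R) : nat -> R :=
  fun n => psi n.+1 ^+ 2.

(* Under the hypotheses of [psi_max_attained] below this is a maximum. *)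
Definition psi_max (R : realType) (psi : nat -> R) : R :=
  sup [set psi n | n in [set n : nat | (0 < n)%N]].

Lemma psi_max_attained (R : realType) (psi : nat -> R) :
  (forall q : nat, (0 < q)%N -> 0 <= psi q) ->
  cvgn (series (psi_sq psi)) ->
  exists n : nat, [/\ (0 < n)%N, psi n = psi_max psi
    & forall m : nat, (0 < m)%N -> psi m <= psi n].
Proof.
move=> psi0 cv.
suff [n n0 nmax] : exists2 n : nat, (0 < n)%N
    & forall m : nat, (0 < m)%N -> psi m <= psi n.
  exists n; split => //; apply/eqP; rewrite eq_le; apply/andP; split.
    by apply: ub_le_sup; [exists (psi n) => _ [m /= m0 <-]; exact: nmax|exists n].
  by apply: ge_sup => [|_ [m /= m0 <-]]; [exists (psi n); exists n|exact: nmax].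
have [all0|] := pselect (forall m : nat, (0 < m)%N -> psi m = 0).
  by exists 1%N => // m m0; rewrite !all0.
move/existsNP => [m /not_implyP [m0 /eqP psim]].
have {}psim : 0 < psi m by rewrite lt_def psim psi0.
have /cvgr0_norm_lt/(_ _ (exprn_gt0 2 psim)) [N _ small] :=
  cvg_series_cvg_0 cv.
have large n : (N < n)%N -> psi n <= psi m.
  case: n => // n Nn; have := small n Nn.
  rewrite /psi_sq ger0_norm ?sqr_ge0// ltr_pXn2r// ?nnegrE ?psi0//.
  by move/ltW.
pose i0 : 'I_(N + m).+1 := inord m.
have i0E : i0 = m :> nat by rewrite inordK// ltnS leq_addl.
have Pi0 : (0 < i0)%N by rewrite i0E.
case: (@Order.TotalTheory.arg_maxP _ _ _ i0 (fun i : 'I_(N + m).+1 => (0 < i)%N)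
  (fun i => psi i) Pi0).
move=> i ipos imax; exists i => // n n0.
have [Nn|nN] := ltnP N n.
  by apply: le_trans (large _ Nn) _; have := imax _ Pi0; rewrite i0E.
have nb : (n < (N + m).+1)%N by rewrite ltnS (leq_trans nN)// leq_addr.
exact: (imax (Ordinal nb)).
Qed.

(* [riemannR s n = 1 / n.+1 `^ s]; meaningful for [1 < s]. *)
Definition zeta (R : realType) (s : R) : R := limn (series (riemannR s)).

(* [base1000 [:: 12; 345; 6]] is 12345006: long numerals are entered by blocks
   of three digits, since a numeral of [ring_scope] is a unary [nat]. *)
Definition base1000 (R : realType) (s : seq nat) : R :=
  foldl (fun acc d => acc * 1000 + d%:R) 0 s.

(* [decimal s k] is [base1000 s] with the decimal point [k] places from the
   right end. *)
Definition decimal (R : realType) (s : seq nat) (k : nat) : R :=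
  base1000 R s / 10 ^+ k.

Definition A1 (R : realType) : R :=
  base1000 R [:: 99; 684] * decimal R [:: 419; 253; 564; 643; 679] 14.

Definition A2 (R : realType) : R :=
  let c : R := decimal R [:: 11; 237] 5 (* 0.11237 *) in
  let d : R := decimal R [:: 139; 177] 5 (* 1.39177 *) in
  27 * 4 `^ (3 / 16 + (c + c ^+ 2) / 2) * 3 `^ (5 / 2)
  * (expR (expR 8) - 10 ^+ 5)
  * expR (5 * ln 2 * expR 8 / (2 * (8 - d)))
  * (1 / (expR 1 * c)) `^ (1 + c / 2).

Definition A3 (R : realType) : R :=
  let c : R := decimal R [:: 218; 819] 8 (* 0.00218819 *) in
  let N : R := base1000 R [:: 176; 846; 309; 399; 143; 769; 411; 680] in
  5 * 4 `^ (3 / 16 + (c + c ^+ 2) / 2 + 5 / (2 * 57))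
  * (57 / ln 2) `^ (7 * N / 2)
  * (1 / (expR 1 * c)) `^ (1 + c / 2).

(* The bound on kappa lives in [\bar R], where [x / 0 = +oo] for [0 < x], so
   that it is [+oo] when [psi] vanishes identically. *)
Definition kappa_bound (R : realType) (psi : nat -> R) (delta : R) : \bar R :=
  let S : R := limn (series (psi_sq psi)) in
  (Order.min (Order.min (Order.min
    (1 / (6 * psi_max psi)%:E)
    (delta%:E / (Num.sqrt S)%:E *
      (2 * Num.sqrt 6 * (5 * ln 2) ^+ 4 /
         (3 * pi ^+ 3 * Num.sqrt (zeta (12 / 11)) * 11 ^+ 4))%:E))
    (sqrte (delta%:E / S%:E) * (1 / (Num.sqrt 18 * pi))%:E))
    ((delta%:E / S%:E) `^ (2 / 3)%R *
      ((1 / (2 * pi ^+ 2 * Num.sqrt 12)) `^ (2 / 3)%R *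
         (A1 R + A2 R + A3 R) `^ (- (2 / 3)))%:E))%E.

(* Main.v *)
(* Write [phi q = max 0 (kappa psi q)]. If [x] in [0, 1] satisfies [||q x|| <= phi q]
   and [||q x ^ 2|| <= phi q], then [x] is within [phi q / q] of a fraction [a / q]
   with [||a ^ 2 / q|| <= 3 phi q], so its measure is at most [2 phi q / q] times
   the number [W q H] of [a] mod [q] with [||a ^ 2 / q|| <= 1 / (2 H)], where [H] is
   a power of 2 with [1 / (12 H) < phi q <= 1 / (6 H)].  Whenever [W q H <= C q / H]
   with a fixed [C], the contribution of [q] is [O(phi q ^ 2)], which is summable.
   For the other [q], [(W q H / q) ^ 2] is bounded by a quantity [excess q]
   independent of [H] whose sum over all [q] converges, and the Cauchy-Schwarz
   inequality concludes.
   The bound on [excess] comes from three sources: the divisor function when [H] is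
   large; pointwise bounds on quadratic Gauss sums when [H] is small; and, in
   between, a mean square over dyadic ranges of [q]: Landsberg-Schaar reciprocity turns the
   Fejer mean of [G(h, q)] over [h < H] into an exponential sum
   [sum_rho c_rho e(- q rho)] over fractions of denominator at most [4 H], to which
   the large sieve applies. *)
From mathcomp Require Import all_boot all_order all_algebra.
From mathcomp Require Import all_classical all_reals all_analysis.
From mathcomp Require Import complex zify ring lra.
Require Import Defs.

Set Implicit Arguments.
Unset Strict Implicit.
Unset Printing Implicit Defensive.

Import Order.TTheory GRing.Theory Num.Theory.
Import numFieldNormedType.Exports.
Import ComplexField.

Local Open Scope ring_scope.
Local Open Scope complex_scope.

(** * Exponential sums *)

(** Since [psi] is arbitrary, [H] may depend on [q] in any way, so estimates must be uniform in [H],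
    at the price of summing over the powers of 2. The pointwise bounds fail only narrowly: an excess
    of [W q H] over [C q / H] forces [q / H] below a multiple of [sqrt (q tau q)], and the divisor
    bound then makes [(W q H / q) ^ 2] of order [tau q ^ 3 / q], apart from squares vanishing mod
    [q]. That sum over [q] diverges, but only like a power of a logarithm. Over [q] of size [Q] the
    mean square replaces it by [1 / H + H / Q] times a power of [log Q], a power saving for [H]
    between about [Q ^ (1 / 3)] and [Q ^ (5 / 8)]. Below this range there is no excess, above it
    [tau q ^ 2 / H ^ 2] is summable. The saving beats the logarithms numerically only for large [q],
    so below [2 ^ 112] the pointwise bound is kept. The second entry of the minimum gives
    [kappa sqrt S <= sigma] with [sigma = 3.5 delta / 10 ^ 4], and the total of [excess] is at most
    [700 ^ 2]; the exceptional measure is then at most [24 * excess_cst * sigma ^ 2 + 1400 * sigma <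
    0.97 delta]. *)

Section ComplexModulus.
Variable R : realType.
Implicit Types (x y : R) (z w : R[i]).

Definition cabs z : R := Normc.normc z.

Lemma cabs_ge0 z : 0 <= cabs z.
Proof. by case: z => a b; exact: sqrtr_ge0. Qed.

Lemma cabs0 : cabs 0 = 0.
Proof. exact: Normc.normc0. Qed.

Lemma cabs1 : cabs 1 = 1.
Proof. exact: Normc.normc1. Qed.

Lemma cabsM z w : cabs (z * w) = cabs z * cabs w.
Proof. exact: Normc.normcM. Qed.

Lemma cabsN z : cabs (- z) = cabs z.
Proof. exact: normcN. Qed.

Lemma cabsV z : cabs z^-1 = (cabs z)^-1.
Proof. exact: Normc.normcV. Qed.

Lemma cabs_eq0 z : cabs z = 0 -> z = 0.
Proof. exact: Normc.eq0_normc. Qed.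

Lemma cabsD z w : cabs (z + w) <= cabs z + cabs w.
Proof. exact: le_normcD. Qed.

Lemma cabsB z w : cabs (z - w) <= cabs z + cabs w.
Proof. by rewrite -(cabsN w); exact: cabsD. Qed.

Lemma cabs_sum (I : Type) (r : seq I) (P : pred I) (F : I -> R[i]) :
  cabs (\sum_(i <- r | P i) F i) <= \sum_(i <- r | P i) cabs (F i).
Proof.
elim/big_rec2: _ => [|i y z _ le_zy]; first by rewrite cabs0.
by apply: le_trans (cabsD _ _) _; rewrite lerD2l.
Qed.

Lemma Re_sum (I : Type) (r : seq I) (P : pred I) (F : I -> R[i]) :
  complex.Re (\sum_(i <- r | P i) F i) = \sum_(i <- r | P i) complex.Re (F i).
Proof. by apply: (big_morph (@complex.Re R)) => // -[a b] [c d]. Qed.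

Lemma cabs_sq z : cabs z ^+ 2 = complex.Re z ^+ 2 + complex.Im z ^+ 2.
Proof. by case: z => a b; rewrite sqr_sqrtr// addr_ge0// sqr_ge0. Qed.

Lemma cabs_sqE z : (cabs z ^+ 2)%:C = z * z^*.
Proof. by rewrite cabs_sq; case: z => a b /=; simpc; congr (_ +i* _); ring. Qed.

Lemma cabs_conj z : cabs z^* = cabs z.
Proof. by case: z => a b; rewrite /cabs /= sqrrN. Qed.

Lemma cabs_real x : cabs x%:C = `|x|.
Proof. by rewrite /cabs /= expr0n addr0 sqrtr_sqr. Qed.

Lemma cabs_nat n : cabs n%:R = n%:R.
Proof. by rewrite -(rmorph_nat (real_complex R)) cabs_real ger0_norm. Qed.

Lemma Re_le_cabs z : complex.Re z <= cabs z.
Proof.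
apply: le_trans (ler_norm _) _.
rewrite -(@ler_pXn2r _ 2)// ?nnegrE ?normr_ge0 ?cabs_ge0//.
by rewrite cabs_sq real_normK ?num_real// lerDl sqr_ge0.
Qed.

End ComplexModulus.

(** * The additive character and its distance to 1 *)

Section Cis.
Variable R : realType.
Implicit Types (x y : R).

Lemma sin_le_id x : 0 <= x -> sin x <= x.
Proof.
rewrite le_eqVlt => /orP[/eqP<-|x0]; first by rewrite sin0.
have := @MVT _ (@sin R) (@cos R) 0 x x0 (fun y _ => is_derive_sin y).
case=> [|c _]; first by apply: continuous_subspaceT; exact: continuous_sin.
rewrite sin0 !subr0 => ->.
by rewrite ler_piMl ?cos_le1// ltW.
Qed.

(** Concavity through the mean value theorem: if [sin x < 2 / pi * x], the chord over [[0, x]] has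
    slope below [2 / pi] and the one over [[x, pi / 2]] slope above it, although [cos] decreases. *)
Lemma jordan_sin x : 0 <= x <= pi / 2 -> 2 / pi * x <= sin x.
Proof.
move=> /andP[]; rewrite le_eqVlt => /orP[/eqP<-|x0]; first by rewrite sin0 mulr0.
rewrite le_eqVlt => /orP[/eqP->|xpi].
  by rewrite sin_pihalf; have := @pi_gt0 R; move=> ?; rewrite le_eqVlt; apply/orP; left; apply/eqP; field; lra.
rewrite leNgt; apply/negP => lt_sin.
have pi0 := @pi_gt0 R.
have ctn (a b : R) : {within `[a, b], continuous (@sin R)}%classic.
  by apply: continuous_subspaceT; exact: continuous_sin.
have [c1 c1I e1] := @MVT _ (@sin R) (@cos R) 0 x x0 (fun y _ => is_derive_sin y) (@ctn 0 x).
have [c2 c2I e2] := @MVT _ (@sin R) (@cos R) x (pi/2) xpi (fun y _ => is_derive_sin y) (@ctn x (pi/2)).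
move: e1 e2; rewrite sin0 sin_pihalf !subr0 => e1 e2.
move: c1I c2I; rewrite !in_itv/= => /andP[c10 c1x] /andP[xc2 c2p].
have lt1 : cos c1 < 2 / pi by rewrite -(ltr_pM2r x0) -e1.
have eqp : 1 - 2 / pi * x = 2 / pi * (pi / 2 - x) by field; lra.
have lt2 : 2 / pi < cos c2.
  have px : 0 < pi / 2 - x by rewrite subr_gt0.
  by rewrite -(ltr_pM2r px) -e2 -eqp ltrD2l ltrN2.
have : cos c2 < cos c1.
  by rewrite ltr_cos ?(lt_trans c1x)// in_itv/=; apply/andP; split; lra.
by move=> /(lt_trans lt2)/(lt_trans lt1); rewrite ltxx.
Qed.

(** The additive character [e(x) = exp (2 pi i x)], of period 1. *)
Definition cis x : R[i] := cos (2 * pi * x) +i* sin (2 * pi * x).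
Arguments cis : simpl never.

Lemma cis0 : cis 0 = 1.
Proof. by rewrite /cis mulr0 cos0 sin0. Qed.

Lemma cisD x y : cis (x + y) = cis x * cis y.
Proof.
rewrite /cis mulrDr cosD sinD; simpc.
by congr (_ +i* _); rewrite addrC.
Qed.

Lemma cisN x : cis (- x) = (cis x)^*.
Proof. by rewrite /cis mulrN cosN sinN. Qed.

Lemma cis1 : cis 1 = 1.
Proof. by rewrite /cis mulr1 mulr_natl cos2pi sin2pi. Qed.

Lemma cis_nat (n : nat) : cis n%:R = 1.
Proof.
elim: n => [|n IH]; first by rewrite cis0.
by rewrite -addn1 natrD cisD IH cis1 mulr1.
Qed.

Lemma cis_int (m : int) : cis m%:~R = 1.
Proof.
by case: m => n; rewrite ?NegzE ?mulrNz ?cisN cis_nat ?conjc1.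
Qed.

Lemma cisDint x (m : int) : cis (x + m%:~R) = cis x.
Proof. by rewrite cisD cis_int mulr1. Qed.

Lemma cisDnat x (n : nat) : cis (x + n%:R) = cis x.
Proof. by rewrite cisD cis_nat mulr1. Qed.

Lemma cabs_cis x : cabs (cis x) = 1.
Proof.
apply/eqP; rewrite -(@eqrXn2 _ 2)// ?cabs_ge0//.
by rewrite cabs_sq /= cos2Dsin2 expr1n.
Qed.

Lemma cisBM x y : cis x * (cis y)^* = cis (x - y).
Proof. by rewrite cisD cisN. Qed.

Lemma cabs_cisB1 x : cabs (cis x - 1) = 2 * `|sin (pi * x)|.
Proof.
apply/eqP; rewrite -(@eqrXn2 _ 2)// ?cabs_ge0// ?mulr_ge0//.
rewrite cabs_sq /cis /= exprMn real_normK ?num_real//.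
have -> : 2 * pi * x = (pi * x) *+ 2 by rewrite -mulrA mulr_natl.
rewrite cos_mulr2n sin_mulr2n subr0.
have := cos2Dsin2 (pi * x).
set c := cos _; set s := sin _ => cs.
have -> : c ^+ 2 = 1 - s ^+ 2 by rewrite -cs addrK.
rewrite exprMn_n exprMn; have -> : c ^+ 2 = 1 - s ^+ 2 by rewrite -cs addrK.
by apply/eqP; ring.
Qed.

Lemma cabs_cisB x y : cabs (cis x - cis y) = cabs (cis (x - y) - 1).
Proof.
rewrite -[RHS]mulr1 -(cabs_cis y) -cabsM mulrBl mul1r -cisD.
by rewrite subrK.
Qed.

Lemma cabs_cisB1_le x : cabs (cis x - 1) <= 2 * pi * `|x|.
Proof.
rewrite cabs_cisB1 -mulrA ler_wpM2l//.
have pi0 := @pi_ge0 R.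
have aux (y : R) : 0 <= y -> `|sin y| <= y.
  move=> y0; rewrite ler_norml; apply/andP; split; last exact: sin_le_id.
  have [y2|y2] := leP 1 y; first by apply: le_trans (sin_geN1 _); lra.
  have : 0 <= sin y by apply: sin_ge0_pi; rewrite y0/=; have := @pi_ge2 R; lra.
  lra.
have [x0|x0] := leP 0 x; first by rewrite (ger0_norm x0) aux// mulr_ge0.
rewrite (ltr0_norm x0) -normrN -sinN -mulrN aux// mulr_ge0//; lra.
Qed.

Lemma cabs_cisB1_ge x : `|x| <= 2^-1 -> 4 * `|x| <= cabs (cis x - 1).
Proof.
move=> x2; rewrite cabs_cisB1.
have pi0 := @pi_gt0 R.
have aux (y : R) : 0 <= y <= 2^-1 -> 2 * y <= `|sin (pi * y)|.
  move=> /andP[y0 y2]; apply: le_trans (ler_norm _).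
  have := @jordan_sin (pi * y); rewrite mulr_ge0 ?(ltW pi0)//= ler_pM2l// => /(_ y2).
  by congr (_ <= _); field; lra.
suff : 2 * `|x| <= `|sin (pi * x)| by lra.
have [x0|x0] := leP 0 x.
  by rewrite (ger0_norm x0) aux// x0/= -(ger0_norm x0).
rewrite (ltr0_norm x0) -[leRHS]normrN -sinN -mulrN aux//.
by rewrite -(ltr0_norm x0) x2 normr_ge0.
Qed.

Lemma cis_geometric y (n : nat) :
  (\sum_(k < n) cis (k%:R * y)) * (cis y - 1) = cis (n%:R * y) - 1.
Proof.
elim: n => [|n IH]; first by rewrite big_ord0 mul0r mul0r cis0 subrr.
rewrite big_ord_recr /= mulrDl IH -addn1 natrD mulrDl mul1r cisD.
by ring.
Qed.

End Cis.

Arguments conjc : simpl never.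

(** * Gauss sums and squares close to 0 mod q *)

Section GaussSums.
Variable R : realType.
Implicit Types (q h n m d : nat).

Definition gauss h q : R[i] := \sum_(a < q) cis ((h * a ^ 2)%:R / q%:R : R).

Lemma sum_shift_periodic (F : nat -> R[i]) q b :
  (forall a, F (a + q)%N = F a) -> \sum_(a < q) F (a + b)%N = \sum_(a < q) F a.
Proof.
move=> perF; elim: b => [|b IH]; first by under eq_bigr do rewrite addn0.
rewrite -{}IH; case: q perF => [|q] perF; first by rewrite !big_ord0.
rewrite big_ord_recr big_ord_recl /= addrC; congr (_ + _).
  by rewrite add0n addnS -addSn addnC perF.
by apply: eq_bigr => i _; rewrite addnS -addSn.
Qed.

Lemma sum_cis_linear q m : (0 < q)%N ->
  \sum_(b < q) cis (b%:R * (m%:R / q%:R) : R) = if (q %| m)%N then q%:R else 0.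
Proof.
move=> q0; have q0' : (q%:R : R) != 0 by rewrite pnatr_eq0 -lt0n.
case: ifPn => [/dvdnP[k ->]|qm].
  rewrite (eq_bigr (fun=> 1)) => [|b _]; first by rewrite sumr_const card_ord.
  by rewrite natrM mulfK// -natrM cis_nat.
set y := (_ / _); have := cis_geometric y q.
have -> : q%:R * y = m%:R by rewrite /y mulrC divfK.
rewrite cis_nat subrr => /eqP; rewrite mulf_eq0 => /orP[/eqP//|/eqP cy].
exfalso; move/negP: qm; apply.
pose r := (m %% q)%N.
have yE : cis (r%:R / q%:R : R) - 1 = 0.
  rewrite -cy; congr (_ - _); rewrite /y [in RHS](divn_eq m q) natrD natrM mulrDl.
  by rewrite mulfK// addrC cisDnat.
have rq : (r < q)%N by rewrite ltn_mod.
have y0 : 0 <= r%:R / q%:R :> R by rewrite divr_ge0.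
have y1 : r%:R / q%:R < 1 :> R by rewrite ltr_pdivrMr ?mul1r ?ltr_nat// ltr0n.
have {yE} : r%:R / q%:R = 0 :> R.
  have [le_half|gt_half] := leP (r%:R / q%:R : R) 2^-1.
    have := @cabs_cisB1_ge R (r%:R / q%:R).
    by rewrite yE cabs0 ger0_norm// => /(_ le_half) ?; lra.
  have := @cabs_cisB1_ge R (r%:R / q%:R - 1).
  rewrite cisD cisN cis1 conjc1 mulr1 yE cabs0 ltr0_norm; last by lra.
  by move=> H; have := H ltac:(lra); lra.
move/eqP; rewrite mulf_eq0 invr_eq0 (negbTE q0') orbF pnatr_eq0 => r0.
by rewrite /dvdn.
Qed.

Lemma card_multiples_lt d q : (0 < d)%N -> (d %| q)%N ->
  #|[set u : 'I_q | (d %| u)%N]| = (q %/ d)%N.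
Proof.
move=> d0 /dvdnP[k ->]; rewrite mulnK//.
have lt_mul (i : 'I_k) : (i * d < k * d)%N by rewrite ltn_pmul2r.
pose f (i : 'I_k) := Ordinal (lt_mul i).
have f_inj : injective f by move=> i j [/eqP]; rewrite eqn_pmul2r// => /eqP/val_inj.
rewrite -[RHS]card_ord -cardsT -(card_imset _ f_inj).
apply: eq_card => u; rewrite inE; apply/idP/imsetP => [/dvdnP[j uj]|[i _ ->]].
  have jk : (j < k)%N by rewrite -(ltn_pmul2r d0) -uj.
  by exists (Ordinal jk) => //; apply: val_inj.
exact: dvdn_mull.
Qed.

Lemma card_annihilated m q : (0 < q)%N ->
  #|[set u : 'I_q | (q %| m * u)%N]| = gcdn m q.
Proof.
move=> q0; have g0 : (0 < gcdn m q)%N by rewrite gcdn_gt0 q0 orbT.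
have [m' me] := dvdnP (dvdn_gcdl m q); have [q' qe] := dvdnP (dvdn_gcdr m q).
have q'0 : (0 < q')%N by move: q0; rewrite qe muln_gt0 => /andP[].
have q'm' : coprime q' m'.
  have : gcdn (m' * gcdn m q) (q' * gcdn m q) = gcdn m q by rewrite -me -qe.
  by rewrite -muln_gcdl -{2}[gcdn m q]mul1n => /eqP; rewrite eqn_pmul2r// gcdnC.
have q'q : (q' %| q)%N by rewrite qe dvdn_mulr.
have -> : gcdn m q = (q %/ q')%N by rewrite {2}qe mulKn.
rewrite -card_multiples_lt//; apply: eq_card => u; rewrite !inE.
have -> : (q %| m * u)%N = (q' * gcdn m q %| m' * u * gcdn m q)%N.
  by rewrite -qe mulnAC -me.
by rewrite dvdn_pmul2r// Gauss_dvdr.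
Qed.

(** Weyl differencing: after the shift [a = u + b] the phase of [G * G^*] is linear in [b] with
    frequency [2 h u / q], so the sum over [b] leaves the [u] with [q | 2 h u], and there are
    [gcd (2 h, q)] of them. *)
Lemma gauss_sq_le h q : (0 < h)%N -> (0 < q)%N ->
  cabs (gauss h q) ^+ 2 <= 2 * q%:R * (gcdn h q)%:R.
Proof.
move=> h0 q0; have q0' : (q%:R : R) != 0 by rewrite pnatr_eq0 -lt0n.
have perG a b : cis ((h * (a + q + b) ^ 2)%:R / q%:R : R) = cis ((h * (a + b) ^ 2)%:R / q%:R).
  rewrite -[RHS](cisDnat _ (2 * h * (a + b) + h * q)); congr cis.
  by rewrite !(natrX, natrD, natrM); field.
have GG : gauss h q * (gauss h q)^* =
    \sum_(u < q) cis ((h * u ^ 2)%:R / q%:R : R)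
      * (if (q %| 2 * h * u)%N then q%:R else 0).
  transitivity (\sum_(b < q) \sum_(u < q)
      cis ((h * (u + b) ^ 2)%:R / q%:R : R) * (cis ((h * b ^ 2)%:R / q%:R))^*).
    rewrite [X in _ * X]rmorph_sum /= mulr_sumr; apply: eq_bigr => b _.
    rewrite -big_distrl /=; congr (_ * _).
    rewrite (sum_shift_periodic (F := fun a => cis ((h * a ^ 2)%:R / q%:R : R)))// => a.
    by have := perG a 0%N; rewrite !addn0.
  rewrite exchange_big /=; apply: eq_bigr => u _.
  rewrite -sum_cis_linear// mulr_sumr; apply: eq_bigr => b _.
  rewrite cisBM -cisD; congr cis.
  by rewrite !(natrX, natrD, natrM); field.
have -> : cabs (gauss h q) ^+ 2 = cabs (gauss h q * (gauss h q)^*).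
  by rewrite cabsM cabs_conj.
rewrite GG; apply: le_trans (cabs_sum _ _ _) _.
have -> : \sum_(u < q) cabs (cis ((h * u ^ 2)%:R / q%:R : R)
      * (if (q %| 2 * h * u)%N then q%:R else 0)) =
    \sum_(u < q | u \in [set u : 'I_q | (q %| 2 * h * u)%N]) q%:R.
  rewrite [RHS]big_mkcond /=; apply: eq_bigr => u _.
  rewrite cabsM cabs_cis mul1r inE; case: ifP => _; by rewrite ?cabs0 ?cabs_nat.
rewrite sumr_const card_annihilated// -[leLHS]mulr_natl [leRHS]mulrAC ler_wpM2r//.
rewrite -natrM ler_nat dvdn_leq ?muln_gt0 ?gcdn_gt0 ?h0//.
by rewrite muln_gcdr dvdn_gcd dvdn_gcdl (dvdn_trans (dvdn_gcdr _ _))// dvdn_mull.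
Qed.

(* The residues [a] with [||a ^ 2 / q|| <= 1 / (2 H)]. *)
Definition near_sq q H : {set 'I_q} := [set a : 'I_q |
  (2 * H * ((a ^ 2) %% q) <= q)%N || (2 * H * (q - (a ^ 2) %% q) <= q)%N].

(** The positive frequencies of the Fejer kernel, summed over the squares mod [q]; the negative ones
    are recovered by the real part, and [d = 0] contributes [H q]. *)
Definition gauss_fejer H q : R[i] := \sum_(1 <= d < H) (H - d)%:R * gauss d q.

(** The Fejer identity with the frequencies [d] and [- d] paired; [d = 0] is then counted twice,
    hence the [- H]. *)
Lemma dirichlet_sq (y : R) H : cabs (\sum_(h < H) cis (h%:R * y)) ^+ 2 =
  2 * complex.Re (\sum_(d < H) (H - d)%:R * cis (d%:R * y)) - H%:R.
Proof.
elim: H => [|H IH]; first by rewrite !big_ord0 cabs0 expr0n/= mulr0 subrr.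
have splitw : \sum_(d < H.+1) (H.+1 - d)%:R * cis (d%:R * y) =
    \sum_(d < H) (H - d)%:R * cis (d%:R * y) + \sum_(d < H.+1) cis (d%:R * y).
  transitivity (\sum_(d < H.+1) ((H - d)%:R * cis (d%:R * y) + cis (d%:R * y))).
    apply: eq_bigr => d _; rewrite subSn ?leq_ord// -natr1 mulrDl mul1r//.
  by rewrite big_split /= big_ord_recr /= subnn mul0r addr0.
set P := \sum_(h < H) cis (h%:R * y) in IH.
set D := \sum_(d < H) _ in IH *.
rewrite splitw -/D.
have revE : P * (cis (H%:R * y))^* = (\sum_(d < H.+1) cis (d%:R * y) - 1)^*.
  rewrite big_ord_recl /= mul0r cis0 addrC addKr mulr_suml rmorph_sum /=.
  rewrite (reindex_inj rev_ord_inj) /=; apply: eq_bigr => i _.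
  rewrite cisBM. rewrite -cisN; congr cis; rewrite natrB// /bump /=.
  by rewrite add1n; ring.
have Pe : \sum_(h < H.+1) cis (h%:R * y) = P + cis (H%:R * y) by rewrite big_ord_recr.
have sq2 (z w : R[i]) : cabs (z + w) ^+ 2 = cabs z ^+ 2 + cabs w ^+ 2 + 2 * complex.Re (z * w^*).
  by rewrite !cabs_sq; case: z w => a b [c e]; rewrite /conjc /=; ring.
rewrite [X in cabs X]Pe sq2 IH revE cabs_cis expr1n -[H.+1%:R]natr1 /conjc.
case: D {IH revE Pe splitw} => D1 D2; case: (\sum_(d < H.+1) _) => S1 S2 /=; ring.
Qed.

Lemma pi_lt4 : pi < 4 :> R.
Proof. by have := @pihalf_02 R; lra. Qed.

(** In [|D| |e(y) - 1| = |e(H y) - 1|], the right side is at least [4 H |y|] and [|e(y) - 1|] at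
    most [2 pi |y|]; so [|D| >= 2 H / pi], and [pi < 4]. *)
Lemma dirichlet_ge (y : R) H : (0 < H)%N -> `|y| <= (2 * H%:R)^-1 ->
  H%:R / 2 <= cabs (\sum_(h < H) cis (h%:R * y)).
Proof.
move=> H0 yH; have H0' : 0 < (H%:R : R) by rewrite ltr0n.
have [->|y0] := eqVneq y 0.
  under eq_bigr do rewrite mulr0 cis0.
  by rewrite sumr_const card_ord cabs_nat; lra.
have y0' : 0 < `|y| by rewrite normr_gt0.
have Hy : `|H%:R * y| <= 2^-1.
  rewrite normrM ger0_norm ?(ltW H0')//.
  by move: yH; rewrite -(ler_pM2l H0') invfM mulrCA mulfV ?mulr1// gt_eqF.
have lo := cabs_cisB1_ge Hy.
have up := cabs_cisB1_le y.
rewrite -cis_geometric cabsM in lo.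
set P := cabs (\sum_(_ < _) _) in lo *; have P0 : 0 <= P by exact: cabs_ge0.
have : 4 * `|H%:R * y| <= P * (2 * pi * `|y|).
  by apply: le_trans lo _; rewrite ler_wpM2l.
rewrite normrM (ger0_norm (ltW H0')) !mulrA ler_pM2r// => le1.
have : P * 2 * pi <= P * 2 * 4 by rewrite ler_wpM2l ?mulr_ge0// ltW// pi_lt4.
lra.
Qed.

(** A Markov inequality: by [dirichlet_ge] each near residue contributes at least [(H / 2) ^ 2] to
    the sum of squared Dirichlet kernels, which equals [H q + 2 Re (gauss_fejer H q)]. *)
Lemma card_near_sq_le q H : (0 < q)%N -> (0 < H)%N ->
  #|near_sq q H|%:R <= 4 * q%:R / H%:R + 8 * cabs (gauss_fejer H q) / H%:R ^+ 2 :> R.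
Proof.
move=> q0 H0; have q0' : 0 < (q%:R : R) by rewrite ltr0n.
have H0' : 0 < (H%:R : R) by rewrite ltr0n.
pose F (a : 'I_q) : R := cabs (\sum_(h < H) cis (h%:R * ((a ^ 2)%:R / q%:R : R))) ^+ 2.
have le1 : #|near_sq q H|%:R * (H%:R / 2) ^+ 2 <= \sum_(a < q) F a.
  rewrite -mulr_natl mulr1 -sumr_const big_distrl /= [leRHS](bigID (mem (near_sq q H))) /=.
  rewrite -[leLHS]addr0 lerD//; last by apply: sumr_ge0 => a _; exact: sqr_ge0.
  apply: ler_sum => a; rewrite inE mul1r => aN.
  set r := (a ^ 2 %% q)%N in aN.
  have [j [y [yE yH]]] : exists j : int, exists y : R,
      (a ^ 2)%:R / q%:R = y + j%:~R /\ `|y| <= (2 * H%:R)^-1.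
    have e0 : (a ^ 2)%:R / q%:R = r%:R / q%:R + (a ^ 2 %/ q)%:R :> R.
      by rewrite {1}(divn_eq (a ^ 2) q) natrD natrM mulrDl mulfK ?gt_eqF// addrC.
    have rq : (r < q)%N by rewrite ltn_mod.
    have H2 : 0 < 2 * H%:R :> R by rewrite mulr_gt0.
    case/orP: aN => aN.
      exists (a ^ 2 %/ q)%:Z, (r%:R / q%:R); split => //.
      rewrite ger0_norm ?divr_ge0// ler_pdivrMr// mulrC ler_pdivlMr//.
      by rewrite mulrC -!natrM ler_nat.
    exists (a ^ 2 %/ q).+1%:Z, (r%:R / q%:R - 1); split.
      rewrite e0 -addrA; congr (_ + _); rewrite -[_%:~R]/((_.+1)%:R) -natr1; ring.
    rewrite ler0_norm; last by rewrite subr_le0 ler_pdivrMr// mul1r ler_nat ltnW.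
    have -> : - (r%:R / q%:R - 1) = (q - r)%:R / q%:R :> R.
      by rewrite natrB 1?ltnW//; field; lra.
    rewrite ler_pdivrMr// mulrC ler_pdivlMr//.
    by rewrite mulrC -!natrM ler_nat.
  rewrite /F ler_pXn2r ?nnegrE ?cabs_ge0 ?divr_ge0 ?(ltW H0')//.
  apply: le_trans (dirichlet_ge H0 yH) _; rewrite le_eqVlt; apply/orP; left; apply/eqP.
  congr cabs; apply: eq_bigr => h _; rewrite yE mulrDr.
  by rewrite -[h%:R * j%:~R]/(h%:~R * j%:~R) -intrM cisDint.
have FE : \sum_(a < q) F a = H%:R * q%:R + 2 * complex.Re (gauss_fejer H q).
  transitivity (2 * complex.Re (\sum_(d < H) (H - d)%:R * gauss d q) - H%:R * q%:R).
    under eq_bigr do rewrite /F dirichlet_sq.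
    rewrite sumrB sumr_const card_ord mulr_natr -mulr_sumr; congr (2 * _ - _).
    have -> : \sum_(a < q) complex.Re (\sum_(d < H) (H - d)%:R * cis (d%:R * ((a ^ 2)%:R / q%:R : R)))
       = complex.Re (\sum_(a < q) \sum_(d < H) (H - d)%:R * cis (d%:R * ((a ^ 2)%:R / q%:R : R))).
      by rewrite Re_sum.
    congr complex.Re; rewrite exchange_big /=; apply: eq_bigr => d _.
    rewrite -mulr_sumr; congr (_ * _); apply: eq_bigr => a _.
    by rewrite natrM mulrA.
  rewrite /gauss_fejer; case: H H0 {le1 H0' F} => // H _.
  rewrite big_ord_recl /= subn0 big_add1 /= big_mkord.
  have -> : gauss 0 q = q%:R.
    by rewrite /gauss; under eq_bigr do rewrite mul0n mul0r cis0; rewrite sumr_const card_ord.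
  under eq_bigr do rewrite /bump/= add1n.
  rewrite -natrM -(rmorph_nat (real_complex R)).
  by case: (\sum_(_ < _) _) => x y /=; rewrite natrM; ring.
have le2 := Re_le_cabs (gauss_fejer H q).
move: le1; rewrite FE => le1.
have {le1 le2} le3 : #|near_sq q H|%:R * (H%:R / 2) ^+ 2 <= H%:R * q%:R + 2 * cabs (gauss_fejer H q).
  by apply: le_trans le1 _; rewrite lerD2l ler_pM2l.
have pos : 0 < (H%:R / 2) ^+ 2 :> R by rewrite exprn_gt0// divr_gt0.
move: le3; rewrite -ler_pdivlMr// => /le_trans; apply.
by rewrite le_eqVlt; apply/orP; left; apply/eqP; field; lra.
Qed.

End GaussSums.

(** * Divisor bounds *)

Section DivisorBounds.
Local Open Scope nat_scope.
Implicit Types (q n m d e k : nat).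

Definition tau n := size (divisors n).

Lemma tau_gt0 n : 0 < tau n.
Proof. by have := divisor1 n; rewrite /tau; case: (divisors n). Qed.

Lemma tauE n : tau n = \sum_(d <- divisors n) 1.
Proof. by rewrite sum1_size. Qed.

(** A divisor [d] of [m n] is determined by [gcd (d, m)], which divides [m], and [d / gcd (d, m)],
    which divides [n]. *)
Lemma tau_mul_le m n : 0 < m -> 0 < n -> tau (m * n) <= tau m * tau n.
Proof.
move=> m0 n0; have mn0 : 0 < m * n by rewrite muln_gt0 m0.
rewrite /tau -(size_allpairs pair); pose f d := (gcdn d m, d %/ gcdn d m).
have f_inj : injective f.
  by move=> x y [e1 e2]; rewrite -[x](divnK (dvdn_gcdl x m)) e2 e1 divnK ?dvdn_gcdl.
rewrite -(size_map f); apply: uniq_leq_size; first by rewrite map_inj_uniq ?divisors_uniq.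
move=> _ /mapP[d dmn ->]; apply/allpairsP; exists (f d); split => //.
  by rewrite -dvdn_divisors// dvdn_gcdr.
move: dmn; rewrite -!dvdn_divisors//= => dmn.
have g0 : 0 < gcdn d m by rewrite gcdn_gt0 m0 orbT.
rewrite -(dvdn_pmul2r g0) divnK ?dvdn_gcdl// mulnC muln_gcdl dvdn_gcd.
by rewrite dvdn_mulr//= .
Qed.

(** [gcd (d, q)] is one term in the sum of the common divisors [e] of [d] and [q]; for a fixed [e],
    its multiples below [H] contribute at most [H]. *)
Lemma sum_gcd_le q H : 0 < q -> \sum_(1 <= d < H) gcdn d q <= H * tau q.
Proof.
move=> q0; case: H => [|H]; first by rewrite big_geq.
apply: (@leq_trans (\sum_(1 <= d < H.+1) \sum_(e <- divisors q) e * (e %| d))).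
  apply: leq_sum => d _.
  rewrite (bigD1_seq (gcdn d q)) ?divisors_uniq//= -?dvdn_divisors ?dvdn_gcdr//.
  by rewrite dvdn_gcdl muln1 leq_addr.
rewrite exchange_big /= tauE big_distrr /= [leqRHS]big_seq big_seq.
apply: leq_sum => e eq; rewrite -big_distrr /= -divn_count_dvd muln1.
by rewrite mulnC (leq_trans (leq_trunc_div _ _)).
Qed.

Lemma card_same_residue n L e (S : {set 'I_n}) : 0 < L -> n = L * e ->
  (forall x y, x \in S -> y \in S -> x = y %[mod L]) -> #|S| <= e.
Proof.
move=> L0 nLe resS; have [x0 x0S|S0] := pickP (mem S); last by rewrite eq_card0.
have lt (x : 'I_n) : x %/ L < e by rewrite ltn_divLR// mulnC -nLe.
pose f (x : 'I_n) : 'I_e := Ordinal (lt x).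
have f_inj : {in S &, injective f}.
  move=> x y xS yS [fxy]; apply: val_inj => /=.
  by rewrite (divn_eq x L) (divn_eq y L) fxy (resS x y).
by rewrite -[leqRHS]card_ord -(card_in_imset f_inj) max_card.
Qed.

(* A square root of [x0 ^ 2] mod [n] lies in some class [x0] mod [d], [- x0] mod
   [n / d] with [d = gcd n (x - x0)]; [self_gcd n d] is the number of elements of
   such a nonempty class. *)
Definition self_gcd n d := gcdn d (n %/ d).

(* [x + x0 * n.-1] stands for [x - x0] mod [n]. *)
Lemma card_split_roots n d x0 : 0 < n -> d %| n ->
  #|[set x : 'I_n | (d %| x + x0 * n.-1) && (n %/ d %| x + x0)]| <=
    (if self_gcd n d %| 2 * x0 then self_gcd n d else 0).
Proof.
move=> n0 dn; set S := [set x | _]; set e := self_gcd n d.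
have nd : n %/ d * d = n by rewrite divnK.
have d0 : 0 < d by move: n0; rewrite -nd muln_gt0 => /andP[].
have e_d : e %| d by exact: dvdn_gcdl.
have e_n : e %| n %/ d by exact: dvdn_gcdr.
have en : e %| n by rewrite (dvdn_trans e_d).
have [x xS|S0] := pickP (mem S); last by rewrite eq_card0//; case: ifP.
have -> : e %| 2 * x0.
  have : x \in S := xS; rewrite inE => /andP[h1 h2].
  rewrite -(dvdn_addr _ (dvdn_trans e_d h1)).
  have -> : x + x0 * n.-1 + 2 * x0 = (x + x0) + x0 * n.
    by rewrite -[X in _ = _ + _ * X](prednK n0) mulnS mul2n -addnn; ring.
  by apply: dvdn_add; [exact: dvdn_trans h2|exact: dvdn_mull].
(* The two congruences fix [x] mod [L], and [n] is [L] times [e]. *)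
pose L := lcmn d (n %/ d).
have nE : n = L * e by rewrite muln_lcm_gcd mulnC nd.
have L0 : 0 < L by move: n0; rewrite nE muln_gt0 => /andP[].
have wlg (a b c m : nat) : m %| a + c -> m %| b + c -> a = b %[mod m].
  by move=> h1 h2; apply/eqP; rewrite -(eqn_modDr c) (eqP h1) (eqP h2).
have res (a b : 'I_n) : a \in S -> b \in S -> a = b %[mod L].
  rewrite !inE => /andP[a1 a2] /andP[b1 b2].
  have := wlg _ _ _ _ a1 b1; have := wlg _ _ _ _ a2 b2 => h2 h1.
  have [lt_ab|/ltnW le_ba] := leqP a b.
    apply/esym/eqP; rewrite eqn_mod_dvd// dvdn_lcm -!eqn_mod_dvd//.
    by rewrite h1 h2 !eqxx.
  apply/eqP; rewrite eqn_mod_dvd// dvdn_lcm -!eqn_mod_dvd//.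
  by rewrite h1 h2 !eqxx.
exact: card_same_residue nE res.
Qed.

Lemma card_roots_le n x0 : 0 < n ->
  #|[set x : 'I_n | x ^ 2 == x0 ^ 2 %[mod n]]| <=
    \sum_(d <- divisors n) (if self_gcd n d %| 2 * x0 then self_gcd n d else 0).
Proof.
move=> n0; set A := [set x | _].
pose S d := [set x : 'I_n | (d %| x + x0 * n.-1) && (n %/ d %| x + x0)].
apply: (@leq_trans (\sum_(d <- divisors n) #|S d|)); last first.
  rewrite big_seq [leqRHS]big_seq; apply: leq_sum => d; rewrite -dvdn_divisors//.
  exact: card_split_roots.
under eq_bigr do rewrite -sum1dep_card big_mkcond /=.
rewrite exchange_big /= -sum1_card big_mkcond /=; apply: leq_sum => x _.
case: ifP => //; rewrite inE => xA; pose d := gcdn n (x + x0 * n.-1).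
have dn : d %| n by exact: dvdn_gcdl.
rewrite (bigD1_seq d) ?divisors_uniq//= -?dvdn_divisors//.
have -> : (d %| x + x0 * n.-1) by exact: dvdn_gcdr.
suff -> : n %/ d %| x + x0 by [].
have d0 : 0 < d by rewrite gcdn_gt0 n0.
rewrite -(@Gauss_dvdr _ ((x + x0 * n.-1) %/ d)); last first.
  by rewrite /coprime -(eqn_pmul2r d0) muln_gcdl !divnK ?dvdn_gcdr// mul1n.
rewrite -(dvdn_pmul2r d0) divnK// mulnAC divnK ?dvdn_gcdr//.
rewrite -(dvdn_addl _ (dvdn_mulr (x0 ^ 2) (dvdnn n))).
have aux (p y : nat) : (y + x0 * p) * (y + x0) + p.+1 * x0 ^ 2 =
    y ^ 2 + x0 ^ 2 * p + p.+1 * (y * x0) + x0 ^ 2 * p.+1 by ring.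
have {aux} := aux n.-1 x; rewrite prednK// => ->.
rewrite dvdn_addl ?dvdn_mull// dvdn_addl ?dvdn_mulr//.
by rewrite /dvdn -modnDml (eqP xA) modnDml -mulnS prednK// modnMl.
Qed.

Lemma dvdn_cofactor a b k : 0 < a -> a %| b * k -> a %/ gcdn a b %| k.
Proof.
move=> a0; have g0 : 0 < gcdn a b by rewrite gcdn_gt0 a0.
have co : coprime (a %/ gcdn a b) (b %/ gcdn a b).
  by rewrite /coprime -(eqn_pmul2r g0) muln_gcdl !divnK ?dvdn_gcdl ?dvdn_gcdr// mul1n.
have ea := divnK (dvdn_gcdl a b); have eb := divnK (dvdn_gcdr a b).
rewrite -{1}ea -{3}eb mulnAC dvdn_pmul2r//.
by rewrite Gauss_dvdr.
Qed.

(** For [q > 0], the largest [k] whose square divides [q], in a form that avoids factorizations. *)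
Definition sq_kernel q := #|[set a : 'I_q | q %| a ^ 2]|.

(** Up to sign the squares involved are residues [k <= M]. The residue 0 costs [sq_kernel q]. For
    [k > 0], [card_roots_le] counts a divisor [d] with weight [e = self_gcd q d] only if
    [e ^ 2 | 4 k], which holds for at most [4 M / e] of the [k <= M]; so each [d] costs at most
    [4 M] per sign. *)
Lemma card_near_sq_tau q H : 0 < q -> 0 < H ->
  #|near_sq q H| <= sq_kernel q + 8 * (q %/ (2 * H)) * tau q.
Proof.
move=> q0 H0; set M := q %/ (2 * H).
have H20 : 0 < 2 * H by rewrite muln_gt0.
pose A (k : nat) := [set a : 'I_q | (a ^ 2 + k) %% q == 0].
pose B (k : nat) := [set a : 'I_q | a ^ 2 == k %[mod q]].
pose E k := \sum_(d <- divisors q) (if self_gcd q d ^ 2 %| 4 * k then self_gcd q d else 0).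
have bound (S : {set 'I_q}) k : (forall a b, a \in S -> b \in S -> a ^ 2 == b ^ 2 %[mod q]) ->
    (forall a e, a \in S -> e %| q -> e %| 4 * a ^ 2 -> e %| 4 * k) -> #|S| <= E k.
  move=> Ssq Sk; have [a aS|S0] := pickP (mem S); last by rewrite eq_card0.
  apply: (@leq_trans #|[set x : 'I_q | x ^ 2 == a ^ 2 %[mod q]]|).
    by apply: subset_leq_card; apply/fintype.subsetP => b bS; rewrite inE Ssq.
  apply: leq_trans (card_roots_le _ q0) _.
  rewrite big_seq [leqRHS]big_seq; apply: leq_sum => d; rewrite -dvdn_divisors// => dq.
  (* Squaring [e | 2 a] yields a condition on [k] alone: [e ^ 2] divides [q], mod which [4 a ^ 2] is
     [4 k] up to sign. *)
  case: ifP => // e2a; rewrite ifT//; apply: (Sk a) => //.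
    have : self_gcd q d * self_gcd q d %| q %/ d * d.
      by apply: dvdn_mul; [exact: dvdn_gcdr|exact: dvdn_gcdl].
    by rewrite divnK// expnS expn1.
  by rewrite -[4]/(2 ^ 2) -expnMn dvdn_exp2r.
have Ak k : #|A k| <= E k.
  apply: bound => [a b|a e]; rewrite !inE.
    by move=> h1 h2; rewrite -(eqn_modDr k) (eqP h1) (eqP h2).
  move=> h1 eq ea; rewrite -(dvdn_addr _ ea) -mulnDr dvdn_mull//.
  exact: dvdn_trans h1.
have Bk k : #|B k| <= E k.
  apply: bound => [a b|a e]; rewrite !inE; first by move=> /eqP-> /eqP->.
  move=> h1 eq ea; have : 4 * a ^ 2 == 4 * k %[mod q] by rewrite -modnMmr (eqP h1) modnMmr.
  move=> /eqP h2; rewrite /dvdn -(modn_dvdm _ eq) -h2 modn_dvdm//.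
have cover : near_sq q H \subset [set a : 'I_q | q %| a ^ 2]
    :|: \bigcup_(k < M) (A k.+1 :|: B k.+1).
  apply/fintype.subsetP => a; rewrite !inE; set r := (a ^ 2 %% q).
  have [r0 _|r0 h] := posnP r; first by rewrite /dvdn -/r r0.
  have rq : r < q by rewrite ltn_mod.
  apply/orP; right; case/orP: h => h.
    have rM : r.-1 < M by rewrite prednK// leq_divRL// mulnC.
    apply/bigcupP; exists (Ordinal rM) => //=; rewrite prednK// !inE.
    by rewrite [r %% q]modn_mod eqxx orbT.
  have rM : (q - r).-1 < M by rewrite prednK ?subn_gt0// leq_divRL// mulnC.
  apply/bigcupP; exists (Ordinal rM) => //=; rewrite prednK ?subn_gt0// !inE.
  by rewrite -modnDml -/r subnKC ?modnn// ltnW.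
apply: leq_trans (subset_leq_card cover) _.
apply: leq_trans (leq_card_setU _ _) _; rewrite leq_add2l.
apply: (@leq_trans (\sum_(k < M) (2 * E k.+1))).
  elim/big_rec2: _ => [|k y S _ le_Sy]; first by rewrite cards0.
  apply: leq_trans (leq_card_setU _ _) _; apply: leq_add => //.
  by apply: leq_trans (leq_card_setU _ _) _; rewrite mul2n -addnn leq_add.
rewrite -big_distrr /= exchange_big /= big_distrr /= tauE big_distrr /= muln1.
apply: leq_sum => d _; set e := self_gcd q d.
have [->|e0] := posnP e; first by rewrite big1// => k _; case: ifP.
pose g := e ^ 2 %/ gcdn (e ^ 2) 4.
have e20 : 0 < e ^ 2 by rewrite expn_gt0 e0.
have g40 : 0 < gcdn (e ^ 2) 4 by rewrite gcdn_gt0 e20.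
have ge : g * gcdn (e ^ 2) 4 = e ^ 2 by rewrite divnK// dvdn_gcdl.
have g0 : 0 < g by move: e20; rewrite -ge muln_gt0 => /andP[].
have gdvd k : e ^ 2 %| 4 * k -> g %| k by exact: dvdn_cofactor.
apply: (@leq_trans (2 * (e * \sum_(1 <= k < M.+1) (g %| k)))).
  rewrite leq_pmul2l// big_distrr /= big_add1 /= big_mkord; apply: leq_sum => k _.
  by case: ifP => // /gdvd ->; rewrite muln1.
rewrite -divn_count_dvd -[8]/(2 * 4) -mulnA leq_pmul2l//.
have le_e : e <= 4 * g.
  apply: (@leq_trans (e ^ 2)); first by rewrite expnS expn1 leq_pmulr.
  by rewrite -ge mulnC leq_mul2r dvdn_leq ?dvdn_gcdr// orbT.
apply: leq_trans (leq_mul le_e (leqnn _)) _.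
by rewrite -mulnA leq_pmul2l// mulnC leq_trunc_div.
Qed.

End DivisorBounds.

(** * Landsberg-Schaar reciprocity *)

Section LandsbergSchaar.
Variable R : realType.
Implicit Types (q h n m d K : nat).

Lemma sum_nat_mul (F : nat -> R[i]) A m :
  \sum_(a < A * m) F a = \sum_(x < A) \sum_(y < m) F (x + A * y)%N.
Proof.
rewrite exchange_big /=; elim: m => [|m IH]; first by rewrite muln0 !big_ord0.
rewrite big_ord_recr /= -IH mulnS addnC -!(big_mkord xpredT) /=.
rewrite (big_cat_nat _ (n := A * m)) ?leq_addr//=; congr (_ + _).
rewrite -{1}[(A * m)%N]add0n big_addn addKn.
by rewrite big_mkord.
Qed.

Lemma sum_multiples (F : nat -> R[i]) A m : (0 < m)%N ->
  \sum_(a < A * m) (if (m %| a)%N then F a else 0) = \sum_(z < A) F (m * z)%N.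
Proof.
move=> m0; rewrite mulnC (sum_nat_mul (fun a => if (m %| a)%N then F a else 0)); case: m m0 => // m _.
rewrite big_ord_recl /= [X in _ + X]big1 ?addr0.
  by apply: eq_bigr => z _; rewrite add0n dvdn_mulr.
move=> i _; rewrite big1// => z _; rewrite dvdn_addl ?dvdn_mulr// ifF//.
by apply: gtnNdvd => //; rewrite /bump /= add1n ltnS ltn_ord.
Qed.

(** With [a = x + q m y], the sum over [y] vanishes unless [m | 2 h x], that is [m | x]; the terms
    [x = m z] give back [gauss h q]. *)
Lemma gauss_mul_sq h q m : (0 < q)%N -> (0 < m)%N -> coprime m (2 * h) ->
  gauss R h (q * m ^ 2) = m%:R * gauss R h q.
Proof.
move=> q0 m0 co.
have q0' : (q%:R : R) != 0 by rewrite pnatr_eq0 -lt0n.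
have m0' : (m%:R : R) != 0 by rewrite pnatr_eq0 -lt0n.
rewrite /gauss; have -> : (q * m ^ 2 = q * m * m)%N by rewrite -mulnA.
rewrite (sum_nat_mul (fun a => cis ((h * a ^ 2)%:R / (q * m * m)%:R : R))).
transitivity (\sum_(x < q * m) (if (m %| x)%N then
    m%:R * cis ((h * x ^ 2)%:R / (q * m * m)%:R : R) else 0)).
  apply: eq_bigr => x _.
  transitivity (\sum_(y < m) cis ((h * x ^ 2)%:R / (q * m * m)%:R : R) *
      cis (y%:R * ((2 * h * x)%:R / m%:R) : R)).
    apply: eq_bigr => y _; rewrite -cisD -[RHS](cisDnat _ (h * q * y ^ 2)); congr cis.
    by rewrite !(natrX, natrD, natrM); field; rewrite q0' m0'.
  rewrite -mulr_sumr sum_cis_linear// Gauss_dvdr//.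
  by case: ifP => _; rewrite ?mulr0// mulrC.
rewrite (sum_multiples (fun x => m%:R * cis ((h * x ^ 2)%:R / (q * m * m)%:R : R)))//.
rewrite -mulr_sumr; congr (_ * _); apply: eq_bigr => z _; congr cis.
by rewrite !(natrX, natrD, natrM); field; rewrite q0' m0'.
Qed.

Definition imagc : R[i] := 0 +i* 1.

Lemma cis_quarter : cis (4^-1 : R) = imagc.
Proof.
rewrite /cis; have -> : 2 * pi * 4^-1 = pi / 2 :> R by field.
by rewrite cos_pihalf sin_pihalf.
Qed.

Lemma gauss14 : gauss R 1 4 = 2 * (1 + imagc).
Proof.
rewrite /gauss !big_ord_recr big_ord0 /= add0r.
have -> : (1 * 0 ^ 2)%:R / 4%:R = 0 :> R by rewrite mul0r.
have -> : (1 * 1 ^ 2)%:R / 4%:R = 4^-1 :> R by rewrite mul1r.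
have -> : (1 * 2 ^ 2)%:R / 4%:R = 1 :> R by rewrite divff// pnatr_eq0.
have -> : (1 * 3 ^ 2)%:R / 4%:R = 4^-1 + 2%:R :> R by field.
rewrite cisDnat cis0 cis1 cis_quarter; ring.
Qed.

(** One side of a stationary point: the derivative of the phase vanishes at [k = - theta] and
    reaches [1 / 2] at [k + theta = N], half way to the next point where it is an integer. *)
Definition chirp (N theta : R) n : R[i] :=
  \sum_(k < n) cis ((k%:R + theta) ^+ 2 / (4 * N)).

(** Source of the main term: [gauss_mul_sq] evaluates [G(1, 4 m ^ 2)] from [G(1, 4)], and the
    symmetries [k -> k + 2 M] and [k -> 2 M - k] of the phase fold the sum onto a quarter of its
    range. The error [(1 - F M) / 2] comes from the end points. *)
Lemma chirp_square m : odd m ->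
  cabs (chirp (m ^ 2)%:R 0 (m ^ 2) - m%:R / 2 * (1 + imagc)) <= 1.
Proof.
move=> om; have m0 : (0 < m)%N by case: m om.
have [M ME] : exists M, M = (m ^ 2)%N by exists (m ^ 2)%N.
rewrite -ME; have M0 : (0 < M)%N by rewrite ME expn_gt0 m0.
have M0' : (M%:R : R) != 0 by rewrite pnatr_eq0 -lt0n.
have G1 : gauss R 1 (4 * M) = 2 * m%:R * (1 + imagc).
  by rewrite ME gauss_mul_sq ?muln1 ?coprimen2// gauss14; ring.
pose F k : R[i] := cis ((1 * k ^ 2)%:R / (4 * M)%:R : R).
have G2 : gauss R 1 (4 * M) = 2 * \sum_(k < 2 * M) F k.
  transitivity (\sum_(k < 2 * M * 2) F k).
    by have -> : (2 * M * 2 = 4 * M)%N by rewrite mulnAC.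
  rewrite (sum_nat_mul F) mulr_sumr; apply: eq_bigr => k _.
  rewrite !big_ord_recr big_ord0 /= add0r muln0 addn0 mulr_natl mulr2n; congr (_ + _).
  rewrite /F muln1 -[RHS](cisDnat _ (k + M)); congr cis.
  by rewrite !(natrX, natrD, natrM); field; exact: M0'.
have SE : chirp M%:R 0 M = \sum_(k < M) F k.
  by apply: eq_bigr => k _; rewrite /F addr0 mul1n natrX natrM.
have G3 : \sum_(k < 2 * M) F k = chirp M%:R 0 M + chirp M%:R 0 M - 1 + F M.
  rewrite SE -addrA -addrA; rewrite mul2n -addnn big_split_ord /=; congr (_ + _).
  have -> : \sum_(i < M) F (M + i)%N = \sum_(i < M) F i.+1.
    rewrite (reindex_inj rev_ord_inj) /=; apply: eq_bigr => j _.
    have jM : (j < M)%N by exact: ltn_ord.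
    rewrite /F -(cisDnat ((1 * j.+1 ^ 2)%:R / _) (M - j.+1)); congr cis.
    rewrite !(natrX, natrD, natrM) !natrB//; field; exact: M0'.
  have : \sum_(i < M.+1) F i = F 0%N + \sum_(i < M) F i.+1 by rewrite big_ord_recl.
  have F0 : F 0%N = 1 by rewrite /F mul1n mul0r cis0.
  rewrite big_ord_recr /= F0 => e.
  have -> : \sum_(i < M) F i.+1 = \sum_(i < M) F i + F M - 1 by rewrite e; ring.
  by ring.
have := G1; rewrite G2 G3 => e.
have -> : chirp M%:R 0 M - m%:R / 2 * (1 + imagc) = (1 - F M) / 2.
  have -> : m%:R / 2 * (1 + imagc) = 2 * m%:R * (1 + imagc) / 4 :> R[i] by field.
  by rewrite -e; field.
rewrite cabsM cabsV -[2]/(2%:R) cabs_nat.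
rewrite ler_pdivrMr// mul1r; apply: le_trans (cabsB _ _) _.
by rewrite cabs1 /F cabs_cis.
Qed.

(* Summation by parts against [(cis (D k) - 1)^-1]. *)
Lemma kusmin_landau (z : nat -> R[i]) (D : nat -> R) K n : (K < n)%N ->
  (forall k, cabs (z k) = 1) -> (forall k, z k.+1 = z k * cis (D k)) ->
  {homo D : i j / (i <= j)%N >-> i <= j} -> 0 < D K ->
  (forall k, (k < n)%N -> D k <= 2^-1) ->
  cabs (\sum_(K <= k < n) z k) <= (D K)^-1.
Proof.
move=> Kn z1 zS Dmono DK Dhalf.
(* [z k = c k * (z k.+1 - z k)], and the variation of [c] telescopes because [D] is monotone. *)
pose c k := (cis (D k) - 1)^-1.
have D0 k : (K <= k)%N -> 0 < D k by move=> Kk; apply: lt_le_trans (Dmono _ _ Kk).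
have cD k : (K <= k < n)%N -> 4 * D k <= cabs (cis (D k) - 1).
  move=> /andP[Kk kn]; have := @cabs_cisB1_ge R (D k).
  by rewrite ger0_norm ?(ltW (D0 _ Kk))//; apply; exact: Dhalf.
have nz k : (K <= k < n)%N -> cis (D k) - 1 != 0.
  move=> Kkn; apply/eqP => e; have := cD _ Kkn; rewrite e cabs0.
  by have := D0 k (andP Kkn).1; lra.
have cle k : (K <= k < n)%N -> cabs (c k) <= (4 * D k)^-1.
  move=> Kkn; have D0k := D0 k (andP Kkn).1.
  by rewrite /c cabsV lef_pV2 ?posrE ?cD//; [apply: lt_le_trans (cD _ Kkn)|]; lra.
have cdiff k : (K <= k)%N -> (k.+1 < n)%N ->
    cabs (c k - c k.+1) <= 2^-1 * ((D k)^-1 - (D k.+1)^-1).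
  move=> Kk kn; have k1 : (K <= k < n)%N by rewrite Kk ltnW.
  have k2 : (K <= k.+1 < n)%N by rewrite leqW.
  have -> : c k - c k.+1 = (cis (D k.+1) - cis (D k)) * c k * c k.+1.
    by rewrite /c; field; rewrite !nz.
  have a := D0 k Kk; have b := D0 k.+1 (leqW Kk).
  have DD : D k <= D k.+1 by exact: Dmono.
  have up : cabs (cis (D k.+1) - cis (D k)) <= 8 * (D k.+1 - D k).
    rewrite cabs_cisB; apply: le_trans (cabs_cisB1_le _) _.
    rewrite ger0_norm ?subr_ge0// ler_wpM2r ?subr_ge0//.
    by have := @pi_lt4 R; lra.
  rewrite !cabsM.
  have -> : 2^-1 * ((D k)^-1 - (D k.+1)^-1) = 8 * (D k.+1 - D k) * (4 * D k)^-1 * (4 * D k.+1)^-1.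
    by field; lra.
  by rewrite ler_pM ?mulr_ge0 ?cabs_ge0 ?cle// ler_pM ?cabs_ge0 ?cle.
have main j : (K + j < n)%N ->
    cabs (\sum_(K <= k < (K + j).+1) z k - c (K + j)%N * z (K + j).+1) <=
    (4 * D K)^-1 + 2^-1 * ((D K)^-1 - (D (K + j)%N)^-1).
  elim: j => [|j IH] lt_jn.
    rewrite addn0 big_nat1 subrr mulr0 addr0 zS.
    have -> : z K - c K * (z K * cis (D K)) = - (c K * z K).
      by rewrite /c; field; rewrite nz ?leqnn.
    by rewrite cabsN cabsM z1 mulr1 cle ?leqnn.
  rewrite addnS in lt_jn *; rewrite big_nat_recr ?leqW ?leq_addr//=.
  set S := \sum_(_ <= _ < _) _ in IH *; set l := (K + j)%N in lt_jn IH *.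
  have Kl : (K <= l)%N by rewrite leq_addr.
  have -> : S + z l.+1 - c l.+1 * z l.+2 = (S - c l * z l.+1) + (c l - c l.+1) * z l.+1.
    rewrite (zS l.+1) /c; field.
    by rewrite !nz ?leqW ?Kl ?lt_jn// ltnW.
  apply: le_trans (cabsD _ _) _; rewrite cabsM z1 mulr1.
  have := IH (ltnW lt_jn); have := cdiff l Kl lt_jn; lra.
have [j nE] : exists j, n = (K + j).+1 by exists (n - K.+1)%N; lia.
have jn : (K + j < n)%N by rewrite nE.
have Kj : (K <= K + j)%N by rewrite leq_addr.
have DKj : D K <= D (K + j)%N by exact: Dmono.
have := main j jn; have := cle (K + j)%N; rewrite Kj jn => /(_ isT).
rewrite nE; set S := \sum_(_ <= _ < _) _; set C := c _; set Z := z _.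
move=> c1 c2; have -> : S = (S - C * Z) + C * Z by rewrite subrK.
apply: le_trans (cabsD _ _) _; rewrite [cabs (C * Z)]cabsM z1 mulr1.
have i1 : (D (K + j)%N)^-1 <= (D K)^-1 by rewrite lef_pV2 ?posrE// D0.
have i2 : 0 < (D (K + j)%N)^-1 by rewrite invr_gt0 D0.
have e1 : (4 * D K)^-1 = (D K)^-1 / 4 by field; lra.
have e2 : (4 * D (K + j)%N)^-1 = (D (K + j)%N)^-1 / 4 by field; have := D0 _ Kj; lra.
rewrite e1 e2 in c1 c2; lra.
Qed.

End LandsbergSchaar.

(** * Stationary phase for quadratic chirps, with explicit error terms *)

Section ChirpAsymptotics.
Variable R : realType.
Implicit Types (q h n m K : nat) (A r N theta : R).

Lemma cabs_cisB_le (x y : R) : cabs (cis x - cis y) <= 8 * `|x - y|.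
Proof.
rewrite cabs_cisB; apply: le_trans (cabs_cisB1_le _) _.
by rewrite ler_wpM2r//; have := @pi_lt4 R; lra.
Qed.

(** Kusmin-Landau for the increments [D k] of the phase; the bound on [n + theta] is exactly what
    keeps them at most [1 / 2]. *)
Lemma chirp_tail N theta K n : 0 < N -> 0 <= theta -> (0 < K < n)%N ->
  n%:R + theta <= N + 2^-1 ->
  cabs (\sum_(K <= k < n) cis ((k%:R + theta) ^+ 2 / (4 * N))) <= 2 * N / K%:R.
Proof.
move=> N0 t0 /andP[K0 Kn] nN; have K0' : 0 < K%:R :> R by rewrite ltr0n.
pose z k : R[i] := cis ((k%:R + theta) ^+ 2 / (4 * N)).
pose D k : R := (2 * (k%:R + theta) + 1) / (4 * N).
have N4 : 0 < 4 * N by lra.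
have DK : 0 < D K by apply: divr_gt0 => //; lra.
apply: (@le_trans _ _ (D K)^-1).
  apply: (@kusmin_landau _ z D) => //.
  - by move=> k; exact: cabs_cis.
  - by move=> k; rewrite /z /D -cisD -natr1; congr cis; field; lra.
  - by move=> i j ij; rewrite /D ler_wpM2r ?invr_ge0 ?(ltW N4)// lerD2r ler_pM2l// lerD2r ler_nat.
  move=> k kn; rewrite /D ler_pdivrMr//.
  have : k.+1%:R <= n%:R :> R by rewrite ler_nat.
  by rewrite -natr1; lra.
rewrite invf_div ler_pdivlMr// mulrAC ler_pdivrMr; last by lra.
suff : 0 <= 2 * N * (2 * theta + 1) by nra.
by rewrite mulr_ge0; lra.
Qed.

Lemma chirp_head N M theta K : 0 < N -> 0 < M -> 0 <= theta <= 1 ->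
  cabs (\sum_(k < K) cis ((k%:R + theta) ^+ 2 / (4 * N)) -
        \sum_(k < K) cis (k%:R ^+ 2 / (4 * M))) <=
  8 * K%:R * (2 * K%:R / (4 * N) + K%:R ^+ 2 * `|N - M| / (4 * N * M)).
Proof.
move=> N0 M0 /andP[t0 t1]; rewrite -sumrB.
set c : R := 2 * K%:R / (4 * N) + _.
apply: le_trans (cabs_sum _ _ _) _.
have -> : 8 * K%:R * c = \sum_(k < K) (8 * c).
  by rewrite sumr_const card_ord -[RHS]mulr_natr; ring.
apply: ler_sum => k _; apply: le_trans (cabs_cisB_le _ _) _; rewrite ler_pM2l//.
have kK : k.+1%:R <= K%:R :> R by rewrite ler_nat.
rewrite -natr1 in kK; have k0 : 0 <= k%:R :> R by [].
have -> : (k%:R + theta) ^+ 2 / (4 * N) - k%:R ^+ 2 / (4 * M) =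
    theta * (2 * k%:R + theta) / (4 * N) + k%:R ^+ 2 * (M - N) / (4 * N * M).
  by field; lra.
apply: le_trans (ler_normD _ _) _; apply: lerD.
  rewrite ger0_norm; last by rewrite divr_ge0 ?mulr_ge0//; lra.
  by rewrite ler_wpM2r ?invr_ge0//; [lra|nra].
have kk : k%:R ^+ 2 <= K%:R ^+ 2 :> R by rewrite ler_pXn2r ?nnegrE//; lra.
have NM0 : 0 < 4 * N * M by rewrite !mulr_gt0.
rewrite normf_div normrM [`|M - N|]distrC (gtr0_norm NM0) (ger0_norm (sqr_ge0 _)).
by rewrite ler_pM2r ?invr_gt0// ler_wpM2r.
Qed.

Lemma odd_near r : 1 <= r -> exists m : nat, odd m /\ `|m%:R - r| <= 1.
Proof.
move=> r1; pose p := Num.truncn (r / 2).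
have /andP[p1 p2] : p%:R <= r / 2 < p.+1%:R by apply: Num.Theory.truncn_itv; lra.
exists p.*2.+1; split; first by rewrite /= odd_double.
rewrite -[p.+1%:R]natr1 in p2; rewrite -[_.*2.+1%:R]natr1 -muln2 natrM ler_norml; lra.
Qed.

(* The head [k <= A r] changes little when [r ^ 2] is replaced by an odd square and
   [theta] by 0, where [chirp_square] applies; the tail is controlled by
   [kusmin_landau]. *)
Lemma chirp_approx A r theta n : 1 <= A -> 16 * A <= r -> 0 <= theta <= 1 ->
  r ^+ 2 - 2 <= n%:R -> n%:R + theta <= r ^+ 2 + 1 ->
  cabs (chirp (r ^+ 2) theta n - (r / 2)%:C * (1 + imagc R)) <=
  10 * r / A + 220 * A ^+ 3.
Proof.
move=> A1 Ar t01 n_ge n_le; have r16 : 16 <= r by lra.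
have r0 : 0 < r by lra.
have A0 : 0 < A by lra.
have t0 := (andP t01).1.
have [m [om mr]] : exists m : nat, odd m /\ `|m%:R - r| <= 1 by apply: odd_near; lra.
move: (mr); rewrite ler_norml => /andP[mr1 mr2].
have m0 : (0 < m)%N by case: m om {mr mr1 mr2}.
set N := r ^+ 2; set M : R := m%:R ^+ 2.
have N0 : 0 < N by rewrite exprn_gt0//; lra.
have Mlo : r ^+ 2 / 4 <= M by rewrite /M; nra.
have Mup : M <= 4 * r ^+ 2 by rewrite /M; nra.
have M0 : 0 < M by rewrite /N in N0; lra.
have NM : `|N - M| <= 3 * r by rewrite ler_norml /N /M; nra.
pose K := (Num.truncn (A * r)).+1.
have /andP[k1 k2] : (Num.truncn (A * r))%:R <= A * r < (Num.truncn (A * r)).+1%:R.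
  by apply: Num.Theory.truncn_itv; nra.
rewrite -/K in k2.
have Kup : K%:R <= 2 * A * r by rewrite /K -[X in X <= _]natr1; nra.
have K0 : 0 < K%:R :> R by rewrite ltr0n.
have Ksmall : 2 * A * r <= r ^+ 2 / 8 by nra.
have n0 : (0 < n)%N by rewrite -(ltr0n R); nra.
have nE : n = n.-1.+1 by rewrite prednK.
have KM : (K < m ^ 2)%N by rewrite -(ltr_nat R) natrX -/M; nra.
have Kn : (K < n.-1)%N.
  by rewrite -(ltr_nat R); move: n_ge; rewrite nE -[n.-1.+1%:R]natr1; nra.
(* The last term is split off because [n + theta] may reach [N + 1], beyond the range of
   [chirp_tail]. *)
have split1 : chirp N theta n = \sum_(k < K) cis ((k%:R + theta) ^+ 2 / (4 * N)) +
    \sum_(K <= k < n.-1) cis ((k%:R + theta) ^+ 2 / (4 * N)) +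
    cis ((n.-1%:R + theta) ^+ 2 / (4 * N)).
  rewrite /chirp -!(big_mkord xpredT (fun k => cis ((k%:R + theta) ^+ 2 / (4 * N)))).
  by rewrite {1}nE big_nat_recr//= -big_cat_nat//= ltnW.
have split2 : chirp M 0 (m ^ 2) = \sum_(k < K) cis (k%:R ^+ 2 / (4 * M)) +
    \sum_(K <= k < m ^ 2) cis ((k%:R + 0) ^+ 2 / (4 * M)).
  rewrite /chirp -!(big_mkord xpredT (fun k => cis ((k%:R + 0) ^+ 2 / (4 * M)))).
  rewrite (big_cat_nat _ (n := K)) ?(ltnW KM)//=; congr (_ + _).
  by rewrite ?big_mkord; apply: eq_bigr => k _; rewrite addr0.
have tail1 := @chirp_tail N theta K n.-1 N0 t0.
have tail2 := @chirp_tail M 0 K (m ^ 2) M0 (lexx 0).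
have head := @chirp_head N M theta K N0 M0 t01.
have sq := chirp_square R om.
rewrite natrX -/M in sq.
have {}tail1 : cabs (\sum_(K <= k < n.-1) cis ((k%:R + theta) ^+ 2 / (4 * N))) <= 2 * r / A.
  apply: le_trans (tail1 _ _) _; first by rewrite Kn.
    by move: n_le; rewrite {1}nE -[n.-1.+1%:R]natr1 -/N; lra.
  rewrite ler_pdivrMr// mulrAC ler_pdivlMr; last by lra.
  by rewrite /N; nra.
have {}tail2 : cabs (\sum_(K <= k < m ^ 2) cis ((k%:R + 0) ^+ 2 / (4 * M))) <= 8 * r / A.
  apply: le_trans (tail2 _ _) _; first by rewrite KM.
    by rewrite natrX -/M addr0; lra.
  rewrite ler_pdivrMr// mulrAC ler_pdivlMr; last by lra.
  have : M * A <= 4 * r ^+ 2 * A by rewrite ler_wpM2r//; lra.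
  nra.
rewrite {}split1; move: sq; rewrite {}split2.
set h1 := \sum_(k < K) _ in head *; set h2 := \sum_(k < K) _ in head *.
set t1 := \sum_(K <= k < _) _ in tail1 *; set t2 := \sum_(K <= k < _) _ in tail2 *.
set z := cis _; set w := m%:R / 2 * _ => sq.
have -> : h1 + t1 + z - (r / 2)%:C * (1 + imagc R) =
   (h1 - h2) + (t1 + (z + ((h2 + t2 - w) + ((w - (r / 2)%:C * (1 + imagc R)) - t2)))) by ring.
have wr : cabs (w - (r / 2)%:C * (1 + imagc R)) <= 1.
  have -> : w - (r / 2)%:C * (1 + imagc R) = ((m%:R - r) / 2)%:C * (1 + imagc R).
    by rewrite /w !(rmorphM, rmorphB) !fmorphV !rmorph_nat; ring.
  rewrite cabsM cabs_real normrM (@ger0_norm _ 2^-1)//.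
  have i2 : cabs (1 + imagc R) <= 2.
    apply: le_trans (cabsD _ _) _; rewrite cabs1 /imagc /cabs /= expr0n expr1n add0r sqrtr1; lra.
  apply: (@le_trans _ _ (2^-1 * 2)); last by lra.
  by apply: ler_pM => //; rewrite ?cabs_ge0 ?mulr_ge0//; lra.
have hd : 8 * K%:R * (2 * K%:R / (4 * N) + K%:R ^+ 2 * `|N - M| / (4 * N * M)) <= 208 * A ^+ 3.
  have b1 : 2 * K%:R / (4 * N) <= A / r.
    rewrite ler_pdivrMr; last by lra.
    have -> : A / r * (4 * N) = 4 * A * r by rewrite /N; field; lra.
    by lra.
  have b2 : K%:R ^+ 2 * `|N - M| / (4 * N * M) <= 12 * A ^+ 2 / r.
    have NM0 : 0 < 4 * N * M by rewrite mulr_gt0// mulr_gt0.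
    rewrite ler_pdivrMr//.
    apply: (@le_trans _ _ ((2 * A * r) ^+ 2 * (3 * r))).
      by rewrite ler_pM ?sqr_ge0 ?normr_ge0// ler_pXn2r ?nnegrE//; nra.
    apply: (@le_trans _ _ (12 * A ^+ 2 / r * (4 * N * (r ^+ 2 / 4)))).
      by rewrite le_eqVlt; apply/orP; left; apply/eqP; rewrite /N; field; lra.
    have c0 : 0 <= 12 * A ^+ 2 / r by rewrite divr_ge0 ?(ltW r0)// mulr_ge0// sqr_ge0.
    apply: ler_wpM2l => //; rewrite ler_pM2l//; exact: mulr_gt0.
  set Y := A / r + 12 * A ^+ 2 / r.
  have Y0 : 0 <= Y.
    have c1 : 0 <= A / r by rewrite divr_ge0 ?(ltW r0)// ltW.
    have c2 : 0 <= 12 * A ^+ 2 / r by rewrite divr_ge0 ?(ltW r0)// mulr_ge0// sqr_ge0.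
    by rewrite addr_ge0.
  have K8 : 0 <= 8 * K%:R :> R by rewrite mulr_ge0.
  apply: le_trans (ler_wpM2l K8 (lerD b1 b2)) _; rewrite -/Y.
  apply: (@le_trans _ _ (8 * (2 * A * r) * Y)).
    by apply: ler_wpM2r => //; rewrite ler_pM2l.
  rewrite /Y.
  have -> : 8 * (2 * A * r) * (A / r + 12 * A ^+ 2 / r) = 16 * A ^+ 2 + 192 * A ^+ 3 by field; lra.
  have A23 : A ^+ 2 <= A ^+ 3 by apply: ler_weXn2l.
  by clear -A23; lra.
have {}head := le_trans head hd.
have A3 : 1 <= A ^+ 3 by rewrite exprn_ege1.
apply: le_trans (cabsD _ _) _; apply: le_trans (lerD head (cabsD _ _)) _.
have := cabsD z ((h2 + t2 - w) + ((w - (r / 2)%:C * (1 + imagc R)) - t2)).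
have := cabsD (h2 + t2 - w) ((w - (r / 2)%:C * (1 + imagc R)) - t2).
have := cabsB (w - (r / 2)%:C * (1 + imagc R)) t2.
rewrite [cabs z]cabs_cis.
have -> : 10 * r / A = 2 * r / A + 8 * r / A by rewrite -mulrDl -mulrDl; congr (_ * _ / _); lra.
lra.
Qed.

End ChirpAsymptotics.

Section Reciprocity.
Variable R : realType.
Implicit Types (q h n m d K : nat) (A r N theta : R).

Lemma sum_nat_blocks (F : nat -> R[i]) (beta : nat -> nat) n :
  {homo beta : i j / (i <= j)%N} ->
  \sum_(beta 0%N <= a < beta n) F a = \sum_(b < n) \sum_(beta b <= a < beta b.+1) F a.
Proof.
move=> bmono; elim: n => [|n IH]; first by rewrite big_geq// big_ord0.
by rewrite big_ord_recr /= -IH -big_cat_nat//=; exact: bmono.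
Qed.

(** The block is cut at the first integer [c] beyond the stationary point [x]. The right part is a
    chirp with offset [c - x], the left part read backwards one with offset [x + 1 - c]; each
    carries half of the main term. *)
Lemma chirp_block A r (x : R) (lo hi : nat) : 1 <= A -> 16 * A <= r -> 0 <= x ->
  x - r ^+ 2 < lo%:R <= x - r ^+ 2 + 1 -> x + r ^+ 2 < hi%:R <= x + r ^+ 2 + 1 ->
  cabs (\sum_(lo <= a < hi) cis ((a%:R - x) ^+ 2 / (4 * r ^+ 2)) - r%:C * (1 + imagc R)) <=
  20 * r / A + 440 * A ^+ 3.
Proof.
move=> A1 Ar x0 /andP[lo1 lo2] /andP[hi1 hi2].
set N := r ^+ 2 in lo1 lo2 hi1 hi2 *.
have N2 : 2 <= N by rewrite /N; nra.
pose c := (Num.truncn x).+1.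
have /andP[c1 c2] : (Num.truncn x)%:R <= x < (Num.truncn x).+1%:R by exact: Num.Theory.truncn_itv.
rewrite -/c in c2.
have {}c1 : c%:R <= x + 1 by rewrite /c -[X in X <= _]natr1 lerD2r.
have loc : (lo <= c)%N by rewrite -(ler_nat R); lra.
have chi : (c <= hi)%N by rewrite -(ler_nat R); lra.
rewrite (big_cat_nat _ (n := c))//=.
have right_sum : \sum_(c <= a < hi) cis ((a%:R - x) ^+ 2 / (4 * N)) = chirp N (c%:R - x) (hi - c).
  rewrite -{1}[c]add0n big_addn big_mkord; apply: eq_bigr => k _.
  by rewrite natrD addrA.
have left_sum : \sum_(lo <= a < c) cis ((a%:R - x) ^+ 2 / (4 * N)) = chirp N (x + 1 - c%:R) (c - lo).
  rewrite -{1}[lo]add0n big_addn big_mkord (reindex_inj rev_ord_inj) /=.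
  apply: eq_bigr => k _; congr cis; congr (_ / _).
  have kc : (k < c - lo)%N by exact: ltn_ord.
  have kc' : (lo + k.+1 <= c)%N by rewrite addnS -ltn_subRL.
  have -> : (c - lo - k.+1 + lo)%N = (c - k.+1)%N.
    by rewrite -subnDA addnC addnBA// subnDl.
  by rewrite natrB ?(leq_trans (leq_addl _ _) kc')// -[k.+1%:R]natr1; ring.
have half_r : r%:C * (1 + imagc R) = (r / 2)%:C * (1 + imagc R) + (r / 2)%:C * (1 + imagc R).
  by rewrite -mulrDl -rmorphD; congr (_%:C * _); field.
rewrite left_sum right_sum half_r.
set w := _ * (1 + _).
have -> (u v : R[i]) : u + v - (w + w) = (u - w) + (v - w) by ring.
have lt_l : cabs (chirp N (x + 1 - c%:R) (c - lo) - w) <= 10 * r / A + 220 * A ^+ 3.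
  by apply: chirp_approx => //; rewrite ?natrB// -/N; lra.
have lt_r : cabs (chirp N (c%:R - x) (hi - c) - w) <= 10 * r / A + 220 * A ^+ 3.
  by apply: chirp_approx => //; rewrite ?natrB// -/N; lra.
apply: le_trans (cabsD _ _) _; apply: le_trans (lerD lt_l lt_r) _.
by rewrite le_eqVlt; apply/orP; left; apply/eqP; field; lra.
Qed.

(* The phase [h a ^ 2 / q] is stationary near [a = b q / (2 h)]; the sum is cut into
   [2 h] blocks around these points, each of which is a translated chirp. *)
Lemma gauss_approx A r h q : (0 < h)%N -> (0 < q)%N -> 1 <= A -> 16 * A <= r ->
  r ^+ 2 = q%:R / (4 * h%:R) ->
  cabs (gauss R h q - r%:C * (1 + imagc R) *
     \sum_(b < 2 * h) cis (- ((q * b.+1 ^ 2)%:R / (4 * h%:R)))) <=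
  (2 * h)%:R * (20 * r / A + 440 * A ^+ 3).
Proof.
move=> h0 q0 A1 Ar rE; set N := r ^+ 2 in rE *.
have h0' : (h%:R : R) != 0 by rewrite pnatr_eq0 -lt0n.
have q0' : (q%:R : R) != 0 by rewrite pnatr_eq0 -lt0n.
have N0 : 0 < N by rewrite exprn_gt0//; lra.
have qE : q%:R = 4 * h%:R * N by rewrite rE; field.
(* [y b] is the midpoint of the stationary points [2 N b] and [2 N (b + 1)]; block [b] is centred at
   the latter. *)
pose y (b : nat) : R := (2 * b%:R + 1) * N.
have y0 b : 0 <= y b by rewrite mulr_ge0 ?(ltW N0)//; have : 0 <= b%:R :> R by []; lra.
pose beta b := (Num.truncn (y b)).+1.
have betaP b : y b < (beta b)%:R <= y b + 1.
  have /andP[h1 h2] := Num.Theory.truncn_itv (y0 b).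
  by rewrite /beta h2 -[X in X <= _]natr1 lerD2r.
have bmono : {homo beta : i j / (i <= j)%N}.
  move=> i j ij; rewrite ltnS; apply: Num.Theory.le_truncn.
  by rewrite ler_wpM2r ?(ltW N0)// lerD2r ler_pM2l// ler_nat.
have betaE : beta (2 * h)%N = (q + beta 0%N)%N.
  rewrite /beta addnS; congr S.
  apply: Num.Theory.truncn_def.
  have /andP[h1 h2] := Num.Theory.truncn_itv (y0 0%N).
  have yE : y (2 * h)%N = q%:R + y 0%N by rewrite /y qE natrM; ring.
  by rewrite yE -addnS !natrD lerD2l ltrD2l h1.
pose F a : R[i] := cis ((h * a ^ 2)%:R / q%:R).
(* Completing the square; the cross term is the integer [(b + 1) a]. *)
have FE (b : nat) a : F a = cis (- ((q * b.+1 ^ 2)%:R / (4 * h%:R)))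
    * cis ((a%:R - 2 * N * b.+1%:R) ^+ 2 / (4 * N)).
  rewrite -cisD -[RHS](cisDnat _ (b.+1 * a)); congr cis.
  by rewrite !(natrX, natrM) rE; field; rewrite h0' q0'.
have -> : gauss R h q = \sum_(b < 2 * h) \sum_(beta b <= a < beta b.+1) F a.
  rewrite -sum_nat_blocks// betaE -{1}[beta 0%N]add0n big_addn addnK big_mkord.
  rewrite sum_shift_periodic// => a.
  rewrite /F -[RHS](cisDnat _ (2 * h * a + h * q)); congr cis.
  by rewrite !(natrX, natrD, natrM); field.
rewrite mulr_sumr -sumrB; apply: le_trans (cabs_sum _ _ _) _.
have -> (t : R) : (2 * h)%:R * t = \sum_(b < 2 * h) t.
  by rewrite sumr_const card_ord mulr_natl.
apply: ler_sum => b _.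
under eq_bigr do rewrite (FE b).
rewrite -mulr_sumr [X in _ - X]mulrC -mulrBr cabsM cabs_cis mul1r.
apply: chirp_block => //.
- by apply: mulr_ge0 => //; apply: mulr_ge0 => //; exact: ltW.
- have := betaP b; rewrite -/N /y -[b.+1%:R]natr1.
  by have -> : 2 * N * (b%:R + 1) - N = (2 * b%:R + 1) * N by ring.
have := betaP b.+1; rewrite -/N /y.
by have -> : 2 * N * b.+1%:R + N = (2 * b.+1%:R + 1) * N by ring.
Qed.

(* [G(h, q m ^ 2) = m G(h, q)] for [m = 1 mod 4 h], while stationary phase gives
   [G(h, q m ^ 2)] up to [o(m)]; the right-hand side depends on [m] in the same way,
   so letting [m] tend to infinity the error disappears. *)
Lemma landsberg_schaar h q : (0 < h)%N -> (0 < q)%N ->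
  gauss R h q = (Num.sqrt (q%:R / (4 * h%:R)))%:C * (1 + imagc R) *
     \sum_(b < 2 * h) cis (- ((q * b.+1 ^ 2)%:R / (4 * h%:R))).
Proof.
move=> h0 q0; set rho := Num.sqrt _; set D := \sum_(b < _) _.
have h0' : 0 < h%:R :> R by rewrite ltr0n.
have q0' : 0 < q%:R :> R by rewrite ltr0n.
have rho2 : rho ^+ 2 = q%:R / (4 * h%:R) by rewrite sqr_sqrtr// divr_ge0// mulr_ge0.
have rho0 : 0 < rho by rewrite sqrtr_gt0 divr_gt0// mulr_gt0.
set w := _ * D; apply/eqP; rewrite -subr_eq0; apply/eqP/cabs_eq0.
apply/eqP/negPn/negP => neq0; set e := cabs _ in neq0.
have e0 : 0 < e by rewrite lt_neqAle eq_sym neq0 cabs_ge0.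
have bound A (j : nat) : 1 <= A -> 16 * A <= (1 + 4 * h * j)%:R * rho ->
    e <= (2 * h)%:R * (20 * rho / A + 440 * A ^+ 3 / (1 + 4 * h * j)%:R).
  move=> A1 Aj; pose m := (1 + 4 * h * j)%N; have m0 : (0 < m)%N by [].
  have m0' : 0 < m%:R :> R by rewrite ltr0n.
  have co : coprime m (2 * h).
    by rewrite /m -[4%N]/(2 * 2)%N -!mulnA [(2 * (h * j))%N]mulnCA addnC mulnA mulnC coprime_sym
        /coprime gcdnMDl gcdn1.
  have qm0 : (0 < q * m ^ 2)%N by rewrite muln_gt0 q0 expn_gt0 m0.
  have rE : (m%:R * rho) ^+ 2 = (q * m ^ 2)%:R / (4 * h%:R).
    by rewrite exprMn rho2 natrM natrX; field; lra.
  have := gauss_approx h0 qm0 A1 Aj rE.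
  rewrite gauss_mul_sq//.
  have -> : \sum_(b < 2 * h) cis (- ((q * m ^ 2 * b.+1 ^ 2)%:R / (4 * h%:R))) = D.
    apply: eq_bigr => b _.
    rewrite -(cisDnat (- ((q * m ^ 2 * b.+1 ^ 2)%:R / _)) (q * (2 * j + 4 * h * j ^ 2) * b.+1 ^ 2)).
    congr cis; rewrite /m !(natrX, natrD, natrM); field; lra.
  have -> : m%:R * gauss R h q - (m%:R * rho)%:C * (1 + imagc R) * D = m%:R * (gauss R h q - w).
    by rewrite /w rmorphM /= rmorph_nat; ring.
  rewrite cabsM cabs_nat -/e mulrC -ler_pdivlMr// => /le_trans; apply.
  rewrite -/m; move: (m%:R) ((2 * h)%:R : R) m0' => mm hh mm0.
  by rewrite le_eqVlt; apply/orP; left; apply/eqP; field; lra.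
(* [A] brings the contribution of [20 rho / A] below half the supposed discrepancy [e]; only then is
   [m] taken large, to absorb [440 A ^ 3 / m]. *)
have [A [A1 hA]] : exists A, 1 <= A /\ 80 * h%:R * rho < e * A.
  exists (1 + 80 * h%:R * rho / e); split.
    by rewrite lerDl divr_ge0 ?(ltW e0)// mulr_ge0 ?(ltW rho0)// mulr_ge0.
  by rewrite mulrDr mulr1 [e * (_ / e)]mulrC divfK ?gt_eqF// ltrDr.
have A0 : 0 < A by exact: lt_le_trans ltr01 A1.
have A30 : 0 <= A ^+ 3 by rewrite exprn_ge0// ltW.
pose B1 := 16 * A / rho; pose B2 := 8 * (440 * (h%:R * A ^+ 3)) / e.
have B10 : 0 <= B1 by apply: divr_ge0; [apply: mulr_ge0 => //|]; exact: ltW.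
have B20 : 0 <= B2.
  have hA30 : 0 <= h%:R * A ^+ 3 by apply: mulr_ge0.
  by apply: divr_ge0; [clear -hA30; lra|exact: ltW].
pose j := (Num.truncn (B1 + B2)).+1.
have jB : B1 + B2 < j%:R by exact: Num.Theory.truncnS_gt.
have mB : B1 + B2 <= (1 + 4 * h * j)%:R.
  apply: ltW; apply: lt_le_trans jB _; rewrite ler_nat.
  by rewrite (leq_trans _ (leq_addl _ _))// leq_pmull// muln_gt0.
have m0 : 0 < (1 + 4 * h * j)%:R :> R by rewrite ltr0n.
have := bound A j A1.
move: ((1 + 4 * h * j)%:R) m0 mB => m m0 mB bnd.
have cond : 16 * A <= m * rho.
  rewrite -ler_pdivrMr//; apply: le_trans mB; by rewrite lerDl.
have := bnd cond; rewrite leNgt => /negP; apply.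
have t1 : (2 * h)%:R * (20 * rho / A) < e / 2.
  by rewrite natrM mulrA ltr_pdivrMr//; clear -hA; lra.
have t2 : (2 * h)%:R * (440 * A ^+ 3 / m) <= e / 4.
  rewrite natrM mulrA ler_pdivrMr//.
  apply: (@le_trans _ _ (e / 4 * B2)).
    by rewrite le_eqVlt; apply/orP; left; apply/eqP; rewrite /B2; clear -e0; field; lra.
  by apply: ler_wpM2l; [apply: divr_ge0 => //; exact: ltW|apply: le_trans mB; rewrite lerDr].
by rewrite mulrDr; clear -t1 t2 e0; lra.
Qed.

End Reciprocity.

(** * The large sieve *)

Section LargeSieve.
Variable R : realType.

Lemma sum_inv_sq_le n : \sum_(1 <= k < n) (k%:R ^+ 2)^-1 <= 2 :> R.
Proof.
suff le j : \sum_(1 <= k < j.+2) (k%:R ^+ 2)^-1 <= 2 - (j.+1%:R)^-1 :> R.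
  case: n => [|[|n]]; [by rewrite big_geq|by rewrite big_geq|].
  by apply: le_trans (le n) _; rewrite lerBlDr lerDl invr_ge0.
elim: j => [|j IH]; first by rewrite big_nat1 expr1n invr1; lra.
rewrite big_nat_recr//=; apply: le_trans (lerD IH (lexx _)) _.
have j0 : 0 < j.+1%:R :> R by rewrite ltr0n.
rewrite -[j.+2%:R]natr1; move: (j.+1%:R) j0 => x x0.
have -> : 2 - (x + 1)^-1 = 2 - x^-1 + (x * (x + 1))^-1 by field; lra.
by rewrite lerD2l lef_pV2 ?posrE; nra.
Qed.

(** By separation the integer parts [k] of [u j / D] are distinct, and they are at least 1, so the
    sum is dominated by that of [1 / (D k) ^ 2]. *)
Lemma sum_inv_sq_separated (J : finType) (S : pred J) (u : J -> R) (D : R) : 0 < D ->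
  (forall j, S j -> D <= u j) ->
  (forall j k, S j -> S k -> j != k -> D <= `|u j - u k|) ->
  \sum_(j | S j) (u j ^+ 2)^-1 <= 2 / D ^+ 2.
Proof.
move=> D0 uD sep; pose k j := Num.truncn (u j / D).
have kP j : S j -> (k j)%:R <= u j / D < (k j).+1%:R.
  move=> Sj; apply: Num.Theory.truncn_itv; rewrite divr_ge0 ?(ltW D0)//.
  exact: le_trans (ltW D0) (uD _ Sj).
have k1 j : S j -> (1 <= k j)%N.
  move=> Sj; rewrite /k Num.Theory.truncn_gt0 ler_pdivlMr// mul1r; exact: uD.
have kinj i j : S i -> S j -> k i = k j -> i = j.
  move=> Si Sj kij; apply/eqP/negPn/negP => /(sep _ _ Si Sj).
  have /andP[a1 a2] := kP _ Si; have /andP[b1 b2] := kP _ Sj.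
  rewrite leNgt => /negP; apply.
  rewrite kij ler_pdivlMr// in a1; rewrite kij -natr1 ltr_pdivrMr// in a2.
  rewrite ler_pdivlMr// in b1; rewrite -natr1 ltr_pdivrMr// in b2.
  by rewrite ltr_norml; apply/andP; split; lra.
pose n := (\max_j k j).+1.
have kn j : (k j < n)%N by rewrite ltnS leq_bigmax.
rewrite (partition_big (fun j => Ordinal (kn j)) xpredT)//=.
apply: (@le_trans _ _ (\sum_(i < n) (if (0 < i)%N then (i%:R ^+ 2)^-1 else 0) / D ^+ 2)).
  apply: ler_sum => i _.
  have [j /andP[Sj /eqP kj]|none] := pickP (fun j => S j && (Ordinal (kn j) == i)); last first.
    by rewrite big_pred0//; case: ifP => _; rewrite ?mul0r// divr_ge0// ?invr_ge0 sqr_ge0.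
  rewrite (big_pred1 j) => [|l /=]; last first.
    apply/andP/eqP => [[Sl /eqP kl]|->]; last by rewrite Sj kj.
    by apply: kinj => //; move: kl; rewrite -kj => -[].
  have -> : i = k j :> nat by rewrite -kj.
  rewrite k1// -invfM lef_pV2 ?posrE; last 2 first.
  - by rewrite exprn_gt0// (lt_le_trans D0)// uD.
  - by rewrite mulr_gt0 ?exprn_gt0// ltr0n k1.
  rewrite -exprMn ler_pXn2r ?nnegrE ?mulr_ge0 ?(ltW D0)//; last first.
    exact: le_trans (ltW D0) (uD _ Sj).
  by have /andP[a1 _] := kP _ Sj; rewrite -ler_pdivlMr.
rewrite -mulr_suml ler_pM2r ?invr_gt0 ?exprn_gt0//.
rewrite -(big_mkord xpredT (fun i => if (0 < i)%N then (i%:R ^+ 2)^-1 else 0)).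
rewrite big_ltn//= add0r; apply: le_trans (sum_inv_sq_le n).
rewrite le_eqVlt; apply/orP; left; apply/eqP; rewrite big_nat_cond [RHS]big_nat_cond.
by apply: eq_bigr => i /andP[/andP[-> _] _].
Qed.

Section Sieve.
Variables (J : finType) (S : pred J) (c y : J -> R) (D : R).
Hypothesis D0 : 0 < D.
Hypothesis sep : forall j k, S j -> S k -> j != k ->
  forall m : int, D <= `|y j - y k - m%:~R|.

Let P (n : nat) (x : R) : R := cabs (\sum_(i < n) cis (i%:R * x)) ^+ 2.

Let P_int n x (m : int) : P n (x + m%:~R) = P n x.
Proof.
congr (cabs _ ^+ 2); apply: eq_bigr => i _.
by rewrite mulrDr -[i%:R * m%:~R]/(i%:~R * m%:~R) -intrM cisDint.
Qed.

Let P_near n x : 0 < x < 1 -> P n x <= 4^-1 * ((x ^+ 2)^-1 + ((1 - x) ^+ 2)^-1).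
Proof.
move=> /andP[x0 x1].
have half (z : R) : `|z| <= 2^-1 -> z != 0 -> P n z <= 4^-1 * (z ^+ 2)^-1.
  move=> zh z0; have := cis_geometric z n; rewrite /P.
  set s := \sum_(_ < _) _ => e.
  have z0' : 0 < `|z| by rewrite normr_gt0.
  have lo := cabs_cisB1_ge zh.
  have up : cabs s * (4 * `|z|) <= 2.
    apply: le_trans (ler_wpM2l (cabs_ge0 _) lo) _; rewrite -cabsM e.
    by apply: le_trans (cabsB _ _) _; rewrite cabs1 cabs_cis; lra.
  have {}up : cabs s <= (2 * `|z|)^-1.
    by rewrite -[leRHS]mul1r ler_pdivlMr ?mulr_gt0//; lra.
  have -> : 4^-1 * (z ^+ 2)^-1 = (2 * `|z|)^-1 ^+ 2.
    by rewrite exprVn exprMn real_normK ?num_real// -invfM; congr (_ * _)^-1; ring.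
  by rewrite ler_pXn2r ?nnegrE ?cabs_ge0 ?invr_ge0 ?mulr_ge0.
have i1 : 0 <= (x ^+ 2)^-1 by rewrite invr_ge0 sqr_ge0.
have i2 : 0 <= ((1 - x) ^+ 2)^-1 by rewrite invr_ge0 sqr_ge0.
have [xh|xh] := leP x 2^-1.
  apply: le_trans (half x _ _) _; rewrite ?ger0_norm ?(ltW x0) ?gt_eqF//.
  by rewrite ler_pM2l// lerDl.
have -> : P n x = P n (x - 1) by rewrite -[in LHS](subrK 1 x) (P_int n (x - 1) 1).
apply: le_trans (half (x - 1) _ _) _; rewrite ?lt_eqF// ?subr_lt0//.
  by rewrite ler0_norm; lra.
by rewrite -[in leLHS]sqrrN opprB ler_pM2l// lerDr.
Qed.

Lemma large_sieve_kernel j n : S j ->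
  \sum_(k | S k) P n (y k - y j) <= n%:R ^+ 2 + (D ^+ 2)^-1.
Proof.
move=> Sj; rewrite (bigD1 j)//= subrr.
have -> : P n 0 = n%:R ^+ 2.
  rewrite /P; under eq_bigr do rewrite mulr0 cis0.
  by rewrite sumr_const card_ord cabs_nat.
rewrite lerD2l.
pose u k : R := y k - y j - (Num.floor (y k - y j))%:~R.
have u01 k : 0 <= u k < 1.
  have := Num.Theory.floor_itv (y k - y j); rewrite intrD => /andP[a b].
  by rewrite /u; apply/andP; split; lra.
have uD k : S k && (k != j) -> D <= u k.
  move=> /andP[Sk kj]; have := sep Sk Sj kj (Num.floor (y k - y j)).
  by rewrite -/(u k) ger0_norm//; case/andP: (u01 k).
have u1D k : S k && (k != j) -> D <= 1 - u k.
  move=> /andP[Sk kj]; have := sep Sk Sj kj (Num.floor (y k - y j) + 1).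
  rewrite intrD opprD addrA -/(u k) ler0_norm ?opprB//.
  by case/andP: (u01 k) => _ /ltW; rewrite subr_le0.
have usep k l : S k && (k != j) -> S l && (l != j) -> k != l -> D <= `|u k - u l|.
  move=> /andP[Sk _] /andP[Sl _] kl.
  have := sep Sk Sl kl (Num.floor (y k - y j) - Num.floor (y l - y j)).
  by congr (_ <= `|_|); rewrite /u intrB; ring.
apply: (@le_trans _ _ (\sum_(k | S k && (k != j)) 4^-1 * ((u k ^+ 2)^-1 + ((1 - u k) ^+ 2)^-1))).
  apply: ler_sum => k Hk.
  have -> : P n (y k - y j) = P n (u k).
    by rewrite -(P_int n (u k) (Num.floor (y k - y j))) /u subrK.
  apply: P_near; case/andP: (u01 k) => _ ->; rewrite andbT.
  exact: lt_le_trans D0 (uD _ Hk).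
rewrite -mulr_sumr big_split /=.
have b1 := sum_inv_sq_separated D0 uD usep.
have usep1 k l : S k && (k != j) -> S l && (l != j) -> k != l ->
    D <= `|(1 - u k) - (1 - u l)|.
  move=> Hk Hl kl; have := usep k l Hk Hl kl; rewrite distrC.
  by congr (_ <= `|_|); ring.
have b2 := sum_inv_sq_separated D0 u1D usep1.
apply: le_trans (ler_wpM2l _ (lerD b1 b2)) _ => //.
by rewrite le_eqVlt; apply/orP; left; apply/eqP; field; rewrite gt_eqF.
Qed.

Let f (x : R) : R[i] := \sum_(j | S j) (c j)%:C * cis (- (x * y j)).

(** Averaging over [a - b] turns the kernel of the quadratic form into the nonnegative [P], so that
    [c j c k <= (c j ^ 2 + c k ^ 2) / 2] reduces it to the row sums of [large_sieve_kernel]. *)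
Lemma large_sieve_square (x : R) n : (forall j, 0 <= c j) ->
  \sum_(a < n) \sum_(b < n) cabs (f (x + a%:R - b%:R)) ^+ 2 <=
  (n%:R ^+ 2 + (D ^+ 2)^-1) * \sum_(j | S j) c j ^+ 2.
Proof.
move=> c0.
have fE z : (cabs (f z) ^+ 2)%:C = \sum_(j | S j) \sum_(k | S k)
    (c j * c k)%:C * cis (z * (y k - y j)).
  rewrite cabs_sqE {1}/f mulr_suml; apply: eq_bigr => j _.
  rewrite rmorph_sum mulr_sumr; apply: eq_bigr => k _.
  have -> : z * (y k - y j) = - (z * y j) - - (z * y k) by ring.
  rewrite -cisBM rmorphM rmorphM /=.
  rewrite (@conj_Creal _ (c k)%:C); last by rewrite complex_real.
  by ring.
have PE n' z : (P n' z)%:C = (\sum_(a < n') cis (a%:R * z)) * (\sum_(b < n') cis (- (b%:R * z))).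
  by rewrite /P cabs_sqE rmorph_sum; congr (_ * _); apply: eq_bigr => b _; rewrite cisN.
have eqC : (\sum_(a < n) \sum_(b < n) cabs (f (x + a%:R - b%:R)) ^+ 2)%:C =
    \sum_(j | S j) \sum_(k | S k) (c j * c k)%:C * cis (x * (y k - y j)) * (P n (y k - y j))%:C.
  rewrite rmorph_sum /=; under eq_bigr do rewrite rmorph_sum /=.
  under eq_bigr do under eq_bigr do rewrite fE.
  under eq_bigr do rewrite exchange_big /=.
  rewrite exchange_big /=; apply: eq_bigr => j _.
  under eq_bigr do rewrite exchange_big /=.
  rewrite exchange_big /=; apply: eq_bigr => k _.
  rewrite PE mulr_suml mulr_sumr; apply: eq_bigr => a _.
  rewrite !mulr_sumr; apply: eq_bigr => b _.
  by rewrite -!mulrA -!cisD; congr (_ * cis _); ring.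
have Psym j k : P n (y k - y j) = P n (y j - y k).
  rewrite /P -[in RHS]cabs_conj rmorph_sum; congr (cabs _ ^+ 2); apply: eq_bigr => a _.
  rewrite [RHS](_ : _ = cis (- (a%:R * (y j - y k)))); last by rewrite cisN.
  by congr cis; ring.
have P0 z : 0 <= P n z by exact: sqr_ge0.
have lhs0 : 0 <= \sum_(a < n) \sum_(b < n) cabs (f (x + a%:R - b%:R)) ^+ 2.
  by apply: sumr_ge0 => a _; apply: sumr_ge0 => b _; exact: sqr_ge0.
rewrite -(ger0_norm lhs0) -cabs_real eqC.
apply: le_trans (cabs_sum _ _ _) _.
apply: (@le_trans _ _ (\sum_(j | S j) \sum_(k | S k)
    (2^-1 * c j ^+ 2 * P n (y k - y j) + 2^-1 * c k ^+ 2 * P n (y j - y k)))).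
  apply: ler_sum => j _; apply: le_trans (cabs_sum _ _ _) _.
  apply: ler_sum => k _; rewrite !cabsM cabs_cis mulr1 !cabs_real.
  rewrite (ger0_norm (P0 _)) ger0_norm ?mulr_ge0// -Psym -mulrDl ler_wpM2r//.
  by have := sqr_ge0 (c j - c k); nra.
under eq_bigr do rewrite big_split /=.
rewrite big_split /= [X in _ + X]exchange_big /= -big_split /= mulr_sumr.
apply: ler_sum => j Sj; rewrite -!mulr_sumr.
have := large_sieve_kernel n Sj; set T := \sum_(k | S k) _ => leT.
have := sqr_ge0 (c j); nra.
Qed.

(** Every [t < L] is a difference of two numbers below [2 L] in at least [L] ways, which undoes the
    averaging; the constant is [5 = 2 ^ 2 + 1]. *)
Lemma large_sieve (x : R) (L : nat) : (0 < L)%N -> D^-1 <= L%:R ->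
  (forall j, 0 <= c j) ->
  \sum_(t < L) cabs (f (x + t%:R)) ^+ 2 <= 5 * L%:R * \sum_(j | S j) c j ^+ 2.
Proof.
move=> L0 DL c0; have L0' : 0 < L%:R :> R by rewrite ltr0n.
have g0 z : 0 <= cabs (f z) ^+ 2 by exact: sqr_ge0.
have le1 : L%:R * \sum_(t < L) cabs (f (x + t%:R)) ^+ 2 <=
    \sum_(a < 2 * L) \sum_(b < 2 * L) cabs (f (x + a%:R - b%:R)) ^+ 2.
  rewrite exchange_big /= -(big_mkord xpredT (fun b => \sum_(a < 2 * L) cabs (f (x + a%:R - b%:R)) ^+ 2)).
  rewrite (big_cat_nat _ (n := L)) ?leq_pmull//= -[leLHS]addr0; apply: lerD; last first.
    by apply: sumr_ge0 => b _; apply: sumr_ge0 => a _.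
  have -> (z : R) : L%:R * z = \sum_(0 <= b < L) z by rewrite sumr_const_nat subn0 mulr_natl.
  rewrite [leLHS]big_nat_cond [leRHS]big_nat_cond; apply: ler_sum => b.
  rewrite andbT => /andP[_ bL].
  rewrite -[leRHS](big_mkord xpredT (fun a => cabs (f (x + a%:R - b%:R)) ^+ 2)).
  have b2 : (b <= 2 * L)%N by rewrite mul2n -addnn (leq_trans (ltnW bL))// leq_addr.
  have bl2 : (b + L <= 2 * L)%N by rewrite mul2n -addnn leq_add2r ltnW.
  rewrite (big_cat_nat _ (n := b))//= (big_cat_nat _ (n := (b + L)%N) (m := b))//= ?leq_addr//.
  set s1 := \sum_(0 <= i < b) _; set s3 := \sum_(b + L <= i < _) _.
  have s10 : 0 <= s1 by apply: sumr_ge0.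
  have s30 : 0 <= s3 by apply: sumr_ge0.
  rewrite (_ : \sum_(b <= i < b + L) cabs (f (x + i%:R - b%:R)) ^+ 2 = \sum_(t < L) cabs (f (x + t%:R)) ^+ 2).
    by lra.
  rewrite -{1}[b]add0n big_addn addKn big_mkord; apply: eq_bigr => t _.
  by rewrite natrD addrA addrK.
have := le_trans le1 (large_sieve_square x (2 * L) c0).
rewrite natrM; set s := \sum_(j | S j) _ => le2.
have s0 : 0 <= s by apply: sumr_ge0 => j _; exact: sqr_ge0.
have D2 : (D ^+ 2)^-1 <= L%:R ^+ 2.
  by rewrite -exprVn ler_pXn2r ?nnegrE ?invr_ge0 ?(ltW D0)// ltW.
rewrite -(ler_pM2l L0'); apply: le_trans le2 _.
have -> : L%:R * (5 * L%:R * s) = ((2 * L%:R) ^+ 2 + L%:R ^+ 2) * s by ring.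
by rewrite ler_wpM2r// lerD2l.
Qed.

End Sieve.
End LargeSieve.

(** * Square roots mod q and divisor moments *)

Section SquareKernel.
Local Open Scope nat_scope.
Implicit Types (q n m d e k t s r : nat).

(** [m] is the least positive integer with [t | m ^ 2]. As for an ideal, division with remainder
    shows that the [b] with [t | b ^ 2] are the multiples of [m]; hence [sq_kernel t = t / m]. *)
Lemma sq_kernel_spec t : 0 < t -> exists m, [/\ 0 < m, t = m * sq_kernel t,
  t %| m ^ 2, forall b, t %| b ^ 2 -> m %| b & sq_kernel t ^ 2 %| t].
Proof.
move=> t0; pose Q m := (0 < m) && (t %| m ^ 2).
have exQ : exists m, Q m by exists t; rewrite /Q t0 expnS expn1 dvdn_mulr.
case: (ex_minnP exQ) => m /andP[m0 tm] m_min.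
have mdvd b : t %| b ^ 2 -> m %| b.
  move=> tb; set r := b %% m; set k := b %/ m.
  have bE : b = r + k * m by rewrite addnC -divn_eq.
  have tbm : t %| b * m.
    rewrite -(@dvdn_pexp2r _ _ 2)// expnMn; exact: dvdn_mul.
  have trm : t %| r * m.
    have : t %| r * m + k * m ^ 2 by rewrite expnS expn1 mulnA -mulnDl -bE.
    by rewrite dvdn_addl// dvdn_mull.
  have tr : t %| r ^ 2.
    have : t %| r ^ 2 + (2 * k * (r * m) + k ^ 2 * m ^ 2).
      have -> : r ^ 2 + (2 * k * (r * m) + k ^ 2 * m ^ 2) = b ^ 2 by rewrite bE; ring.
      exact: tb.
    by rewrite dvdn_addl//; apply: dvdn_add; exact: dvdn_mull.
  rewrite /dvdn -/r; have [//|r0] := posnP r.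
  have : m <= r by apply: m_min; rewrite /Q r0.
  by rewrite leqNgt ltn_mod m0.
have mt : m %| t by apply: mdvd; rewrite expnS expn1 dvdn_mulr.
have kE : sq_kernel t = t %/ m.
  rewrite -card_multiples_lt//; apply: eq_card => a; rewrite !inE.
  apply/idP/idP => [/mdvd//|ma].
  by apply: dvdn_trans tm _; rewrite dvdn_exp2r.
exists m; split => //; first by rewrite kE mulnC divnK.
have tE : t = m * sq_kernel t by rewrite kE mulnC divnK.
have km : sq_kernel t %| m by rewrite -(dvdn_pmul2l m0) -tE mulnn.
by have := dvdn_mul km (dvdnn (sq_kernel t)); rewrite -tE mulnn.
Qed.

Lemma sq_kernel_gt0 t : 0 < t -> 0 < sq_kernel t.
Proof.
move=> t0; have [m [_ tE _ _ _]] := sq_kernel_spec t0.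
by rewrite lt0n; apply/eqP => k0; move: t0; rewrite tE k0 muln0.
Qed.

Lemma card_coprime_roots s z : 0 < s -> coprime z s ->
  #|[set x : 'I_s | x ^ 2 == z ^ 2 %[mod s]]| <= 2 * tau s.
Proof.
move=> s0 zs; apply: leq_trans (card_roots_le _ s0) _.
rewrite tauE big_distrr /= big_seq [leqRHS]big_seq; apply: leq_sum => d.
rewrite -dvdn_divisors// => ds; case: ifP => // e2z.
rewrite muln1 dvdn_leq//; move: e2z; rewrite Gauss_dvdl// coprime_sym.
by apply: coprime_dvdr zs; apply: dvdn_trans ds; exact: dvdn_gcdl.
Qed.

Lemma modn_cancel w s a b : coprime w s -> w * a = w * b %[mod s] -> a = b %[mod s].
Proof.
move=> ws; wlog ab : a b / a <= b => [H e|].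
  by have [/H|/ltnW/H e'] := leqP a b; [exact|exact/esym/e'/esym].
move=> /esym/eqP; rewrite eqn_mod_dvd ?leq_mul// -mulnBr Gauss_dvdr 1?coprime_sym//.
by rewrite -eqn_mod_dvd// => /eqP.
Qed.

(** With [m] from [sq_kernel_spec] and [m ^ 2 = w t], a solution is [x = m z] where [w z ^ 2 = r]
    mod [s], and [w], [z] are units mod [s]. So [z] takes at most [2 tau s] values mod [s], each
    with [sq_kernel t] lifts. *)
Lemma card_twisted_roots t s r : 0 < t -> 0 < s -> coprime r s ->
  #|[set x : 'I_(t * s) | x ^ 2 == t * r %[mod t * s]]| <= sq_kernel t * (2 * tau s).
Proof.
move=> t0 s0 rs; set A := [set x | _].
have [m [m0 tE tm mdvd _]] := sq_kernel_spec t0; set k := sq_kernel t in tE *.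
have k0 : 0 < k := sq_kernel_gt0 t0.
have [w wE] := dvdnP tm.
have Am (x : 'I_(t * s)) : x \in A -> m %| x.
  rewrite inE => /eqP xA; apply: mdvd.
  have : t %| (x ^ 2) %% (t * s) by rewrite xA /dvdn modn_dvdm ?dvdn_mulr// modnMr.
  by rewrite /dvdn modn_dvdm ?dvdn_mulr.
have Az (x : 'I_(t * s)) : x \in A -> w * (x %/ m) ^ 2 = r %[mod s].
  move=> xA; have := Am x xA; move: xA; rewrite inE => /eqP xA mx.
  apply/eqP; rewrite -(eqn_pmul2l t0) !muln_modr -xA.
  by rewrite -{2}(divnK mx) expnMn wE; apply/eqP; congr (_ %% _); ring.
have [x0 x0A|A0] := pickP (mem A); last by rewrite eq_card0.
pose z0 := x0 %/ m.
have wz0 : coprime (w * z0 ^ 2) s by rewrite -coprime_modl (Az x0 x0A) coprime_modl.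
have ws : coprime w s by move: wz0; rewrite coprimeMl => /andP[].
have z0s : coprime z0 s by move: wz0; rewrite coprimeMl coprime_pexpl// => /andP[].
have zlt (x : 'I_(t * s)) : x %/ m < k * s.
  by rewrite ltn_divLR// mulnAC [k * m]mulnC -tE.
have klt (x : 'I_(t * s)) : x %/ m %/ s < k by rewrite ltn_divLR.
pose f (x : 'I_(t * s)) := (Ordinal (klt x), Ordinal (ltn_pmod (x %/ m) s0)).
have f_inj : {in A &, injective f}.
  move=> x x' xA x'A [e1 e2]; apply: val_inj => /=.
  rewrite -(divnK (Am x xA)) -(divnK (Am x' x'A)); congr (_ * _).
  by rewrite (divn_eq (x %/ m) s) (divn_eq (x' %/ m) s) e1 e2.
rewrite -(card_in_imset f_inj).
apply: leq_trans (leq_mul (leqnn k) (card_coprime_roots s0 z0s)).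
have kE : k = #|[set: 'I_k]| by rewrite cardsT card_ord.
rewrite [X in _ <= X * _]kE -cardsX; apply: subset_leq_card.
apply/fintype.subsetP => p /imsetP[x xA ->]; rewrite !inE /=.
rewrite modnXm.
by apply/eqP/(modn_cancel ws); rewrite (Az x xA) (Az x0 x0A).
Qed.

End SquareKernel.

(** * Sums of square kernels and divisor moments *)

Section ArithmeticSums.
Variable R : realType.

Lemma sum_inj_le (I : finType) (P : pred I) (k : I -> nat) (phi : nat -> R) n :
  (forall t, 0 <= phi t) -> {in P &, injective k} -> (forall i, P i -> (0 < k i < n)%N) ->
  \sum_(i | P i) phi (k i) <= \sum_(1 <= t < n) phi t.
Proof.
move=> phi0 kinj kn.
apply: (@le_trans _ _ (\sum_(1 <= t < n) \sum_(i | P i) (if k i == t then phi t else 0))).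
  rewrite exchange_big /=; apply: ler_sum => i Pi.
  rewrite (bigD1_seq (k i)) ?iota_uniq//=; last by rewrite mem_index_iota kn.
  rewrite eqxx lerDl; apply: sumr_ge0 => t _; by case: ifP.
apply: ler_sum => t _; rewrite -big_mkcondr /=.
have [i /andP[Pi /eqP kt]|none] := pickP (fun i => P i && (k i == t)); last by rewrite big_pred0.
rewrite (big_pred1 i)//= => j.
apply/andP/eqP => [[Pj /eqP kj]|->]; last by rewrite Pi kt.
by apply: kinj; rewrite // kj.
Qed.

Definition harm n : R := \sum_(1 <= k < n.+1) k%:R^-1.

Lemma harm_ge0 n : 0 <= harm n.
Proof. by apply: sumr_ge0 => k _; rewrite invr_ge0. Qed.

Lemma le_harm m n : (m <= n)%N -> harm m <= harm n.
Proof.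
move=> mn; rewrite /harm [leRHS](big_cat_nat _ (n := m.+1))//= lerDl.
by apply: sumr_ge0 => k _; rewrite invr_ge0.
Qed.

Lemma harm_pow2 j : harm (2 ^ j) <= 1 + j%:R.
Proof.
elim: j => [|j IH]; first by rewrite /harm expn0 big_nat1 invr1 addr0.
have le2 : (2 ^ j <= 2 ^ j.+1)%N by rewrite leq_exp2l.
rewrite /harm (big_cat_nat _ (n := (2 ^ j).+1))//= -/(harm _).
rewrite -[j.+1%:R]natr1 addrA; apply: lerD => //.
apply: (@le_trans _ _ (\sum_((2 ^ j).+1 <= k < (2 ^ j.+1).+1) (2 ^ j)%:R^-1)).
  rewrite big_nat_cond [leRHS]big_nat_cond; apply: ler_sum => k.
  rewrite andbT => /andP[k1 _]; rewrite lef_pV2 ?posrE ?ltr0n ?expn_gt0//; last exact: leq_ltn_trans k1.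
  by rewrite ler_nat ltnW.
by rewrite sumr_const_nat subSS expnS mul2n -addnn addnK -[leLHS]mulr_natl divff//.
Qed.

Lemma count_le (X : R) n : 0 <= X -> \sum_(1 <= e < n) (if e%:R <= X then 1 else 0) <= X.
Proof.
move=> X0; elim: n => [|n IH]; first by rewrite big_geq.
case: n IH => [|n] IH; first by rewrite big_geq.
rewrite big_nat_recr//=; case: ifP => nX; last by rewrite addr0.
apply: le_trans nX; rewrite -[n.+1%:R]natr1 lerD2r.
apply: (@le_trans _ _ (\sum_(1 <= e < n.+1) 1)).
  by apply: ler_sum => e _; case: ifP.
by rewrite sumr_const_nat subn1.
Qed.

(** With [t = m k ^ 2] and [k = sq_kernel t], the term is [1 / sqrt m]; for each [m] at most
    [sqrt (T / m)] values of [k] occur. *)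
Lemma sum_sq_kernel_le T :
  \sum_(1 <= t < T.+1) (sq_kernel t)%:R / Num.sqrt t%:R <= Num.sqrt T%:R * harm T.
Proof.
pose g m e t : R := if (m * e ^ 2 == t)%N then (Num.sqrt m%:R)^-1 else 0.
have g0 m e t : 0 <= g m e t by rewrite /g; case: ifP => // _; rewrite invr_ge0 sqrtr_ge0.
apply: (@le_trans _ _ (\sum_(1 <= t < T.+1) \sum_(1 <= m < T.+1) \sum_(1 <= e < T.+1) g m e t)).
  rewrite big_nat_cond [leRHS]big_nat_cond; apply: ler_sum => t.
  rewrite andbT => /andP[t0 tT].
  have [_ [_ _ _ _ /dvdnP[m tE]]] := sq_kernel_spec t0.
  have k0 := sq_kernel_gt0 t0; set k := sq_kernel t in tE k0 *.
  have m0 : (0 < m)%N by move: t0; rewrite tE muln_gt0 => /andP[].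
  have k20 : (0 < k ^ 2)%N by rewrite expn_gt0 k0.
  have mT : (1 <= m < T.+1)%N by rewrite m0 (leq_ltn_trans _ tT)// tE leq_pmulr.
  have kT : (1 <= k < T.+1)%N.
    by rewrite k0 (leq_ltn_trans _ tT)// tE (leq_trans _ (leq_pmull _ m0))// expnS expn1 leq_pmulr.
  rewrite (bigD1_seq m) ?iota_uniq ?mem_index_iota//= (bigD1_seq k) ?iota_uniq ?mem_index_iota//=.
  have -> : g m k t = (Num.sqrt m%:R)^-1 by rewrite /g -tE eqxx.
  rewrite -addrA.
  have -> : k%:R / Num.sqrt t%:R = (Num.sqrt m%:R)^-1 :> R.
    rewrite tE natrM natrX sqrtrM// sqrtr_sqr ger0_norm// invfM mulrCA divff ?mulr1//.
    by rewrite pnatr_eq0 -lt0n.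
  rewrite lerDl addr_ge0//; first by apply: sumr_ge0.
  by apply: sumr_ge0 => i _; apply: sumr_ge0.
rewrite exchange_big /= /harm mulr_sumr.
rewrite big_nat_cond [leRHS]big_nat_cond; apply: ler_sum => m.
rewrite andbT => /andP[m0 mT]; rewrite exchange_big /=.
have m0' : 0 < m%:R :> R by rewrite ltr0n.
pose X : R := Num.sqrt (T%:R / m%:R).
apply: (@le_trans _ _ (\sum_(1 <= e < T.+1) (Num.sqrt m%:R)^-1 * (if e%:R <= X then 1 else 0))).
  apply: ler_sum => e _; rewrite /g.
  have [leT|gtT] := leqP (m * e ^ 2) T; last first.
    rewrite big_nat_cond big1.
      by case: ifP => _; rewrite ?mulr1 ?mulr0 ?invr_ge0 ?sqrtr_ge0.
    by move=> t; rewrite andbT => /andP[_ tT]; case: eqP => // e2; move: gtT; rewrite e2 ltnNge -ltnS tT.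
  have -> : e%:R <= X.
    rewrite -(@ler_pXn2r _ 2)// ?nnegrE ?sqrtr_ge0// sqr_sqrtr ?divr_ge0//.
    by rewrite ler_pdivlMr// -natrX -natrM ler_nat mulnC.
  rewrite mulr1 -big_mkcond /=.
  case: (posnP (m * e ^ 2)) => [->|me0].
    rewrite big_nat_cond big_pred0 ?invr_ge0 ?sqrtr_ge0// => t.
    by case: t => [|t]; rewrite ?andbF.
  rewrite -big_filter (perm_big [:: (m * e ^ 2)%N]) ?big_seq1//=.
  apply: uniq_perm; rewrite ?filter_uniq ?iota_uniq// => t.
  rewrite mem_filter mem_index_iota inE eq_sym; case: eqP => // ->.
  by rewrite me0 ltnS leT.
rewrite -mulr_sumr.
apply: le_trans (ler_wpM2l _ (count_le _ _)) _; rewrite ?invr_ge0 ?sqrtr_ge0//.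
rewrite /X sqrtrM// sqrtrV ?ler0n// mulrCA -invfM -expr2 sqr_sqrtr//.
Qed.

(* Uses [tau q = sum_(q = a b) 1] and [tau (a b) <= tau a * tau b]. *)
Lemma tau_moment_sq (g : nat -> R) k n : (forall a, 0 <= g a) ->
  (forall a b, (0 < a)%N -> (0 < b)%N -> g (a * b)%N = g a * g b) ->
  \sum_(1 <= q < n) (tau q)%:R ^+ k.+1 * g q <=
  (\sum_(1 <= q < n) (tau q)%:R ^+ k * g q) ^+ 2.
Proof.
move=> g0 gM; rewrite expr2 big_distrl /=.
pose G q : R := (tau q)%:R ^+ k * g q.
have G0 q : 0 <= G q by rewrite mulr_ge0 ?exprn_ge0.
apply: (@le_trans _ _ (\sum_(1 <= q < n) \sum_(1 <= a < n) \sum_(1 <= b < n)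
    (if (a * b == q)%N then G q else 0))).
  rewrite big_nat_cond [leRHS]big_nat_cond; apply: ler_sum => q.
  rewrite andbT => /andP[q0 qn].
  have -> : (tau q)%:R ^+ k.+1 * g q = \sum_(a <- divisors q) G q.
    by rewrite big_const_seq count_predT iter_addr_0 -[RHS]mulr_natl exprS -mulrA.
  have sub : {subset divisors q <= index_iota 1 n}.
    move=> a; rewrite -dvdn_divisors// mem_index_iota => aq.
    by rewrite (dvdn_gt0 q0)//= (leq_ltn_trans (dvdn_leq q0 aq)).
  rewrite [leRHS](bigID (mem (divisors q))) /= -[leLHS]addr0; apply: lerD; last first.
    by apply: sumr_ge0 => a _; apply: sumr_ge0 => b _; case: ifP.
  rewrite [leLHS](perm_big [seq a <- index_iota 1 n | a \in divisors q]) /=; last first.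
    apply: uniq_perm; rewrite ?filter_uniq ?iota_uniq ?divisors_uniq// => a.
    by rewrite mem_filter; case: (boolP (a \in divisors q)) => [ad|//]; rewrite (sub _ ad).
  rewrite big_filter; apply: ler_sum => a; rewrite -dvdn_divisors// => aq.
  rewrite (bigD1_seq (q %/ a)%N) ?iota_uniq//=; last first.
    rewrite mem_index_iota divn_gt0 ?(dvdn_gt0 q0)// dvdn_leq//=.
    exact: leq_ltn_trans (leq_div _ _) qn.
  rewrite mulnC divnK// eqxx lerDl; apply: sumr_ge0 => b _; by case: ifP.
rewrite exchange_big /= big_nat_cond [leRHS]big_nat_cond; apply: ler_sum => a.
rewrite andbT => /andP[a0 an]; rewrite exchange_big /= mulr_sumr.
rewrite big_nat_cond [leRHS]big_nat_cond; apply: ler_sum => b.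
rewrite andbT => /andP[b0 bn].
have ab0 : (0 < a * b)%N by rewrite muln_gt0 a0.
have le : G (a * b)%N <= G a * G b.
  rewrite /G gM// mulrACA ler_wpM2r ?mulr_ge0//.
  by rewrite -exprMn lerXn2r ?nnegrE ?mulr_ge0// -natrM ler_nat tau_mul_le.
apply: le_trans le; rewrite -big_mkcond /=.
have [lt|ge] := ltnP (a * b) n; last first.
  rewrite big_nat_cond big_pred0// => q; apply/negP => /andP[/andP[_ qn] /eqP e].
  by move: ge; rewrite e leqNgt qn.
rewrite -big_filter (perm_big [:: (a * b)%N]) ?big_seq1//=.
apply: uniq_perm; rewrite ?filter_uniq ?iota_uniq// => q.
by rewrite mem_filter mem_index_iota inE eq_sym; case: eqP => // ->; rewrite ab0 lt.
Qed.

End ArithmeticSums.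

(** * Mean square of the Fejer means of Gauss sums *)

Section MeanSquare.
Variable R : realType.

Lemma big_ord_from1 (V : nmodType) (n : nat) (f : nat -> V) :
  \sum_(1 <= h < n) f h = \sum_(h < n | (0 < h)%N) f h.
Proof.
rewrite [RHS]big_mkcond -(big_mkord xpredT (fun h => if (0 < h)%N then f h else 0)) /=.
case: n => [|n]; first by rewrite !big_geq.
rewrite [RHS]big_ltn//= add0r big_nat_cond [RHS]big_nat_cond.
by apply: eq_bigr => i /andP[/andP[-> _] _].
Qed.

Variable H : nat.
Local Notation N := (4 * H).+1.

(* Index [(h, b)] stands for the fraction [(b + 1) ^ 2 / (4 h)] mod 1, in lowest
   terms and with the numerator first. *)
Definition phase_frac (i : 'I_H * 'I_(2 * H)) : 'I_N * 'I_N :=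
  let g := gcdn (i.2.+1 ^ 2) (4 * i.1) in
  (inord ((i.2.+1 ^ 2 %/ g) %% (4 * i.1 %/ g)), inord (4 * i.1 %/ g)).

Definition reduced_frac (j : 'I_N * 'I_N) : bool :=
  [&& (0 < j.2)%N, (j.1 < j.2)%N & coprime j.1 j.2].

Definition frac_val (j : 'I_N * 'I_N) : R := (j.1 : nat)%:R / (j.2 : nat)%:R.

Lemma phase_fracP (i : 'I_H * 'I_(2 * H)) : (0 < i.1)%N -> exists g k : nat,
  [/\ (i.2.+1 ^ 2 = g * (k * (phase_frac i).2 + (phase_frac i).1))%N,
      (4 * i.1 = g * (phase_frac i).2)%N & reduced_frac (phase_frac i)].
Proof.
case: i => h b /= h0; rewrite /reduced_frac /phase_frac /=.
set x := (b.+1 ^ 2)%N; set g := gcdn x (4 * h).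
have h40 : (0 < 4 * h)%N by rewrite muln_gt0.
have g0 : (0 < g)%N by rewrite gcdn_gt0 h40 orbT.
have gx : (g %| x)%N by exact: dvdn_gcdl.
have gh : (g %| 4 * h)%N by exact: dvdn_gcdr.
have s0 : (0 < 4 * h %/ g)%N by rewrite divn_gt0// dvdn_leq.
have sN : (4 * h %/ g < N)%N.
  by rewrite ltnS (leq_trans (leq_div _ _))// leq_mul2l/= ltnW.
have rs : ((x %/ g) %% (4 * h %/ g) < 4 * h %/ g)%N by rewrite ltn_mod.
exists g, (x %/ g %/ (4 * h %/ g))%N.
rewrite !inordK//; last exact: ltn_trans rs sN.
split; first by rewrite -divn_eq mulnC divnK.
  by rewrite [RHS]mulnC divnK.
rewrite s0 rs /= coprime_modl /coprime -(eqn_pmul2r g0) muln_gcdl.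
by rewrite !divnK// mul1n.
Qed.

(** The difference is [z / (s s')] with [z] an integer. If [z = 0], coprimality makes [s] and [s']
    divide each other, and the numerators, both below [s], must agree. *)
Lemma frac_separated j k : reduced_frac j -> reduced_frac k -> j != k ->
  forall m : int, (16 * H%:R ^+ 2)^-1 <= `|frac_val j - frac_val k - m%:~R|.
Proof.
case: j k => [r s] [r' s'] /and3P[/= s0 rs co] /and3P[/= s'0 rs' co'] neq m.
have s0' : 0 < (s : nat)%:R :> R by rewrite ltr0n.
have s'0' : 0 < (s' : nat)%:R :> R by rewrite ltr0n.
pose z : int := (r : nat)%:Z * (s' : nat)%:Z - (r' : nat)%:Z * (s : nat)%:Z - m * (s : nat)%:Z * (s' : nat)%:Z.
have zE : frac_val (r, s) - frac_val (r', s') - m%:~R = z%:~R / ((s : nat)%:R * (s' : nat)%:R).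
  rewrite /frac_val /z /= !(intrB, intrM) -!pmulrn; field; rewrite !gt_eqF//.
have sH : (s : nat)%:R <= 4 * H%:R :> R by rewrite -natrM ler_nat -ltnS.
have s'H : (s' : nat)%:R <= 4 * H%:R :> R by rewrite -natrM ler_nat -ltnS.
have ss : (s : nat)%:R * (s' : nat)%:R <= 16 * H%:R ^+ 2 :> R.
  have -> : 16 * H%:R ^+ 2 = (4 * H%:R) * (4 * H%:R) :> R by ring.
  by apply: ler_pM.
have ss0 : 0 < (s : nat)%:R * (s' : nat)%:R :> R by rewrite mulr_gt0.
suff z0 : z != 0.
  rewrite zE normrM normfV (gtr0_norm ss0) -[leLHS]mul1r.
  have b1 : 1 <= `|z%:~R : R| by rewrite -intr_norm -[1]/(1%:~R) ler_int; lia.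
  have HH : 0 < 16 * H%:R ^+ 2 :> R by exact: lt_le_trans ss0 ss.
  have b2 : (16 * H%:R ^+ 2)^-1 <= ((s : nat)%:R * (s' : nat)%:R)^-1 :> R by rewrite lef_pV2 ?posrE.
  by apply: ler_pM => //; rewrite invr_ge0 ltW.
apply/negP => /eqP z0; move/negP: neq; apply.
have eqz : (r : nat)%:Z * (s' : nat)%:Z = (r' : nat)%:Z * (s : nat)%:Z + m * (s : nat)%:Z * (s' : nat)%:Z.
  by move: z0; rewrite /z; lia.
have dvd1 : (s %| s')%N.
  rewrite -(@Gauss_dvdr s r); last by rewrite coprime_sym.
  have : ((s : nat)%:Z %| (r : nat)%:Z * (s' : nat)%:Z)%Z.
    rewrite eqz; apply: rpredD; first exact: dvdz_mull.
    by rewrite mulrAC; exact: dvdz_mull.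
  by rewrite -PoszM.
have dvd2 : (s' %| s)%N.
  rewrite -(@Gauss_dvdr s' r'); last by rewrite coprime_sym.
  have : ((s' : nat)%:Z %| (r' : nat)%:Z * (s : nat)%:Z)%Z.
    have -> : (r' : nat)%:Z * (s : nat)%:Z = (r : nat)%:Z * (s' : nat)%:Z - m * (s : nat)%:Z * (s' : nat)%:Z.
      by rewrite eqz addrK.
    by apply: rpredB; exact: dvdz_mull.
  by rewrite -PoszM.
have se : (s : nat) = s' by apply/eqP; rewrite eqn_dvd dvd1 dvd2.
have rr : (r : nat)%:Z = (r' : nat)%:Z + m * (s : nat)%:Z.
  have sz : (s : nat)%:Z != 0 by rewrite -lt0n.
  by apply: (mulIf sz); rewrite mulrDl {1}se eqz -se.
have re : (r : nat) = r'.
  rewrite -se in rs'.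
  have : m = 0 by nia.
  by move=> m0; move: rr; rewrite m0 mul0r addr0 => -[].
by apply/eqP; congr pair; apply: val_inj.
Qed.

(** The Fejer coefficient times the factor [1 / sqrt h] of reciprocity; the factor [sqrt q] is
    common to all [h] and is taken out in [gauss_fejer_frac]. *)
Definition phase_weight (h : nat) : R := (H - h)%:R / Num.sqrt h%:R.

(** The total coefficient of one frequency. The index type bounds [b] only by [2 H]; the condition
    [i.2 < 2 * i.1] restores its true range. *)
Definition frac_weight (j : 'I_N * 'I_N) : R :=
  \sum_(i : 'I_H * 'I_(2 * H) | (0 < i.1)%N && (i.2 < 2 * i.1)%N && (phase_frac i == j))
     phase_weight i.1.

Lemma phase_weight_ge0 h : 0 <= phase_weight h.
Proof. by rewrite divr_ge0 ?sqrtr_ge0. Qed.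

Lemma frac_weight_ge0 j : 0 <= frac_weight j.
Proof. by apply: sumr_ge0 => i _; exact: phase_weight_ge0. Qed.

Lemma gauss_fejer_frac q : (0 < q)%N ->
  cabs (gauss_fejer R H q) ^+ 2 = q%:R / 2 *
    cabs (\sum_(j | reduced_frac j) (frac_weight j)%:C * cis (- (q%:R * frac_val j))) ^+ 2.
Proof.
move=> q0.
set B := \sum_(j | reduced_frac j) _.
have BE : B = \sum_(1 <= h < H) \sum_(b < 2 * h)
    (phase_weight h)%:C * cis (- ((q * b.+1 ^ 2)%:R / (4 * h%:R))).
  pose F (i : 'I_H * 'I_(2 * H)) : R[i] :=
    (phase_weight i.1)%:C * cis (- ((q * i.2.+1 ^ 2)%:R / (4 * (i.1 : nat)%:R))).
  transitivity (\sum_(i : 'I_H * 'I_(2 * H) | (0 < i.1)%N && (i.2 < 2 * i.1)%N) F i).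
    rewrite (partition_big phase_frac reduced_frac) /=; last first.
      by move=> i /andP[i0 _]; have [g [k [_ _ ->]]] := phase_fracP i0.
    apply: eq_bigr => j Sj; rewrite /frac_weight rmorph_sum mulr_suml.
    apply: eq_bigr => i /andP[/andP[i0 _] /eqP ij]; congr (_ * _).
    have [g [k [xE hE /and3P[s0 _ _]]]] := phase_fracP i0.
    rewrite ij in xE hE s0.
    have g0 : (0 < g)%N.
      have : (0 < 4 * i.1)%N by rewrite muln_gt0.
      by rewrite hE muln_gt0 => /andP[].
    rewrite -(cisDnat (- ((q * _)%:R / _)) (q * k)); congr cis.
    have s0' : (j.2 : nat)%:R != 0 :> R by rewrite pnatr_eq0 -lt0n.
    have g0' : g%:R != 0 :> R by rewrite pnatr_eq0 -lt0n.
    rewrite -natrM hE xE /frac_val !(natrM, natrD); field.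
    by rewrite s0' g0'.
  rewrite big_ord_from1.
  rewrite -(pair_big_dep (fun h : 'I_H => 0 < h)%N (fun h (b : 'I_(2 * H)) => b < 2 * h)%N
    (fun h b => F (h, b))) /=.
  apply: eq_bigr => h h0.
  have h2 : (2 * h <= 2 * H)%N by rewrite leq_mul2l/= ltnW.
  by rewrite (big_ord_widen _ (fun b => (phase_weight h)%:C *
    cis (- ((q * b.+1 ^ 2)%:R / (4 * (h : nat)%:R) : R))) h2).
have rootq (h : nat) : (0 < h)%N ->
    Num.sqrt (q%:R / (4 * h%:R)) = Num.sqrt q%:R / (2 * Num.sqrt h%:R) :> R.
  move=> h0; rewrite sqrtrM// sqrtrV ?mulr_ge0// sqrtrM//.
  by rewrite (_ : 4 = 2 ^+ 2 :> R) ?sqrtr_sqr ?ger0_norm//; ring.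
have -> : gauss_fejer R H q = (Num.sqrt q%:R / 2)%:C * (1 + imagc R) * B.
  rewrite /gauss_fejer BE !mulr_sumr big_nat_cond [RHS]big_nat_cond.
  apply: eq_bigr => h; rewrite andbT => /andP[h0 _].
  rewrite landsberg_schaar// rootq// -mulr_sumr /phase_weight.
  set D := \sum_(b < 2 * h) _.
  have -> : (H - h)%:R = ((H - h)%:R : R)%:C by rewrite rmorph_nat.
  have -> (u v : R) (z : R[i]) : u%:C * (v%:C * (1 + imagc R) * z) = (u * v)%:C * ((1 + imagc R) * z).
    by rewrite rmorphM /=; ring.
  have -> (u v : R) (z : R[i]) : u%:C * (1 + imagc R) * (v%:C * z) = (u * v)%:C * ((1 + imagc R) * z).
    by rewrite rmorphM /=; ring.
  congr (_%:C * _); rewrite invfM; ring.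
rewrite !cabsM !exprMn cabs_real real_normK ?num_real// exprMn sqr_sqrtr//.
rewrite (_ : cabs (1 + imagc R) ^+ 2 = 2); last by rewrite cabs_sq /=; ring.
by field.
Qed.

End MeanSquare.

(** * Size of the coefficients and the mean square estimate *)

Section FracWeights.
Variable R : realType.
Variable H : nat.
Local Notation N := (4 * H).+1.

(** If [(b + 1) ^ 2 / (4 h)] is [r / s] mod 1, then [(b + 1) ^ 2 = t r] mod [t s] with
    [t = 4 h / s], the congruence of [card_twisted_roots]. *)
Lemma card_phase_frac (h : 'I_H) (j : 'I_N * 'I_N) : (0 < h)%N -> reduced_frac j ->
  (#|[set b : 'I_(2 * H) | (b < 2 * h)%N && (phase_frac (h, b) == j)]| <=
   if (j.2 %| 4 * h)%N then sq_kernel (4 * h %/ j.2) * (2 * tau j.2) else 0)%N.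
Proof.
move=> h0 /and3P[s0 rs co]; set A := [set b | _].
have [b0 b0A|A0] := pickP (mem A); last by rewrite eq_card0.
have key (b : 'I_(2 * H)) : b \in A -> exists k : nat,
    [/\ (4 * h = (4 * h %/ j.2) * j.2)%N, (j.2 %| 4 * h)%N &
    (b.+1 ^ 2 = (4 * h %/ j.2) * (k * j.2 + j.1))%N].
  rewrite inE => /andP[_ /eqP bj].
  have [g [k [xE hE _]]] := @phase_fracP H (h, b) h0.
  rewrite bj /= in xE hE.
  have gE : (4 * h %/ j.2 = g)%N by rewrite hE mulnK.
  by exists k; rewrite gE; split => //; rewrite hE dvdn_mull.
have [_ [hE dvd _]] := key b0 b0A; rewrite dvd.
set t := (4 * h %/ j.2)%N in hE key *.
have t0 : (0 < t)%N.
  have : (0 < 4 * h)%N by rewrite muln_gt0.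
  by rewrite hE muln_gt0 => /andP[].
apply: leq_trans (card_twisted_roots t0 s0 co).
have lt (b : 'I_(2 * H)) : (b.+1 %% (t * j.2) < t * j.2)%N by rewrite ltn_mod muln_gt0 t0.
pose f (b : 'I_(2 * H)) : 'I_(t * j.2) := Ordinal (lt b).
have fE b : b \in A -> f b = b.+1 :> nat.
  rewrite inE => /andP[b2 _]; rewrite /= modn_small// -hE.
  by rewrite (leq_ltn_trans b2)// ltn_mul2r h0.
have f_inj : {in A &, injective f}.
  move=> b b' bA b'A /(congr1 (fun i => nat_of_ord i)).
  by rewrite (fE b bA) (fE b' b'A) => -[] /val_inj.
rewrite -(card_in_imset f_inj); apply: subset_leq_card.
apply/fintype.subsetP => x /imsetP[b bA ->]; rewrite inE (fE b bA).
have [k [_ _ ->]] := key b bA.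
by rewrite mulnDr mulnCA modnMDl.
Qed.

(** Only [h] with [s | 4 h] contribute. In terms of [t = 4 h / s <= 4 H / s] the bound separates
    into a factor depending on [s] and [sq_kernel t / sqrt t], summed by [sum_sq_kernel_le]. *)
Lemma frac_weight_le (j : 'I_N * 'I_N) : reduced_frac j ->
  frac_weight R j <=
  8 * H%:R * Num.sqrt H%:R * (tau j.2)%:R * harm R (4 * H) / (j.2 : nat)%:R.
Proof.
move=> Sj; have /and3P[s0 rs co] := Sj.
set s : nat := j.2; have s0' : 0 < s%:R :> R by rewrite ltr0n.
pose phi (t : nat) : R := 4 * H%:R * (tau s)%:R / Num.sqrt s%:R * ((sq_kernel t)%:R / Num.sqrt t%:R).
have phi0 t : 0 <= phi t.
  by rewrite /phi !mulr_ge0 ?invr_ge0 ?sqrtr_ge0.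
have -> : frac_weight R j = \sum_(h < H | (0 < h)%N)
    \sum_(b < 2 * H | (b < 2 * h)%N && (phase_frac (h, b) == j)) phase_weight R H h.
  rewrite pair_big_dep /=; apply: eq_big => [[h b]|[h b]] //=.
  by rewrite andbA.
apply: (@le_trans _ _ (\sum_(h < H | (0 < h)%N && (s %| 4 * h)%N) phi (4 * h %/ s)%N)).
  rewrite [leRHS]big_mkcondr /=; apply: ler_sum => h h0.
  rewrite sumr_const -(cardsE (fun b : 'I_(2 * H) => (b < 2 * h)%N && (phase_frac (h, b) == j))).
  have := card_phase_frac h0 Sj; rewrite -/s; set n := #|_|.
  case: ifP => [dvd le|_]; last by rewrite leqn0 => /eqP ->; rewrite mulr0n.
  set t := (4 * h %/ s)%N in le *.
  have hE : (4 * h = t * s)%N by rewrite divnK.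
  have t0 : (0 < t)%N.
    have : (0 < 4 * h)%N by rewrite muln_gt0.
    by rewrite hE muln_gt0 => /andP[].
  have t0' : 0 < t%:R :> R by rewrite ltr0n.
  have h0' : 0 < (h : nat)%:R :> R by rewrite ltr0n.
  have rootE : 2 * Num.sqrt h%:R = Num.sqrt t%:R * Num.sqrt s%:R :> R.
    rewrite -sqrtrM// -natrM -hE natrM sqrtrM//.
    by rewrite (_ : 4%:R = 2 ^+ 2 :> R) ?sqrtr_sqr ?ger0_norm//; ring.
  have rh : Num.sqrt h%:R != 0 :> R by rewrite gt_eqF// sqrtr_gt0.
  have rt : Num.sqrt t%:R != 0 :> R by rewrite gt_eqF// sqrtr_gt0.
  have rs' : Num.sqrt s%:R != 0 :> R by rewrite gt_eqF// sqrtr_gt0.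
  have -> : phi t = H%:R / Num.sqrt h%:R * (sq_kernel t * (2 * tau s))%:R.
    have -> : (Num.sqrt h%:R)^-1 = 2 / (Num.sqrt t%:R * Num.sqrt s%:R) :> R.
      by rewrite -rootE; field.
    by rewrite /phi !natrM; field; rewrite rt rs'.
  rewrite -[leLHS]mulr_natr; apply: ler_pM => //; first exact: phase_weight_ge0.
    by rewrite ler_pM2r ?invr_gt0 ?sqrtr_gt0// ler_nat leq_subr.
  by rewrite ler_nat.
pose T := (4 * H %/ s)%N.
apply: le_trans (@sum_inj_le R _ _ _ phi T.+1 phi0 _ _) _.
- move=> h h'; rewrite !unfold_in => /andP[_ d1] /andP[_ d2] e.
  apply: val_inj; apply/eqP; rewrite -(eqn_pmul2l (isT : (0 < 4)%N)) /=.
  by rewrite -(divnK d1) -(divnK d2) e.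
- move=> h /andP[h0 d1]; rewrite ltnS leq_div2r ?leq_mul2l ?(ltnW (ltn_ord h))// andbT.
  by rewrite divn_gt0// dvdn_leq// muln_gt0.
rewrite -mulr_sumr.
have c0 : 0 <= 4 * H%:R * (tau s)%:R / Num.sqrt s%:R :> R.
  by rewrite !mulr_ge0 ?invr_ge0 ?sqrtr_ge0.
apply: le_trans (ler_wpM2l c0 (sum_sq_kernel_le R T)) _.
have le1 : Num.sqrt T%:R * harm R T <= 2 * Num.sqrt H%:R / Num.sqrt s%:R * harm R (4 * H).
  apply: ler_pM; rewrite ?sqrtr_ge0 ?harm_ge0//; last by rewrite le_harm// leq_div.
  have -> : 2 * Num.sqrt H%:R / Num.sqrt s%:R = Num.sqrt (4 * H%:R / s%:R) :> R.
    rewrite sqrtrM ?mulr_ge0// sqrtrM// sqrtrV//.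
    by rewrite (_ : 4 = 2 ^+ 2 :> R) ?sqrtr_sqr ?ger0_norm//; ring.
  by rewrite ler_wsqrtr// ler_pdivlMr// -!natrM ler_nat leq_trunc_div.
apply: le_trans (ler_wpM2l c0 le1) _.
have sE : (s%:R : R)^-1 = (Num.sqrt s%:R)^-1 * (Num.sqrt s%:R)^-1.
  by rewrite -invfM -expr2 sqr_sqrtr.
rewrite sE le_eqVlt; apply/orP; left; apply/eqP; ring.
Qed.

Lemma sum_tau_sq_le n : \sum_(1 <= s < n.+1) (tau s)%:R ^+ 2 * s%:R^-1 <= harm R n ^+ 4.
Proof.
have g0 a : 0 <= (a%:R : R)^-1 by rewrite invr_ge0.
have gM a b : (0 < a)%N -> (0 < b)%N -> ((a * b)%:R : R)^-1 = a%:R^-1 * b%:R^-1.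
  by move=> _ _; rewrite natrM invfM.
have := @tau_moment_sq R _ 1 n.+1 g0 gM; have := @tau_moment_sq R _ 0 n.+1 g0 gM.
have -> : \sum_(1 <= q < n.+1) (tau q)%:R ^+ 0 * q%:R^-1 = harm R n.
  by apply: eq_bigr => q _; rewrite expr0 mul1r.
set s1 := \sum_(_ <= _ < _) _ => h1 h2; apply: le_trans h2 _.
have s10 : 0 <= s1 by apply: sumr_ge0 => q _; rewrite mulr_ge0 ?exprn_ge0.
by rewrite (_ : 4 = 2 * 2)%N// exprM ler_pXn2r ?nnegrE ?sqr_ge0.
Qed.

(** The squared weights are of order [tau s ^ 2 / s ^ 2]; the at most [s] numerators over each [s]
    leave [tau s ^ 2 / s], a divisor moment controlled by the fourth power of [harm]. *)
Lemma sum_frac_weight_sq :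
  \sum_(j : 'I_N * 'I_N | reduced_frac j) frac_weight R j ^+ 2 <= 64 * H%:R ^+ 3 * harm R (4 * H) ^+ 6.
Proof.
set l := harm R (4 * H); have l0 : 0 <= l by exact: harm_ge0.
pose c : R := 64 * H%:R ^+ 3 * l ^+ 2.
have c0 : 0 <= c by rewrite /c !mulr_ge0 ?exprn_ge0.
apply: (@le_trans _ _ (\sum_(j : 'I_N * 'I_N | reduced_frac j) c * ((tau j.2)%:R ^+ 2 / (j.2 : nat)%:R ^+ 2))).
  apply: ler_sum => j Sj.
  have -> : c * ((tau j.2)%:R ^+ 2 / (j.2 : nat)%:R ^+ 2) =
      (8 * H%:R * Num.sqrt H%:R * (tau j.2)%:R * l / (j.2 : nat)%:R) ^+ 2.
    have sq : H%:R = Num.sqrt H%:R ^+ 2 :> R by rewrite sqr_sqrtr.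
    by rewrite /c !exprMn -sq exprVn; ring.
  rewrite ler_pXn2r ?nnegrE ?frac_weight_ge0//; first exact: frac_weight_le.
  by rewrite !mulr_ge0 ?invr_ge0 ?sqrtr_ge0.
apply: (@le_trans _ _ (\sum_(j : 'I_N * 'I_N | (0 < j.2)%N && (j.1 < j.2)%N)
    c * ((tau j.2)%:R ^+ 2 / (j.2 : nat)%:R ^+ 2))).
  rewrite [leLHS]big_mkcond [leRHS]big_mkcond /=; apply: ler_sum => j _.
  rewrite /reduced_frac andbA; case: (_ && (_ < _)%N) => //=.
  case: ifP => // _; rewrite mulr_ge0// divr_ge0 ?sqr_ge0//.
pose F (r s : 'I_N) : R := c * ((tau s)%:R ^+ 2 / (s : nat)%:R ^+ 2).
have -> : \sum_(j : 'I_N * 'I_N | (0 < j.2)%N && (j.1 < j.2)%N)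
    c * ((tau j.2)%:R ^+ 2 / (j.2 : nat)%:R ^+ 2) =
    \sum_(s < N | (0 < s)%N) \sum_(r < N | (r < s)%N) F r s.
  rewrite (exchange_big_dep xpredT)//= pair_big_dep /=.
  by apply: eq_bigl => -[r s] /=.
have -> : \sum_(s < N | (0 < s)%N) \sum_(r < N | (r < s)%N) F r s =
    \sum_(1 <= s < N) c * ((tau s)%:R ^+ 2 * s%:R^-1).
  rewrite big_ord_from1; apply: eq_bigr => s s0.
  rewrite -(big_ord_widen _ (fun=> c * ((tau s)%:R ^+ 2 / (s : nat)%:R ^+ 2)))//; last exact: ltnW.
  rewrite sumr_const card_ord -mulr_natr; field.
  by rewrite pnatr_eq0 -lt0n.
rewrite -mulr_sumr; apply: le_trans (ler_wpM2l c0 (sum_tau_sq_le _)) _.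
by rewrite -/l /c le_eqVlt; apply/orP; left; apply/eqP; ring.
Qed.

Lemma gauss_fejer_mean_square Q : (0 < H)%N -> (0 < Q)%N ->
  \sum_(t < Q) cabs (gauss_fejer R H (Q + t)) ^+ 2 / (Q + t)%:R <=
  160 * (Q%:R + 16 * H%:R ^+ 2) * (H%:R ^+ 3 * harm R (4 * H) ^+ 6).
Proof.
(* The range is prolonged to [L] terms so that [L] is at least the inverse spacing [16 H ^ 2] of the
   frequencies. *)
move=> H0 Q0; pose L := (Q + 16 * H ^ 2)%N.
have H0' : 0 < H%:R :> R by rewrite ltr0n.
have D0 : 0 < (16 * H%:R ^+ 2)^-1 :> R by rewrite invr_gt0 mulr_gt0 ?exprn_gt0.
have L0 : (0 < L)%N by rewrite addn_gt0 Q0.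
have DL : (16 * H%:R ^+ 2)^-1^-1 <= L%:R :> R.
  by rewrite invrK /L natrD natrM natrX lerDr.
pose f (x : R) : R[i] := \sum_(j : 'I_N * 'I_N | reduced_frac j) (frac_weight R j)%:C * cis (- (x * frac_val R j)).
have sieve : \sum_(t < L) cabs (f (Q%:R + t%:R)) ^+ 2 <=
    5 * L%:R * \sum_(j : 'I_N * 'I_N | reduced_frac j) frac_weight R j ^+ 2.
  exact: (large_sieve D0 (@frac_separated R H) Q%:R L0 DL (@frac_weight_ge0 R H)).
apply: (@le_trans _ _ (2^-1 * \sum_(t < L) cabs (f (Q%:R + t%:R)) ^+ 2)).
  rewrite mulr_sumr -(big_mkord xpredT (fun t => 2^-1 * cabs (f (Q%:R + t%:R)) ^+ 2)).
  rewrite (big_cat_nat _ (n := Q)) ?leq_addr//= big_mkord -[leLHS]addr0; apply: lerD.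
    apply: ler_sum => t _; rewrite gauss_fejer_frac ?addn_gt0 ?Q0// -/(f _) -natrD.
    have x0 : (Q + t)%:R != 0 :> R by rewrite pnatr_eq0 -lt0n addn_gt0 Q0.
    by rewrite mulrAC [X in X * _]mulrAC divff// mul1r.
  by apply: sumr_ge0 => t _; rewrite mulr_ge0 ?sqr_ge0.
apply: le_trans (ler_wpM2l _ sieve) _ => //.
have L5 : 0 <= 2^-1 * (5 * L%:R) :> R by rewrite !mulr_ge0.
rewrite [leLHS]mulrA; apply: le_trans (ler_wpM2l L5 sum_frac_weight_sq) _.
by rewrite /L natrD natrM natrX le_eqVlt; apply/orP; left; apply/eqP; field.
Qed.

End FracWeights.

(** * Exceptional moduli *)

Section ExcessBounds.
Variable R : realType.
Implicit Types (q H j k n : nat).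

(** The square root in [gauss_sq_le] is linearized: [|G| <= (q / u) gcd + u / 2] for any [u > 0], so
    that only sums of gcds enter; the chosen [u] balances the two terms. *)
Lemma gauss_fejer_le H q (T : R) : (0 < q)%N -> 0 < T ->
  \sum_(1 <= d < H) (gcdn d q)%:R <= H%:R * T ->
  cabs (gauss_fejer R H q) <= H%:R ^+ 2 * Num.sqrt (2 * q%:R * T).
Proof.
move=> q0 T0 sumT; set u := Num.sqrt _.
have q0' : 0 < q%:R :> R by rewrite ltr0n.
have u2 : u ^+ 2 = 2 * q%:R * T by rewrite sqr_sqrtr// !mulr_ge0// ltW.
have u0 : 0 < u by rewrite sqrtr_gt0 !mulr_gt0.
apply: le_trans (cabs_sum _ _ _) _.
apply: (@le_trans _ _ (\sum_(1 <= d < H) H%:R * (q%:R / u * (gcdn d q)%:R + u / 2))).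
  rewrite big_nat_cond [leRHS]big_nat_cond; apply: ler_sum => d.
  rewrite andbT => /andP[d0 dH]; rewrite cabsM cabs_nat.
  apply: ler_pM; rewrite ?cabs_ge0// ?ler_nat ?leq_subr//.
  have := gauss_sq_le R d0 q0; set g := cabs _ => gle.
  rewrite -(ler_pM2r (_ : 0 < 2 * u)) ?mulr_gt0//.
  have -> : (q%:R / u * (gcdn d q)%:R + u / 2) * (2 * u) = 2 * q%:R * (gcdn d q)%:R + u ^+ 2.
    by field; rewrite gt_eqF.
  by have := sqr_ge0 (g - u); nra.
rewrite -mulr_sumr expr2 -mulrA; apply: ler_wpM2l => //.
rewrite big_split /= -mulr_sumr sumr_const_nat.
have le1 : q%:R / u * \sum_(1 <= d < H) (gcdn d q)%:R <= H%:R * (u / 2).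
  apply: le_trans (ler_wpM2l _ sumT) _; first by rewrite divr_ge0// ltW.
  have -> : u / 2 = u ^+ 2 / (2 * u) by field; rewrite gt_eqF.
  by rewrite u2 le_eqVlt; apply/orP; left; apply/eqP; field; rewrite gt_eqF.
have le2 : u / 2 *+ (H - 1) <= H%:R * (u / 2).
  by rewrite -[leLHS]mulr_natl ler_pM2r ?divr_gt0// ler_nat leq_subr.
apply: le_trans (lerD le1 le2) _.
by rewrite le_eqVlt; apply/orP; left; apply/eqP; field.
Qed.

Lemma gauss_fejer_le_tau H q : (0 < q)%N ->
  cabs (gauss_fejer R H q) <= H%:R ^+ 2 * Num.sqrt (2 * q%:R * (tau q)%:R).
Proof.
move=> q0; apply: gauss_fejer_le => //; first by rewrite ltr0n tau_gt0.
by rewrite -natr_sum -natrM ler_nat sum_gcd_le.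
Qed.

Lemma gauss_fejer_le_self H q : (0 < q)%N -> (0 < H)%N ->
  cabs (gauss_fejer R H q) <= H%:R ^+ 2 * Num.sqrt (2 * q%:R * H%:R).
Proof.
move=> q0 H0; apply: gauss_fejer_le => //; first by rewrite ltr0n.
rewrite -natr_sum -natrM ler_nat.
apply: (@leq_trans (\sum_(1 <= d < H) H)%N).
  rewrite big_nat_cond [leqRHS]big_nat_cond; apply: leq_sum => d.
  rewrite andbT => /andP[d0 dH]; apply: leq_trans (ltnW dH).
  by rewrite dvdn_leq// dvdn_gcdl.
by rewrite sum_nat_const_nat leq_mul2r leq_subr orbT.
Qed.

(* A larger constant makes [excess] smaller but costs [24 * excess_cst * sigma ^ 2]
   in the final estimate; this value leaves room for both terms. *)
Definition excess_cst : R := 4 + 16 * 10 ^+ 4.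

Lemma near_sq_tau_real q H : (0 < q)%N -> (0 < H)%N ->
  #|near_sq q H|%:R <= (sq_kernel q)%:R + 4 * (tau q)%:R * q%:R / H%:R :> R.
Proof.
move=> q0 H0; have H0' : 0 < H%:R :> R by rewrite ltr0n.
apply: (@le_trans _ _ (sq_kernel q + 8 * (q %/ (2 * H)) * tau q)%:R).
  by rewrite ler_nat card_near_sq_tau.
rewrite natrD lerD2l ler_pdivlMr//.
have : (2 * H * (q %/ (2 * H)))%:R <= q%:R :> R by rewrite ler_nat mulnC leq_trunc_div.
rewrite !natrM; move: ((q %/ (2 * H))%:R) ((tau q)%:R) (ler0n R (tau q)) => a t t0 le.
have -> : 8 * a * t * H%:R = 4 * t * (2 * H%:R * a) by ring.
by rewrite ler_wpM2l// mulr_ge0.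
Qed.

(** Put [u = sqrt (2 q tau q)] and [c = 10 ^ 4]. The Gauss sum bound turns an excess into
    [q / H <= u / (2 c)], and the divisor bound becomes [sq_kernel q + 2 tau q * u / c], from which
    [H] has disappeared. *)
Lemma excess_small q H : (0 < q)%N -> (0 < H)%N ->
  excess_cst * q%:R / H%:R < #|near_sq q H|%:R ->
  (#|near_sq q H|%:R / q%:R) ^+ 2 <=
  2 * (sq_kernel q)%:R ^+ 2 / q%:R ^+ 2 + 16 / 10 ^+ 8 * (tau q)%:R ^+ 3 / q%:R :> R.
Proof.
move=> q0 H0 exc; have H0' : 0 < H%:R :> R by rewrite ltr0n.
have q0' : 0 < q%:R :> R by rewrite ltr0n.
have b1 := card_near_sq_le R q0 H0; have b2 := gauss_fejer_le_tau H q0.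
have b3 := near_sq_tau_real q0 H0.
have H20 : 0 < H%:R ^+ 2 :> R by rewrite exprn_gt0.
have t0 : 0 <= (tau q)%:R :> R by [].
have s0 : 0 <= (sq_kernel q)%:R :> R by [].
have W0 : 0 <= #|near_sq q H|%:R :> R by [].
set u := Num.sqrt _ in b2.
have u2 : u ^+ 2 = 2 * q%:R * (tau q)%:R by rewrite sqr_sqrtr// !mulr_ge0.
have u0 : 0 <= u by exact: sqrtr_ge0.
move: b1 b2 b3 exc W0; set W := #|_|%:R; set z := cabs _; move=> b1 b2 b3 exc W0.
pose p : R := q%:R / H%:R.
have b4 : 8 * z / H%:R ^+ 2 <= 8 * u by rewrite ler_pdivrMr// -mulrA ler_pM2l// mulrC.
have b5 : W <= 4 * p + 8 * u.
  by apply: le_trans b1 _; rewrite /p mulrA lerD2l.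
have b6 : (4 + 16 * 10 ^+ 4) * p < W by rewrite /p mulrA.
have b7 : W <= (sq_kernel q)%:R + 4 * (tau q)%:R * p by rewrite /p mulrA.
have [c [cE c1]] : exists c : R, c = 10 ^+ 4 /\ 0 < c by exists (10 ^+ 4); rewrite exprn_gt0.
rewrite -cE in b6.
have p2 : 2 * c * p <= u by lra.
have b8 : W <= (sq_kernel q)%:R + 2 * (tau q)%:R / c * u.
  apply: le_trans b7 _; rewrite lerD2l.
  have -> : 4 * (tau q)%:R * p = 2 * (tau q)%:R / c * (2 * c * p) by field; rewrite gt_eqF.
  by apply: ler_wpM2l => //; rewrite divr_ge0 ?mulr_ge0// ltW.
have b9 : W ^+ 2 <= 2 * (sq_kernel q)%:R ^+ 2 + 2 * (2 * (tau q)%:R / c * u) ^+ 2.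
  set v := 2 * _ / c * u in b8 *.
  have v0 : 0 <= v by rewrite /v mulr_ge0 ?divr_ge0 ?mulr_ge0// ltW.
  apply: (@le_trans _ _ (((sq_kernel q)%:R + v) ^+ 2)).
    by rewrite ler_pXn2r ?nnegrE ?addr_ge0.
  by have := sqr_ge0 ((sq_kernel q)%:R - v); nra.
have q20 : 0 < q%:R ^+ 2 :> R by rewrite exprn_gt0.
rewrite expr_div_n ler_pdivrMr//; apply: le_trans b9 _.
rewrite exprMn u2 (_ : 10 ^+ 8 = c ^+ 2); last by rewrite cE -exprM.
by rewrite le_eqVlt; apply/orP; left; apply/eqP; field; rewrite !gt_eqF.
Qed.

Lemma excess_large q H : (0 < q)%N -> (0 < H)%N ->
  (#|near_sq q H|%:R / q%:R) ^+ 2 <=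
  2 * (sq_kernel q)%:R ^+ 2 / q%:R ^+ 2 + 32 * (tau q)%:R ^+ 2 / H%:R ^+ 2 :> R.
Proof.
move=> q0 H0; have H0' : 0 < H%:R :> R by rewrite ltr0n.
have q0' : 0 < q%:R :> R by rewrite ltr0n.
have b3 := near_sq_tau_real q0 H0.
have t0 : 0 <= (tau q)%:R :> R by [].
have s0 : 0 <= (sq_kernel q)%:R :> R by [].
set v := _ / _ in b3.
have v0 : 0 <= v by rewrite /v !mulr_ge0// invr_ge0.
have b9 : #|near_sq q H|%:R ^+ 2 <= 2 * (sq_kernel q)%:R ^+ 2 + 2 * v ^+ 2 :> R.
  apply: (@le_trans _ _ (((sq_kernel q)%:R + v) ^+ 2)).
    by rewrite ler_pXn2r ?nnegrE ?addr_ge0.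
  by have := sqr_ge0 ((sq_kernel q)%:R - v); nra.
rewrite expr_div_n ler_pdivrMr ?exprn_gt0//; apply: le_trans b9 _.
by rewrite /v le_eqVlt; apply/orP; left; apply/eqP; field; rewrite !gt_eqF.
Qed.

(** With [gcd (d, q) <= H] the Fejer term is at most [8 sqrt (2 q H)]; the hypothesis says exactly
    that this is at most [16 * 10 ^ 4 * q / H]. *)
Lemma no_excess q H : (0 < q)%N -> (0 < H)%N -> (H ^ 3 <= 2 * 10 ^ 8 * q)%N ->
  #|near_sq q H|%:R <= excess_cst * q%:R / H%:R.
Proof.
move=> q0 H0; rewrite -(ler_nat R) !(natrX, natrM) => H3.
have H0' : 0 < H%:R :> R by rewrite ltr0n.
have q0' : 0 < q%:R :> R by rewrite ltr0n.
apply: le_trans (card_near_sq_le R q0 H0) _.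
have b2 := gauss_fejer_le_self q0 H0.
have H20 : 0 < H%:R ^+ 2 :> R by rewrite exprn_gt0.
have -> : excess_cst * q%:R / H%:R = 4 * q%:R / H%:R + 16 * 10 ^+ 4 * (q%:R / H%:R).
  by rewrite /excess_cst; move: (10 ^+ 4) => c; ring.
rewrite lerD2l.
rewrite ler_pdivrMr//; apply: le_trans (ler_wpM2l _ b2) _ => //.
rewrite mulrCA [leRHS]mulrC ler_pM2l//.
have c0 : 0 <= 16 * 10 ^+ 4 * (q%:R / H%:R) :> R.
  by rewrite mulr_ge0 ?divr_ge0 ?mulr_ge0 ?exprn_ge0.
rewrite -(@ler_pXn2r _ 2)// ?nnegrE ?mulr_ge0 ?sqrtr_ge0//.
rewrite exprMn sqr_sqrtr ?mulr_ge0//.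
have -> : (16 * 10 ^+ 4 * (q%:R / H%:R)) ^+ 2 = 8 ^+ 2 * (2 * (2 * 10 ^+ 8 * q%:R) * q%:R / H%:R ^+ 2) :> R.
  rewrite (_ : 10 ^+ 8 = (10 ^+ 4) ^+ 2); last by rewrite -exprM.
  by move: (10 ^+ 4) => c; field; rewrite gt_eqF.
rewrite ler_pM2l ?exprn_gt0// ler_pdivlMr//.
have -> : 2 * q%:R * H%:R * H%:R ^+ 2 = 2 * q%:R * H%:R ^+ 3 :> R by ring.
have -> : 2 * (2 * 10 ^+ 8 * q%:R) * q%:R = 2 * q%:R * (2 * 10 ^+ 8 * q%:R) :> R by ring.
by rewrite ler_pM2l// mulr_gt0.
Qed.

(** Under an excess the diagonal term [4 q / H] is at most a hundredth of the count, so the Fejer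
    term carries the rest; [66 > (800 / 99) ^ 2]. *)
Lemma excess_mean q H : (0 < q)%N -> (0 < H)%N ->
  excess_cst * q%:R / H%:R < #|near_sq q H|%:R ->
  (#|near_sq q H|%:R / q%:R) ^+ 2 <=
  66 * cabs (gauss_fejer R H q) ^+ 2 / (H%:R ^+ 4 * q%:R ^+ 2).
Proof.
move=> q0 H0 exc; have H0' : 0 < H%:R :> R by rewrite ltr0n.
have q0' : 0 < q%:R :> R by rewrite ltr0n.
have b1 := card_near_sq_le R q0 H0.
have W0 : 0 <= #|near_sq q H|%:R :> R by [].
move: b1 exc W0; set W := #|_|%:R; set z := cabs _ => b1 exc W0.
have z0 : 0 <= z by exact: cabs_ge0.
pose p : R := q%:R / H%:R.
pose y : R := z / H%:R ^+ 2.
have y0 : 0 <= y by rewrite divr_ge0 ?exprn_ge0// ltW.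
have b5 : W <= 4 * p + 8 * y by rewrite /p /y !mulrA.
have b6 : 400 * p <= W.
  apply: le_trans (ltW exc).
  have -> : excess_cst * q%:R / H%:R = excess_cst * p by rewrite /p mulrA.
  rewrite ler_wpM2r ?divr_ge0// /excess_cst.
  by rewrite (_ : 10 ^+ 4 = 100 * 100 :> R); [lra|rewrite !exprS expr0; ring].
have b7 : 99 * W <= 800 * y by lra.
have b8 : (99 * W) * (99 * W) <= (800 * y) * (800 * y).
  have W99 : 0 <= 99 * W by lra.
  exact: ler_pM.
rewrite expr_div_n ler_pdivrMr ?exprn_gt0//.
have -> : 66 * z ^+ 2 / (H%:R ^+ 4 * q%:R ^+ 2) * q%:R ^+ 2 = 66 * y ^+ 2.
  by rewrite /y; field; rewrite !gt_eqF.
have := sqr_ge0 y; lra.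
Qed.

End ExcessBounds.

(** * A bound on the excess independent of [H] *)

Section ExcessSum.
Variable R : realType.
Implicit Types (q j k n m : nat).

(** Eighth roots by iterated square roots: the exponents in use are multiples of [1 / 8], so
    comparisons become comparisons of natural powers of [x = root8 2]. *)
Definition root8 (a : R) : R := Num.sqrt (Num.sqrt (Num.sqrt a)).

Lemma root8_ge0 a : 0 <= root8 a.
Proof. exact: sqrtr_ge0. Qed.

Lemma root8_gt0 a : 0 < a -> 0 < root8 a.
Proof. by move=> a0; rewrite !sqrtr_gt0. Qed.

Lemma root8K a : 0 <= a -> root8 a ^+ 8 = a.
Proof.
move=> a0; rewrite (_ : 8 = 2 * 2 * 2)%N// !exprM !sqr_sqrtr ?sqrtr_ge0//.
Qed.

Lemma root8M a b : 0 <= a -> 0 <= b -> root8 (a * b) = root8 a * root8 b.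
Proof. by move=> a0 b0; rewrite /root8 !sqrtrM ?sqrtr_ge0. Qed.

Lemma le_root8 a b : a <= b -> root8 a <= root8 b.
Proof. by move=> ab; rewrite !ler_wsqrtr. Qed.

Local Notation x := (root8 2).

Lemma root8_two_ge : 25 / 23 <= x.
Proof.
rewrite -(@ler_pXn2r _ 8)// ?nnegrE ?root8_ge0 ?divr_ge0//.
by rewrite root8K//; lra.
Qed.

Lemma root8_pow2 k : root8 ((2 ^ k)%:R) = x ^+ k.
Proof.
elim: k => [|k IH]; first by rewrite expn0 expr0 /root8 !sqrtr1.
by rewrite expnS natrM root8M// IH exprS.
Qed.

Lemma pow2_root8 k : (2 ^ k)%:R = x ^+ (8 * k) :> R.
Proof. by rewrite exprM root8K// natrX. Qed.

(* [q ^ (- 9 / 8)] is completely multiplicative, as needed for [tau_moment_sq], and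
   summable; it replaces [1 / q] only for [q < 2 ^ 112], at a loss of at most [2 ^ 14]. *)
Definition weight8 q : R := (q%:R * root8 q%:R)^-1.

Lemma weight8_ge0 q : 0 <= weight8 q.
Proof. by rewrite invr_ge0 mulr_ge0// root8_ge0. Qed.

Lemma weight8M a b : (0 < a)%N -> (0 < b)%N -> weight8 (a * b) = weight8 a * weight8 b.
Proof. by move=> _ _; rewrite /weight8 natrM root8M// -invfM; congr (_^-1); ring. Qed.

(** Telescoping against [- 8 t ^ (- 1 / 8)], a primitive of [t ^ (- 9 / 8)]; with [w ^ 8] and
    [y ^ 8] consecutive integers the comparison is algebraic. *)
Lemma sum_weight8_le n : \sum_(1 <= q < n) weight8 q <= 9.
Proof.
suff le j : \sum_(1 <= q < j.+2) weight8 q <= 9 - 8 / root8 j.+1%:R.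
  case: n => [|[|n]]; [by rewrite big_geq|by rewrite big_geq|].
  apply: le_trans (le n) _; rewrite lerBlDr lerDl divr_ge0// root8_ge0//.
elim: j => [|j IH].
  by rewrite big_nat1 /weight8 /root8 !sqrtr1 mulr1 invr1; lra.
rewrite big_nat_recr//=; apply: le_trans (lerD IH (lexx _)) _.
set w := root8 _; set y := root8 j.+2%:R.
have w0 : 0 < w by rewrite root8_gt0// ltr0n.
have y0 : 0 < y by rewrite root8_gt0// ltr0n.
have wy : w <= y by rewrite le_root8// ler_nat.
have y8 : y ^+ 8 = w ^+ 8 + 1 by rewrite !root8K// natr1.
have -> : weight8 j.+2 = (y ^+ 9)^-1 by rewrite /weight8 -/y -{1}[j.+2%:R]root8K// -exprSr.
have key : y ^+ 8 - w ^+ 8 <= 8 * y ^+ 7 * (y - w).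
  have -> : y ^+ 8 - w ^+ 8 = (y + w) * (y ^+ 2 + w ^+ 2) * (y ^+ 4 + w ^+ 4) * (y - w) by ring.
  rewrite ler_wpM2r ?subr_ge0//.
  have -> : 8 * y ^+ 7 = (y + y) * (y ^+ 2 + y ^+ 2) * (y ^+ 4 + y ^+ 4) by ring.
  have e n' : w ^+ n' <= y ^+ n' by rewrite lerXn2r ?nnegrE// ltW.
  have p n' : 0 <= y ^+ n' by rewrite exprn_ge0// ltW.
  have r n' : 0 <= w ^+ n' by rewrite exprn_ge0// ltW.
  apply: ler_pM; rewrite ?mulr_ge0 ?addr_ge0 ?(ltW y0) ?(ltW w0)//; last by rewrite lerD2l.
  by apply: ler_pM; rewrite ?addr_ge0 ?(ltW y0) ?(ltW w0)// lerD2l.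
have step : (y ^+ 9)^-1 <= 8 / w - 8 / y.
  have -> : 8 / w - 8 / y = 8 * (y - w) / (w * y) by field; rewrite !gt_eqF.
  rewrite -[leLHS]mul1r ler_pdivrMr ?exprn_gt0// mulrAC ler_pdivlMr ?mulr_gt0// mul1r.
  have le1 : 1 <= 8 * y ^+ 7 * (y - w) by move: key; rewrite y8; lra.
  have wy2 : w * y <= y ^+ 2 by rewrite expr2 ler_pM2r.
  apply: (le_trans wy2); have -> : 8 * (y - w) * y ^+ 9 = y ^+ 2 * (8 * y ^+ 7 * (y - w)) by ring.
  by rewrite ler_peMr ?sqr_ge0.
lra.
Qed.

Lemma sum_weight8_tau2 n : \sum_(1 <= q < n) (tau q)%:R ^+ 2 * weight8 q <= 9 ^+ 4.
Proof.
have m1 := tau_moment_sq 1 n weight8_ge0 weight8M.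
have m0 := tau_moment_sq 0 n weight8_ge0 weight8M.
have z := sum_weight8_le n.
have e0 : \sum_(1 <= q < n) (tau q)%:R ^+ 0 * weight8 q = \sum_(1 <= q < n) weight8 q.
  by apply: eq_bigr => q _; rewrite expr0 mul1r.
have z0 : 0 <= \sum_(1 <= q < n) weight8 q by apply: sumr_ge0 => q _; exact: weight8_ge0.
have t0 : 0 <= \sum_(1 <= q < n) (tau q)%:R ^+ 1 * weight8 q.
  by apply: sumr_ge0 => q _; rewrite mulr_ge0 ?exprn_ge0 ?weight8_ge0.
apply: (le_trans m1); rewrite (_ : 4 = 2 * 2)%N// exprM ler_pXn2r ?nnegrE ?sqr_ge0//.
by apply: (le_trans m0); rewrite e0 ler_pXn2r ?nnegrE.
Qed.

Lemma sum_weight8_tau3 n : \sum_(1 <= q < n) (tau q)%:R ^+ 3 * weight8 q <= 9 ^+ 8.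
Proof.
apply: le_trans (tau_moment_sq 2 n weight8_ge0 weight8M) _.
rewrite (_ : 8 = 4 * 2)%N// exprM ler_pXn2r ?nnegrE ?exprn_ge0 ?sum_weight8_tau2//.
by apply: sumr_ge0 => q _; rewrite mulr_ge0 ?exprn_ge0 ?weight8_ge0.
Qed.

(** With [q = m k ^ 2] and [k = sq_kernel q], the term is [1 / (m ^ 2 k ^ 2)], and the sums over [m]
    and [k] are each at most 2. *)
Lemma sum_sq_kernel_sq_le n :
  \sum_(1 <= q < n) (sq_kernel q)%:R ^+ 2 / q%:R ^+ 2 <= 4 :> R.
Proof.
pose g (m e q : nat) : R := if (m * e ^ 2 == q)%N then (m%:R ^+ 2)^-1 * (e%:R ^+ 2)^-1 else 0.
have i0 (m : nat) : 0 <= (m%:R ^+ 2)^-1 :> R by rewrite invr_ge0 sqr_ge0.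
have g0 m e q : 0 <= g m e q by rewrite /g; case: ifP => // _; rewrite mulr_ge0.
apply: (@le_trans _ _ (\sum_(1 <= q < n) \sum_(1 <= m < n) \sum_(1 <= e < n) g m e q)).
  rewrite big_nat_cond [leRHS]big_nat_cond; apply: ler_sum => q.
  rewrite andbT => /andP[q0 qn].
  have [_ [_ _ _ _ /dvdnP[m qE]]] := sq_kernel_spec q0.
  have k0 := sq_kernel_gt0 q0; set k := sq_kernel q in qE k0 *.
  have m0 : (0 < m)%N by move: q0; rewrite qE muln_gt0 => /andP[].
  have k20 : (0 < k ^ 2)%N by rewrite expn_gt0 k0.
  have mn : (1 <= m < n)%N by rewrite m0 (leq_ltn_trans _ qn)// qE leq_pmulr.
  have kn : (1 <= k < n)%N.
    by rewrite k0 (leq_ltn_trans _ qn)// qE (leq_trans _ (leq_pmull _ m0))// expnS expn1 leq_pmulr.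
  rewrite (bigD1_seq m) ?iota_uniq ?mem_index_iota//= (bigD1_seq k) ?iota_uniq ?mem_index_iota//=.
  have -> : k%:R ^+ 2 / q%:R ^+ 2 = g m k q.
    rewrite /g -qE eqxx qE natrM natrX; field.
    by rewrite !pnatr_eq0 -!lt0n k0 m0.
  rewrite -addrA lerDl addr_ge0//; first by apply: sumr_ge0.
  by apply: sumr_ge0 => i _; apply: sumr_ge0.
rewrite exchange_big /=.
apply: (@le_trans _ _ (\sum_(1 <= m < n) \sum_(1 <= e < n) (m%:R ^+ 2)^-1 * (e%:R ^+ 2)^-1)).
  apply: ler_sum => m _; rewrite exchange_big /=; apply: ler_sum => e _.
  rewrite /g -big_mkcond /=; set v := _ * _.
  have v0 : 0 <= v by rewrite mulr_ge0.
  have [q0|none] := boolP ((m * e ^ 2)%N \in index_iota 1 n).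
    rewrite -big_filter (perm_big [:: (m * e ^ 2)%N]) ?big_seq1//=.
    apply: uniq_perm; rewrite ?filter_uniq ?iota_uniq// => q.
    by rewrite mem_filter inE eq_sym; case: eqP => // ->.
  rewrite big_seq_cond big_pred0// => q; apply/negP => /andP[qi /eqP e2].
  by move/negP: none; rewrite e2.
under eq_bigr do rewrite -mulr_sumr.
rewrite -mulr_suml; have s2 := @sum_inv_sq_le R n.
have s0 : 0 <= \sum_(1 <= k < n) (k%:R ^+ 2)^-1 :> R by apply: sumr_ge0.
by rewrite (_ : 4 = 2 * 2 :> R); [exact: ler_pM|ring].
Qed.

(* For [q] of size [2 ^ k] and [H = 2 ^ j], smaller [j] fall under [no_excess] and
   larger ones under [excess_large]. *)
Definition mid_range k j := (k + 24 <= 3 * j)%N && (8 * j <= 5 * k)%N.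

(** The sum over [j] stands in for a supremum: it dominates the term of whichever [H = 2 ^ j] in the
    range occurs for this [q], and the mean square applies to it term by term. *)
Definition mean_excess q : R := \sum_(j < (trunc_log 2 q).+1 | mid_range (trunc_log 2 q) j)
  66 * cabs (gauss_fejer R (2 ^ j) q) ^+ 2 / ((2 ^ j)%:R ^+ 4 * q%:R ^+ 2).

Lemma mean_excess_ge0 q : 0 <= mean_excess q.
Proof.
apply: sumr_ge0 => j _; apply: divr_ge0.
  by apply: mulr_ge0 => //; exact: sqr_ge0.
by apply: mulr_ge0; apply: exprn_ge0.
Qed.

(** One term per source: squares vanishing mod [q]; [excess_small], where [2 ^ 14] bounds [root8 q]
    for [q < 2 ^ 112]; [excess_large]; and the middle range. *)
Definition excess q : R := 2 * ((sq_kernel q)%:R ^+ 2 / q%:R ^+ 2) +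
  16 * 2 ^+ 14 / 10 ^+ 8 * ((tau q)%:R ^+ 3 * weight8 q) +
  64 / 2 ^+ 14 * ((tau q)%:R ^+ 2 * weight8 q) +
  (if (112 <= trunc_log 2 q)%N then mean_excess q else 0).

Lemma excess_ge0 q : 0 <= excess q.
Proof.
have w0 := weight8_ge0 q.
rewrite /excess !addr_ge0 ?mulr_ge0 ?divr_ge0 ?exprn_ge0//.
by case: ifP => // _; exact: mean_excess_ge0.
Qed.

Lemma excessP q j : (0 < q)%N ->
  excess_cst R * q%:R / (2 ^ j)%:R < #|near_sq q (2 ^ j)|%:R ->
  (#|near_sq q (2 ^ j)|%:R / q%:R) ^+ 2 <= excess q.
Proof.
move=> q0 exc; have H0 : (0 < 2 ^ j)%N by rewrite expn_gt0.
have q0' : 0 < q%:R :> R by rewrite ltr0n.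
have [k [kE kq qk]] : exists k, [/\ trunc_log 2 q = k, (2 ^ k <= q)%N & (q < 2 ^ k.+1)%N].
  by exists (trunc_log 2 q); case/andP: (trunc_log_bounds (isT : (1 < 2)%N) q0).
have r0 : 0 < root8 q%:R by rewrite root8_gt0.
have w0 := weight8_ge0 q.
have m0 := mean_excess_ge0 q.
have p1 : 0 <= 2 * ((sq_kernel q)%:R ^+ 2 / q%:R ^+ 2) :> R.
  by rewrite mulr_ge0 ?divr_ge0 ?exprn_ge0.
have p2 : 0 <= 16 * 2 ^+ 14 / 10 ^+ 8 * ((tau q)%:R ^+ 3 * weight8 q).
  by rewrite mulr_ge0 ?mulr_ge0 ?divr_ge0 ?exprn_ge0// mulr_ge0// exprn_ge0.
have p3 : 0 <= 64 / 2 ^+ 14 * ((tau q)%:R ^+ 2 * weight8 q).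
  by rewrite mulr_ge0 ?mulr_ge0 ?divr_ge0 ?exprn_ge0.
have x1 : 1 <= x by have := root8_two_ge; lra.
have x0 : 0 < x by lra.
have x112 : x ^+ 112 = 2 ^+ 14 :> R by rewrite (_ : 112 = 8 * 14)%N// exprM root8K.
rewrite /excess kE; have [k112|k112] := ltnP k 112.
  apply: le_trans (excess_small q0 H0 exc) _; rewrite mulrA addr0 -[leLHS]addr0.
  apply: lerD => //; rewrite lerD2l.
  have rq : root8 q%:R <= 2 ^+ 14.
    rewrite -x112 -root8_pow2 le_root8// ler_nat.
    by apply: ltnW; apply: leq_trans qk _; rewrite leq_exp2l.
  have -> : 16 / 10 ^+ 8 * (tau q)%:R ^+ 3 / q%:R =
      16 * root8 q%:R / 10 ^+ 8 * ((tau q)%:R ^+ 3 * weight8 q).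
    by rewrite /weight8; field; rewrite !gt_eqF.
  by rewrite ler_wpM2r ?mulr_ge0 ?exprn_ge0// ler_wpM2r// ler_wpM2l.
have [j58|j58] := ltnP (5 * k) (8 * j).
  apply: le_trans (excess_large R q0 H0) _.
  have -> : 2 * (sq_kernel q)%:R ^+ 2 / q%:R ^+ 2 = 2 * ((sq_kernel q)%:R ^+ 2 / q%:R ^+ 2) :> R by rewrite mulrA.
  suff le3 : 32 * (tau q)%:R ^+ 2 / (2 ^ j)%:R ^+ 2 <= 64 / 2 ^+ 14 * ((tau q)%:R ^+ 2 * weight8 q).
    by lra.
  (* In powers of [x], [H ^ 2] exceeds [q ^ (9 / 8)] by a factor of at least [x ^ (k - 7)], which is
     more than [2 ^ 13] for [k >= 112]. *)
  have qr : q%:R * root8 q%:R <= x ^+ (9 * k + 9).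
    have -> : (9 * k + 9 = 8 * k.+1 + k.+1)%N by rewrite !mulnS; clear; lia.
    rewrite exprD -pow2_root8 -root8_pow2; apply: ler_pM; rewrite ?root8_ge0//.
      by rewrite ler_nat ltnW.
    by rewrite le_root8// ler_nat ltnW.
  have hj : x ^+ (10 * k + 2) <= (2 ^ j)%:R ^+ 2.
    by rewrite pow2_root8 -exprM ler_weXn2l//; clear -j58; lia.
  have -> : 64 / 2 ^+ 14 * ((tau q)%:R ^+ 2 * weight8 q) =
     32 * (tau q)%:R ^+ 2 * (2 / (2 ^+ 14 * (q%:R * root8 q%:R))).
    by rewrite /weight8; field; rewrite !gt_eqF.
  apply: ler_wpM2l; first by rewrite mulr_ge0// exprn_ge0.
  rewrite -[leLHS]mul1r ler_pdivrMr ?exprn_gt0 ?ltr0n// mulrAC ler_pdivlMr ?mulr_gt0 ?exprn_gt0// mul1r.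
  apply: (@le_trans _ _ (x ^+ 112 * x ^+ (9 * k + 9))).
    by rewrite -x112 ler_pM2l ?exprn_gt0.
  apply: (@le_trans _ _ (x ^+ 8 * x ^+ (10 * k + 2))).
    by rewrite -!exprD ler_weXn2l//; clear -k112; lia.
  by rewrite root8K// ler_pM2l.
have [j3|j3] := ltnP (3 * j) (k + 24).
  exfalso; move: exc; rewrite ltNge => /negP; apply; apply: no_excess => //.
  rewrite -expnM; apply: (@leq_trans (2 ^ (k + 24))); first by rewrite leq_exp2l//; clear -j3; lia.
  rewrite expnD mulnC; apply: leq_mul; last exact: kq.
  rewrite (_ : 24 = 3 * 8)%N; last by [].
  rewrite expnM; apply: (@leq_trans (10 ^ 8)); last exact: leq_pmull.
  by rewrite leq_exp2r.
have mid : mid_range k j by rewrite /mid_range j3 j58.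
have jk : (j < k.+1)%N by clear -j58; lia.
apply: le_trans (excess_mean q0 H0 exc) _.
apply: (@le_trans _ _ (mean_excess q)); last by lra.
rewrite /mean_excess kE (bigD1 (Ordinal jk))//= lerDl.
apply: sumr_ge0 => i _; apply: divr_ge0.
  by apply: mulr_ge0 => //; exact: sqr_ge0.
by apply: mulr_ge0; apply: exprn_ge0.
Qed.

End ExcessSum.

(** * Summation of the excess over all moduli *)

Section ExcessTotal.
Variable R : realType.
Implicit Types (q j k n m : nat).
Local Notation x := (root8 (2 : R)).

Lemma sum_dyadic (F : nat -> R) n :
  \sum_(1 <= q < 2 ^ n) F q = \sum_(k < n) \sum_(t < 2 ^ k) F (2 ^ k + t)%N.
Proof.
elim: n => [|n IH]; first by rewrite expn0 big_geq// big_ord0.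
rewrite big_ord_recr /= -IH (big_cat_nat _ (n := (2 ^ n)%N)) ?expn_gt0 ?leq_exp2l//=.
congr (_ + _); rewrite -{1}[(2 ^ n)%N]add0n big_addn expnS mul2n -addnn addnK big_mkord.
by apply: eq_bigr => t _; rewrite addnC.
Qed.

Lemma trunc_log_dyadic k t : (t < 2 ^ k)%N -> trunc_log 2 (2 ^ k + t) = k.
Proof.
move=> tk; apply: trunc_log_eq => //.
by rewrite leq_addr/= expnS mul2n -addnn ltn_add2l.
Qed.

Lemma sum_mean_excess_dyadic k :
  \sum_(t < 2 ^ k) mean_excess R (2 ^ k + t) <=
  \sum_(j < k.+1 | mid_range k j)
    66 * 160 * (((2 ^ j)%:R)^-1 + 16 * ((2 ^ j)%:R / (2 ^ k)%:R)) * (j + 3)%:R ^+ 6.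
Proof.
have Q0 : (0 < 2 ^ k)%N by rewrite expn_gt0.
have Q0' : 0 < (2 ^ k)%:R :> R by rewrite ltr0n.
apply: (@le_trans _ _ (\sum_(t < 2 ^ k) \sum_(j < k.+1 | mid_range k j)
    66 / ((2 ^ j)%:R ^+ 4 * (2 ^ k)%:R) *
    (cabs (gauss_fejer R (2 ^ j) (2 ^ k + t)) ^+ 2 / (2 ^ k + t)%:R))).
  apply: ler_sum => t _; rewrite /mean_excess trunc_log_dyadic//; apply: ler_sum => j _.
  have H0 : 0 < (2 ^ j)%:R :> R by rewrite ltr0n expn_gt0.
  have q0 : 0 < (2 ^ k + t)%:R :> R by rewrite ltr0n addn_gt0 Q0.
  have le : (2 ^ k)%:R <= (2 ^ k + t)%:R :> R by rewrite ler_nat leq_addr.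
  have g0 : 0 <= cabs (gauss_fejer R (2 ^ j) (2 ^ k + t)) ^+ 2 by exact: sqr_ge0.
  move: ((2 ^ j)%:R) ((2 ^ k + t)%:R) ((2 ^ k)%:R) (cabs _ ^+ 2) H0 q0 le g0 Q0' => H q Q g H0 q0 Qq g0 Q0'.
  have -> : 66 / (H ^+ 4 * Q) * (g / q) = 66 * g / (H ^+ 4 * (Q * q)) by field; rewrite !gt_eqF.
  apply: ler_wpM2l; first by apply: mulr_ge0.
  by rewrite lef_pV2 ?posrE ?mulr_gt0 ?exprn_gt0// ler_pM2l ?exprn_gt0// expr2 ler_pM2r.
rewrite exchange_big /=; apply: ler_sum => j _; rewrite -mulr_sumr.
have H0 : (0 < 2 ^ j)%N by rewrite expn_gt0.
have H0' : 0 < (2 ^ j)%:R :> R by rewrite ltr0n.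
have c0 : 0 <= 66 / ((2 ^ j)%:R ^+ 4 * (2 ^ k)%:R) :> R.
  by apply: divr_ge0 => //; apply: mulr_ge0 => //; apply: exprn_ge0.
apply: le_trans (ler_wpM2l c0 (@gauss_fejer_mean_square R _ _ H0 Q0)) _.
have hb : harm R (4 * 2 ^ j) ^+ 6 <= (j + 3)%:R ^+ 6.
  rewrite lerXn2r ?nnegrE ?harm_ge0//.
  have := harm_pow2 R (j + 2); rewrite expnD mulnC => /le_trans; apply.
  by rewrite !natrD; lra.
have h0 : 0 <= harm R (4 * 2 ^ j) ^+ 6 by rewrite exprn_ge0// harm_ge0.
move: (harm R _ ^+ 6) ((j + 3)%:R ^+ 6) hb h0 => h J hJ h0.
move: ((2 ^ j)%:R) ((2 ^ k)%:R) H0' Q0' {c0} => H Q H0' Q0'.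
have -> : 66 / (H ^+ 4 * Q) * (160 * (Q + 16 * H ^+ 2) * (H ^+ 3 * h)) =
    66 * 160 * (H^-1 + 16 * (H / Q)) * h by field; rewrite !gt_eqF.
apply: ler_wpM2l => //.
apply: mulr_ge0; first by lra.
by apply: addr_ge0; [rewrite invr_ge0 ltW|apply: mulr_ge0 => //; apply: divr_ge0; exact: ltW].
Qed.

Lemma sum_pow2_le n b : \sum_(j < n | (j <= b)%N) (2 ^ j)%:R <= 2 * (2 ^ b)%:R :> R.
Proof.
suff : \sum_(j < n | (j <= b)%N) (2 ^ j)%:R <= (2 ^ minn n b.+1)%:R - 1 :> R.
  move=> /le_trans; apply; rewrite -natrM -expnS lerBlDr.
  by apply: ler_wpDr => //; rewrite ler_nat leq_exp2l// geq_minr.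
elim: n => [|n IH]; first by rewrite big_ord0 min0n expn0 subrr.
rewrite big_mkcond big_ord_recr -big_mkcond /=.
apply: le_trans (lerD IH (lexx _)) _; case: (leqP n b) => nb.
  have -> : minn n b.+1 = n by apply/minn_idPl; rewrite ltnW.
  have -> : minn n.+1 b.+1 = n.+1 by apply/minn_idPl.
  by rewrite expnS natrM; lra.
rewrite addr0; have -> : minn n b.+1 = b.+1 by apply/minn_idPr.
by have -> : minn n.+1 b.+1 = b.+1 by apply/minn_idPr; rewrite ltnS ltnW.
Qed.

Lemma sum_inv_pow2_le n a : \sum_(j < n | (a <= j)%N) ((2 ^ j)%:R)^-1 <= 2 / (2 ^ a)%:R :> R.
Proof.
have pos i : 0 < ((2 ^ i)%:R)^-1 :> R by rewrite invr_gt0 ltr0n expn_gt0.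
suff le1 : \sum_(j < n | (a <= j)%N) ((2 ^ j)%:R)^-1 + (if (a <= n)%N then 2 / (2 ^ n)%:R else 0)
    <= 2 / (2 ^ a)%:R :> R.
  by apply: le_trans le1; rewrite lerDl; case: ifP => // _; rewrite divr_ge0.
elim: n => [|n IH].
  rewrite big_ord0 add0r; case: ifP => [|_]; first by rewrite leqn0 => /eqP ->.
  by rewrite divr_ge0.
rewrite big_mkcond big_ord_recr -big_mkcond /=.
have e2 : 2 / (2 ^ n.+1)%:R = ((2 ^ n)%:R)^-1 :> R.
  by rewrite expnS natrM; field; rewrite pnatr_eq0 expn_eq0.
move: IH; rewrite [(a <= n.+1)%N]leq_eqVlt ltnS; case: (leqP a n) => an.
  by rewrite orbT e2; lra.
rewrite orbF; case: eqP => [->|_]; last by rewrite !addr0.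
move=> _; rewrite addr0 big1 ?add0r// => j.
by move=> /ltn_trans/(_ (ltn_ord j)); rewrite ltnn.
Qed.

(** The sum of [1 / H] is governed by the lower end [a] of the range and that of [H / 2 ^ k] by the
    upper end [b]; each saves a factor [x ^ (2 k) = 2 ^ (k / 4)], while [j + 3 <= 2 k / 3]
    throughout. *)
Lemma mid_sum_le k : (112 <= k)%N ->
  \sum_(j < k.+1 | mid_range k j)
    66 * 160 * (((2 ^ j)%:R)^-1 + 16 * ((2 ^ j)%:R / (2 ^ k)%:R)) * (j + 3)%:R ^+ 6 <=
  2 * k%:R ^+ 6 / x ^+ (2 * k).
Proof.
move=> k112; pose a := (k %/ 3 + 8)%N; pose b := (5 * k %/ 8)%N.
have x1 : 1 <= x by have := root8_two_ge R; lra.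
have x0 : 0 < x by lra.
have Q0 : 0 < (2 ^ k)%:R :> R by rewrite ltr0n expn_gt0.
pose c : R := 66 * 160 * ((2 / 3) ^+ 6 * k%:R ^+ 6).
have c0 : 0 <= c.
  have k6 : 0 <= k%:R ^+ 6 :> R by exact: exprn_ge0.
  by rewrite /c; move: (k%:R ^+ 6) k6 => K k6; clear -k6; lra.
apply: (@le_trans _ _ (c * (\sum_(j < k.+1 | (a <= j)%N) ((2 ^ j)%:R)^-1 +
    16 / (2 ^ k)%:R * \sum_(j < k.+1 | (j <= b)%N) (2 ^ j)%:R))).
  apply: (@le_trans _ _ (\sum_(j < k.+1 | mid_range k j)
      (c * ((2 ^ j)%:R)^-1 + c * (16 / (2 ^ k)%:R) * (2 ^ j)%:R))).
    apply: ler_sum => j /andP[j1 j2].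
    have j6 : (j + 3)%:R ^+ 6 <= (2 / 3) ^+ 6 * k%:R ^+ 6 :> R.
      rewrite -exprMn lerXn2r ?nnegrE ?mulr_ge0 ?divr_ge0//.
      have : (3 * (j + 3))%:R <= (2 * k)%:R :> R by rewrite ler_nat; clear -j2 k112; lia.
      by rewrite !natrM; lra.
    have H0 : 0 < (2 ^ j)%:R :> R by rewrite ltr0n expn_gt0.
    rewrite /c; move: ((j + 3)%:R ^+ 6) ((2 / 3) ^+ 6 * k%:R ^+ 6) ((2 ^ j)%:R) ((2 ^ k)%:R) j6 H0 Q0 => J K H Q JK H0 Q0'.
    have -> : 66 * 160 * K / H + 66 * 160 * K * (16 / Q) * H = 66 * 160 * (H^-1 + 16 * (H / Q)) * K.
      by field; rewrite !gt_eqF.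
    apply: ler_wpM2l => //; apply: mulr_ge0; first by lra.
    by apply: addr_ge0; [rewrite invr_ge0 ltW|apply: mulr_ge0 => //; apply: divr_ge0; exact: ltW].
  rewrite big_split /= mulrDr -!mulr_sumr [X in _ <= _ + X]mulrA; apply: lerD.
    apply: ler_wpM2l => //; rewrite [leLHS]big_mkcond [leRHS]big_mkcond /=.
    apply: ler_sum => j _; case: ifP => [/andP[j1 _]|_]; last by case: ifP.
    rewrite ifT// /a; clear -j1; lia.
  apply: ler_wpM2l; first by rewrite mulr_ge0// divr_ge0.
  rewrite [leLHS]big_mkcond [leRHS]big_mkcond /=.
  apply: ler_sum => j _; case: ifP => [/andP[_ j2]|_]; last by case: ifP.
  rewrite ifT// /b; clear -j2; lia.
have s1 : \sum_(j < k.+1 | (a <= j)%N) ((2 ^ j)%:R)^-1 <= 2 / (2 ^+ 16 * x ^+ (2 * k)).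
  apply: le_trans (sum_inv_pow2_le _ _) _; rewrite ler_pM2l// lef_pV2 ?posrE; last 2 first.
  - by rewrite ltr0n expn_gt0.
  - by rewrite mulr_gt0 ?exprn_gt0.
  have -> : 2 ^+ 16 = x ^+ 128 :> R by rewrite (_ : 128 = 8 * 16)%N// exprM root8K.
  by rewrite pow2_root8 -exprD ler_weXn2l// /a; clear -k112; lia.
have s2 : 16 / (2 ^ k)%:R * \sum_(j < k.+1 | (j <= b)%N) (2 ^ j)%:R <= 32 / (2 ^+ 14 * x ^+ (2 * k)).
  apply: le_trans (ler_wpM2l _ (sum_pow2_le _ _)) _; first by rewrite divr_ge0.
  have -> : 16 / (2 ^ k)%:R * (2 * (2 ^ b)%:R) = 32 * ((2 ^ b)%:R / (2 ^ k)%:R) :> R by field; rewrite gt_eqF.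
  rewrite ler_pM2l// ler_pdivrMr// ler_pdivlMl ?mulr_gt0 ?exprn_gt0//.
  have -> : 2 ^+ 14 = x ^+ 112 :> R by rewrite (_ : 112 = 8 * 14)%N// exprM root8K.
  (* Since [8 b <= 5 k], it suffices that [5 k + 112 + 2 k <= 8 k], that is [k >= 112]. *)
  by rewrite !pow2_root8 -!exprD ler_weXn2l// /b; clear -k112; lia.
apply: le_trans (ler_wpM2l c0 (lerD s1 s2)) _.
have X0 : 0 < x ^+ (2 * k) by rewrite exprn_gt0.
rewrite /c; move: (x ^+ (2 * k)) (k%:R ^+ 6 : R) (exprn_ge0 6 (ler0n R k)) X0 => X K K0 X0.
have -> : 66 * 160 * ((2 / 3) ^+ 6 * K) * (2 / (2 ^+ 16 * X) + 32 / (2 ^+ 14 * X)) =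
  (66 * 160 * (2 / 3) ^+ 6 * (2 / 2 ^+ 16 + 32 / 2 ^+ 14)) * (K / X).
  by field; rewrite gt_eqF.
have -> : 2 * K / X = 2 * (K / X) by rewrite mulrA.
apply: ler_wpM2r; first by rewrite divr_ge0// ltW.
lra.
Qed.

(** Equality at [k = 112]; from there [k ^ 6] grows at each step by at most
    [(113 / 112) ^ 6 <= 25 / 23 <= x]. *)
Lemma pow6_le k : (112 <= k)%N -> k%:R ^+ 6 * 2 ^+ 14 <= 112 ^+ 6 * x ^+ k.
Proof.
have x1 := root8_two_ge R.
elim: k => // k IH; rewrite leq_eqVlt => /orP[/eqP <-|k112].
  by rewrite (_ : x ^+ 112 = 2 ^+ 14)// (_ : 112 = 8 * 14)%N// exprM root8K.
have {}IH := IH k112.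
have k0 : 112 <= k%:R :> R by rewrite ler_nat.
have le6 : k.+1%:R ^+ 6 <= (25 / 23) * k%:R ^+ 6 :> R.
  have : k.+1%:R <= (113 / 112) * k%:R :> R by rewrite -natr1; lra.
  move=> le1; apply: (@le_trans _ _ (((113 / 112) * k%:R) ^+ 6)).
    by rewrite lerXn2r ?nnegrE ?mulr_ge0 ?divr_ge0.
  by rewrite exprMn ler_wpM2r ?exprn_ge0//; lra.
have x0 : 0 < x by lra.
have h : 25 / 23 * (k%:R ^+ 6 * 2 ^+ 14) <= x * (112 ^+ 6 * x ^+ k).
  by apply: ler_pM => //; apply: mulr_ge0; apply: exprn_ge0.
have -> : 112 ^+ 6 * x ^+ k.+1 = x * (112 ^+ 6 * x ^+ k) by rewrite [x ^+ k.+1]exprS mulrCA.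
apply: le_trans h; rewrite [leRHS]mulrA; apply: ler_wpM2r le6; exact: exprn_ge0.
Qed.

Lemma sum_inv_root8_le n : \sum_(112 <= k < n) (x ^+ k)^-1 <= 25 / 2 / 2 ^+ 14.
Proof.
have x1 := root8_two_ge R; have x0 : 0 < x by lra.
have pos i : 0 < (x ^+ i)^-1 by rewrite invr_gt0 exprn_gt0.
have x112 : x ^+ 112 = 2 ^+ 14 by rewrite (_ : 112 = 8 * 14)%N// exprM root8K.
have [n112|/ltnW n112] := leqP n 112.
  by rewrite big_geq// divr_ge0 ?exprn_ge0.
have step m : (x ^+ m)^-1 + 25 / 2 / x ^+ m.+1 <= 25 / 2 / x ^+ m.
  rewrite [x ^+ m.+1]exprS invfM; have := pos m; move: ((x ^+ m)^-1) => y y0.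
  have : x^-1 <= 23 / 25 by rewrite -[23 / 25]invf_div lef_pV2 ?posrE; lra.
  move: (x^-1) => z z1; have : z * y <= 23 / 25 * y by rewrite ler_pM2r.
  by move=> zy; clear -y0 zy; lra.
suff le1 : \sum_(112 <= k < n) (x ^+ k)^-1 + 25 / 2 / x ^+ n <= 25 / 2 / x ^+ 112.
  rewrite -x112; apply: le_trans le1; rewrite lerDl.
  by rewrite mulr_ge0// ltW.
rewrite -(subnKC n112); elim: (n - 112)%N => [|i IH].
  by rewrite addn0 big_geq// add0r.
rewrite addnS big_nat_recr ?leq_addr//; apply: le_trans IH.
by rewrite -addrA lerD2l; exact: step.
Qed.

Lemma sum_excess_le n : \sum_(1 <= q < n) excess R q <= 700 ^+ 2.
Proof.
have x1 := root8_two_ge R; have x0 : 0 < x by lra.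
pose Y q : R := if (112 <= trunc_log 2 q)%N then mean_excess R q else 0.
have Y0 q : 0 <= Y q by rewrite /Y; case: ifP => // _; exact: mean_excess_ge0.
(* This is [2 * 112 ^ 6 / 2 ^ 14] times the geometric tail [25 / 2 / 2 ^ 14], simplified by
   [112 = 7 * 2 ^ 4]. *)
have YS : \sum_(1 <= q < n) Y q <= 25 * 7 ^+ 6 / 16.
  have n2 : (n <= 2 ^ n)%N by rewrite ltnW// ltn_expl.
  case: n n2 => [|n] n2; first by rewrite big_geq// divr_ge0// mulr_ge0// exprn_ge0.
  apply: (@le_trans _ _ (\sum_(1 <= q < 2 ^ n.+1) Y q)).
    rewrite [leRHS](big_cat_nat _ (n := n.+1))//= lerDl.
    by apply: sumr_ge0.
  rewrite sum_dyadic.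
  apply: (@le_trans _ _ (\sum_(k < n.+1 | (112 <= k)%N) 2 * 112 ^+ 6 / 2 ^+ 14 * (x ^+ k)^-1)).
    rewrite [leRHS]big_mkcond /=; apply: ler_sum => k _.
    have -> : \sum_(t < 2 ^ k) Y (2 ^ k + t)%N =
        \sum_(t < 2 ^ k) (if (112 <= k)%N then mean_excess R (2 ^ k + t) else 0).
      by apply: eq_bigr => t _; rewrite /Y trunc_log_dyadic.
    case: ifP => k112; last by rewrite big1.
    apply: le_trans (sum_mean_excess_dyadic k) _.
    apply: le_trans (mid_sum_le k112) _.
    have := pow6_le k112; have X0 : 0 < x ^+ k by rewrite exprn_gt0.
    rewrite mul2n -addnn exprD; move: (x ^+ k) (k%:R ^+ 6) X0 => X K X0 KX.
    rewrite ler_pdivrMr ?mulr_gt0//.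
    have -> : 2 * 112 ^+ 6 / 2 ^+ 14 * X^-1 * (X * X) = 2 * (112 ^+ 6 * X / 2 ^+ 14).
      by field; rewrite gt_eqF.
    by rewrite ler_pM2l// ler_pdivlMr// exprn_gt0.
  rewrite -mulr_sumr.
  have -> : \sum_(k < n.+1 | (112 <= k)%N) (x ^+ k)^-1 = \sum_(112 <= k < n.+1) (x ^+ k)^-1.
    by rewrite big_geq_mkord.
  have c0 : 0 <= 2 * 112 ^+ 6 / 2 ^+ 14 :> R.
    by apply: divr_ge0; [apply: mulr_ge0 => //|]; exact: exprn_ge0.
  apply: le_trans (ler_wpM2l c0 (sum_inv_root8_le _)) _.
  lra.
rewrite /excess -/(Y _) !big_split /= -!mulr_sumr.
have s1 := @sum_sq_kernel_sq_le R n; have s2 := sum_weight8_tau3 R n.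
have s3 := sum_weight8_tau2 R n.
have e1 := ler_wpM2l (ler0n R 2) s1.
have c2 : 0 <= 16 * 2 ^+ 14 / 10 ^+ 8 :> R by lra.
have c3 : 0 <= 64 / 2 ^+ 14 :> R by lra.
have e2 := ler_wpM2l c2 s2; have e3 := ler_wpM2l c3 s3.
(* The four parts are about 8, 112844, 26 and 183827, against 490000. *)
apply: le_trans (lerD (lerD (lerD e1 e2) e3) YS) _.
lra.
Qed.

End ExcessTotal.

(** * Covering the exceptional set *)

Section CountBound.
Variable R : realType.
Implicit Types (q n : nat) (phi sigma delta : R).

(** [2 ^ j] is [1 / (6 phi)] rounded down to a power of 2, whence [1 / 2 ^ j <= 12 phi] and the
    constant [24 = 2 * 12]. The two terms on the right answer to absence and presence of an
    excess. *)
Lemma count_bound q phi : (0 < q)%N -> 0 < phi -> phi <= 6^-1 -> exists j : nat,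
  6 * (2 ^ j)%:R * phi <= 1 /\
  2 * phi / q%:R * #|near_sq q (2 ^ j)|%:R <=
    24 * excess_cst R * phi ^+ 2 + 2 * phi * Num.sqrt (excess R q).
Proof.
move=> q0 p0 p6; have q0' : 0 < q%:R :> R by rewrite ltr0n.
pose y : R := (6 * phi)^-1.
have y1 : 1 <= y by rewrite /y -[leLHS]invr1 lef_pV2 ?posrE; lra.
pose N := Num.truncn y.
have /andP[N1 N2] : N%:R <= y < N.+1%:R by apply: Num.Theory.truncn_itv; lra.
have N0 : (0 < N)%N by rewrite /N Num.Theory.truncn_gt0.
pose j := trunc_log 2 N; have /andP[jN Nj] := trunc_log_bounds (isT : (1 < 2)%N) N0.
rewrite -/j in jN Nj.
have H0 : 0 < (2 ^ j)%:R :> R by rewrite ltr0n expn_gt0.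
have hy : 6 * phi * y = 1 by rewrite /y mulfV// gt_eqF// mulr_gt0.
have Hy : (2 ^ j)%:R <= y by apply: le_trans N1; rewrite ler_nat.
have yH : y < 2 * (2 ^ j)%:R.
  by apply: lt_le_trans N2 _; rewrite -natrM -expnS ler_nat.
exists j; split.
  by rewrite mulrAC -[leRHS]hy; apply: ler_wpM2l => //; lra.
have invH : ((2 ^ j)%:R)^-1 <= 12 * phi.
  rewrite -[leLHS]mul1r ler_pdivrMr// -[leLHS]hy.
  have -> : 12 * phi * (2 ^ j)%:R = 6 * phi * (2 * (2 ^ j)%:R) by ring.
  by apply: ler_wpM2l; [lra|exact: ltW].
have C0 : 0 <= excess_cst R by rewrite /excess_cst; lra.
have s0 : 0 <= Num.sqrt (excess R q) by exact: sqrtr_ge0.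
have [le|gt] := leP #|near_sq q (2 ^ j)|%:R (excess_cst R * q%:R / (2 ^ j)%:R).
  apply: (@le_trans _ _ (24 * excess_cst R * phi ^+ 2)); last first.
    by rewrite lerDl mulr_ge0// mulr_ge0// ltW.
  have c0 : 0 <= 2 * phi / q%:R by rewrite divr_ge0 ?mulr_ge0// ltW.
  apply: le_trans (ler_wpM2l c0 le) _.
  move: (excess_cst R) ((2 ^ j)%:R) C0 H0 invH => C H C0 H0 invH.
  have -> : 2 * phi / q%:R * (C * q%:R / H) = 2 * phi * C * H^-1 by field; rewrite !gt_eqF.
  have -> : 24 * C * phi ^+ 2 = 2 * phi * C * (12 * phi) by ring.
  by rewrite ler_wpM2l// mulr_ge0// mulr_ge0// ltW.
apply: (@le_trans _ _ (2 * phi * Num.sqrt (excess R q))); last first.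
  by rewrite lerDr mulr_ge0 ?sqr_ge0// mulr_ge0.
rewrite mulrAC -mulrA ler_pM2l ?mulr_gt0//.
rewrite -(@ler_pXn2r _ 2)// ?nnegrE ?divr_ge0//.
by rewrite sqr_sqrtr ?excess_ge0//; exact: excessP.
Qed.

(** Cauchy-Schwarz in the form [2 p s <= (700 / sigma) p ^ 2 + (sigma / 700) s ^ 2]; with
    [sum_excess_le] each half adds up to at most [700 sigma]. *)
Lemma sum_count_bound (phi : nat -> R) sigma n : 0 < sigma ->
  (forall q, (0 < q)%N -> 0 <= phi q) ->
  \sum_(1 <= q < n) phi q ^+ 2 <= sigma ^+ 2 ->
  \sum_(1 <= q < n) (24 * excess_cst R * phi q ^+ 2 + 2 * phi q * Num.sqrt (excess R q)) <=
  24 * excess_cst R * sigma ^+ 2 + 1400 * sigma.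
Proof.
move=> s0 p0 psum.
have C0 : 0 <= 24 * excess_cst R by rewrite /excess_cst; lra.
rewrite big_split /= -mulr_sumr; apply: lerD; first exact: ler_wpM2l.
apply: (@le_trans _ _ (\sum_(1 <= q < n) (700 / sigma * phi q ^+ 2 + sigma / 700 * excess R q))).
  rewrite big_nat_cond [leRHS]big_nat_cond; apply: ler_sum => q.
  rewrite andbT => /andP[q0 _].
  have e2 : excess R q = Num.sqrt (excess R q) ^+ 2 by rewrite sqr_sqrtr// excess_ge0.
  rewrite [X in _ <= _ + _ * X]e2; move: (Num.sqrt _) (phi q) => s p.
  have -> : 700 / sigma * p ^+ 2 + sigma / 700 * s ^+ 2 =
    2 * p * s + (700 * p - sigma * s) ^+ 2 / (700 * sigma) by field; lra.
  by rewrite lerDl; apply: divr_ge0; [exact: sqr_ge0|lra].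
rewrite big_split /= -!mulr_sumr.
have a0 : 0 <= 700 / sigma by apply: divr_ge0; lra.
have b0 : 0 <= sigma / 700 by lra.
apply: le_trans (lerD (ler_wpM2l a0 psum) (ler_wpM2l b0 (sum_excess_le R n))) _.
by rewrite le_eqVlt; apply/orP; left; apply/eqP; field; lra.
Qed.

Lemma dist_int_attained (y : R) : exists m : int, dist_int y = `|y - m%:~R|.
Proof.
pose m := Num.floor (y + 2^-1); exists m.
have := Num.Theory.floor_itv (y + 2^-1); rewrite -/m intrD => /andP[m1 m2].
have ym : `|y - m%:~R| <= 2^-1 by rewrite ler_norml; apply/andP; split; lra.
apply/eqP; rewrite eq_le; apply/andP; split.
  apply: ge_inf; last by exists m.
  by exists 0 => _ [k _ <-]; exact: normr_ge0.
apply: lb_le_inf; first by exists `|y - m%:~R|; exists m.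
move=> _ [k _ <-]; have [->//|km] := eqVneq k m.
have : 1 <= `|m%:~R - k%:~R| :> R by rewrite -intrB -intr_norm -[1]/(1%:~R) ler_int; lia.
have := ler_normB (m%:~R - y) (k%:~R - y).
have -> : m%:~R - y - (k%:~R - y) = m%:~R - k%:~R by ring.
by rewrite [`|m%:~R - y|]distrC [`|k%:~R - y|]distrC; lra.
Qed.

Lemma near_sqP q H (a : nat) (b z : int) (aq : (a < q)%N) : (0 < H)%N ->
  (a ^ 2)%:Z = q%:Z * b + z -> 2 * H%:Z * `|z| <= q%:Z -> Ordinal aq \in near_sq q H.
Proof.
move=> H0 aE zq; have q0 : (0 < q)%N by exact: leq_ltn_trans aq.
rewrite inE /=; case: z aE zq => z aE zq.
  have zq' : (2 * H * z <= q)%N by rewrite -lez_nat !PoszM.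
  have ltz : (z < q)%N.
    by case: z zq' {aE zq} => // z zq'; apply: leq_trans zq'; rewrite -mulnA mul2n -addnn -addn1 leq_add// ?leq_pmull// muln_gt0 H0.
  have [b' bE] : exists b' : nat, b = b'%:Z.
    by case: b aE => b' aE; [exists b'|exfalso; nia].
  have -> : (a ^ 2 = b' * q + z)%N by apply/eqP; rewrite -eqz_nat aE bE PoszD PoszM mulrC.
  by rewrite modnMDl modn_small// zq'.
rewrite NegzE normrN /= in aE zq.
have zq' : (2 * H * z.+1 <= q)%N by rewrite -lez_nat !PoszM.
have ltz : (z.+1 <= q)%N by apply: leq_trans zq'; rewrite leq_pmull// muln_gt0.
have [b' bE] : exists b' : nat, b = b'.+1%:Z.
  by case: b aE => [[|b']|b'] aE; [exfalso; nia|exists b'|exfalso; nia].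
have ltr : (q - z.+1 < q)%N by rewrite ltn_subrL.
have -> : (a ^ 2 = b' * q + (q - z.+1))%N.
  by apply/eqP; rewrite -eqz_nat aE bE PoszD PoszM -subzn// -addn1 PoszD; apply/eqP; ring.
by rewrite modnMDl modn_small// subKn// zq' orbT.
Qed.

Lemma near_sq_cover q H (phi x : R) : (0 < q)%N -> (0 < H)%N -> 0 <= phi ->
  6 * H%:R * phi <= 1 -> 0 <= x <= 1 ->
  dist_int (q%:R * x) <= phi -> dist_int (q%:R * x ^+ 2) <= phi ->
  exists2 a : 'I_q, a \in near_sq q H &
    ((a : nat)%:R - phi) / q%:R <= x <= ((a : nat)%:R + phi) / q%:R \/
    (a = 0%N :> nat /\ 1 - phi / q%:R <= x).
Proof.
move=> q0 H0 p0 p6 /andP[x0 x1].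
have q0' : 0 < q%:R :> R by rewrite ltr0n.
have H1 : 1 <= H%:R :> R by rewrite ler1n.
have p1 : phi <= 6^-1 by nra.
have [m ->] := dist_int_attained (q%:R * x); have [b ->] := dist_int_attained (q%:R * x ^+ 2).
rewrite !ler_norml => /andP[a1 a2] /andP[b1 b2].
have zero_near : Ordinal q0 \in near_sq q H by rewrite inE /= exp0n// mod0n muln0.
have m0 : 0 <= m.
  rewrite leNgt; apply/negP => m0.
  have : m%:~R <= (-1)%:~R :> R by rewrite ler_int; clear -m0; lia.
  by rewrite intrN; have := mulr_ge0 (ltW q0') x0; lra.
case: m m0 a1 a2 => // a _; rewrite -[_%:~R]/(a%:R) => a1 a2.
(* The integer nearest to [q x] may be [q]: then [x] is close to 1 and is assigned to the residue
   0. *)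
have [aq|qa] := ltnP a q; last first.
  exists (Ordinal q0) => //; right; split => //.
  have : q%:R <= a%:R :> R by rewrite ler_nat.
  by rewrite lerBlDr -lerBlDl ler_pdivlMr//; lra.
exists (Ordinal aq); last first.
  by left; rewrite /= ler_pdivrMr// ler_pdivlMr//; apply/andP; split; lra.
pose z : int := (a ^ 2)%:Z - q%:Z * b.
apply: (@near_sqP q H a b z aq H0); first by rewrite /z; ring.
have aq1 : a%:R <= q%:R - 1 :> R by rewrite lerBrDr natr1 ler_nat.
pose t : R := q%:R * x - a%:R; pose e : R := q%:R * x ^+ 2 - b%:~R.
(* From [(q x) ^ 2 = (a + t) ^ 2]; the three terms are at most [q phi], [2 (q - 1) phi] and [phi] in
   absolute value. *)
have zE : z%:~R = q%:R * e - 2 * a%:R * t - t ^+ 2 :> R.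
  by rewrite /z intrB intrM -!pmulrn natrX /t /e; ring.
have a0 : 0 <= a%:R :> R by [].
have zle : `|z%:~R| <= 3 * q%:R * phi :> R.
  have t2 : t ^+ 2 <= phi by rewrite /t; nra.
  have t1 : - phi <= t <= phi by rewrite /t; apply/andP; split; lra.
  have e1 : - phi <= e <= phi by rewrite /e; apply/andP; split; lra.
  case/andP: t1 => t1 t1'; case/andP: e1 => e1 e1'.
  have qe1 : - (q%:R * phi) <= q%:R * e by rewrite -mulrN ler_pM2l.
  have qe2 : q%:R * e <= q%:R * phi by rewrite ler_pM2l.
  have at1 : - (a%:R * phi) <= a%:R * t by rewrite -mulrN ler_wpM2l.
  have at2 : a%:R * t <= a%:R * phi by rewrite ler_wpM2l.
  have aphi : a%:R * phi <= (q%:R - 1) * phi by rewrite ler_wpM2r.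
  have tsq := sqr_ge0 t.
  by rewrite zE ler_norml; apply/andP; split; lra.
rewrite -(ler_int R) !intrM intr_norm -!pmulrn.
apply: (@le_trans _ _ (2 * H%:R * (3 * q%:R * phi))); first by rewrite ler_wpM2l.
have -> : 2 * H%:R * (3 * q%:R * phi) = q%:R * (6 * H%:R * phi) by ring.
by rewrite ler_piMr.
Qed.

End CountBound.

(** * From counting residues to Lebesgue measure *)

Section MeasureBound.
Local Open Scope classical_set_scope.
Variable R : realType.
Implicit Types (q H : nat) (phi sigma delta : R).

Local Notation mu := (@lebesgue_measure R).

Lemma outer_measure_big (I : Type) (r : seq I) (P : pred I) (F : I -> set R) :
  (mu (\big[setU/set0]_(i <- r | P i) F i) <= \sum_(i <- r | P i) mu (F i))%E.
Proof.
elim/big_ind2 : _ => // [|A a B b Aa Bb]; first by rewrite measure0.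
exact: le_trans (outer_measureU2 _ _ _) (leeD Aa Bb).
Qed.

Lemma lebesgue_measure_segment_le (a b : R) : a <= b -> (mu `[a, b] <= (b - a)%:E)%E.
Proof. by move=> ab; rewrite lebesgue_measure_itv/=; case: ifP => // _; rewrite lee_fin subr_ge0. Qed.

Definition near_rational phi q : set R :=
  [set x | [/\ 0 <= x <= 1, dist_int (q%:R * x) <= phi & dist_int (q%:R * x ^+ 2) <= phi]].

Lemma near_rational_count q H phi : (0 < q)%N -> (0 < H)%N -> 0 <= phi ->
  6 * H%:R * phi <= 1 ->
  (mu (near_rational phi q) <= (2 * phi / q%:R * #|near_sq q H|%:R)%:E)%E.
Proof.
move=> q0 H0 p0 p6; have q0' : 0 < q%:R :> R by rewrite ltr0n.
have pq : 0 <= phi / q%:R by rewrite divr_ge0// ltW.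
(* The residue 0 stands for both ends of [[0, 1]]; its two half intervals have the total length of
   any other [J a]. *)
pose J (a : 'I_q) : set R := if a == 0%N :> nat
  then `[0, phi / q%:R] `|` `[1 - phi / q%:R, 1]
  else `[(a%:R - phi) / q%:R, (a%:R + phi) / q%:R].
have muJ a : (mu (J a) <= (2 * phi / q%:R)%:E)%E.
  rewrite /J; case: ifP => _.
    apply: le_trans (outer_measureU2 _ _ _) _.
    apply: le_trans (leeD (lebesgue_measure_segment_le _) (lebesgue_measure_segment_le _)) _ => //.
      by rewrite lerBlDr lerDl.
    by rewrite -EFinD lee_fin; lra.
  apply: le_trans (lebesgue_measure_segment_le _) _.
    by rewrite ler_pM2r ?invr_gt0//; lra.
  by rewrite lee_fin -mulrBl; lra.
apply: (@le_trans _ _ (mu (\big[setU/set0]_(a in near_sq q H) J a))).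
  apply: le_outer_measure => x [x01 d1 d2].
  have [a aq xa] := near_sq_cover q0 H0 p0 p6 x01 d1 d2.
  rewrite (bigD1 a)//=; left; rewrite /J; case/andP: x01 => x0 x1.
  case: eqP => a0; case: xa => [/andP[xa xb]|[a00 xa]] //=.
  - by left; rewrite /= in_itv/= x0; rewrite a0 add0r in xb.
  - by right; rewrite /= in_itv/= xa.
apply: le_trans (outer_measure_big _ _ _) _.
apply: le_trans (lee_sum _ (fun a _ => muJ a)) _.
by rewrite sumEFin sumr_const mulr_natr.
Qed.

Lemma near_rational_le q phi : (0 < q)%N -> 0 <= phi -> phi <= 6^-1 ->
  (mu (near_rational phi q) <=
    (24 * excess_cst R * phi ^+ 2 + 2 * phi * Num.sqrt (excess R q))%:E)%E.
Proof.
move=> q0 p0 p6; move: p0; rewrite le_eqVlt => /orP[/eqP <-|p0].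
  apply: le_trans (@near_rational_count q 1 0 q0 isT (lexx _) _) _; first by rewrite mulr0.
  by rewrite lee_fin expr0n/= !(mulr0, mul0r) addr0.
have [j [j1 j2]] := count_bound q0 p0 p6.
apply: le_trans (near_rational_count q0 _ (ltW p0) j1) _; first by rewrite expn_gt0.
by rewrite lee_fin.
Qed.

(** [[0, 1]] is covered by [badB] and the sets [near_rational (phi q) q], and [lebesgue_measure] is
    countably subadditive as an outer measure on all sets. Truncating [kappa psi] at 0 allows for
    negative [kappa]. *)
Lemma badB_measure_ge (psi : nat -> R) kappa sigma delta :
  0 < sigma -> sigma <= 6^-1 ->
  (forall n, \sum_(1 <= q < n) Num.max 0 (kappa * psi q) ^+ 2 <= sigma ^+ 2) ->
  24 * excess_cst R * sigma ^+ 2 + 1400 * sigma <= delta ->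
  ((1 - delta)%:E <= mu (badB psi kappa))%E.
Proof.
move=> s0 s6 psum sd.
pose phi q := Num.max 0 (kappa * psi q).
have p0 q : 0 <= phi q by rewrite /phi le_max lexx.
have p6 q : (0 < q)%N -> phi q <= 6^-1.
  move=> q0; apply: le_trans s6; rewrite -(@ler_pXn2r _ 2)// ?nnegrE ?(ltW s0)//.
  apply: le_trans (psum q.+1); rewrite big_nat_recr//= lerDr.
  by apply: sumr_ge0 => *; exact: sqr_ge0.
(* Index 0 corresponds to no [q] and is given to [badB]. *)
pose F n : set R := if n is 0%N then badB psi kappa else near_rational (phi n) n.
have cover : `[0, 1] `<=` \bigcup_n F n.
  move=> x /=; rewrite in_itv/= => x01.
  have [xB|] := pselect (badB psi kappa x); first by exists 0%N.
  move=> nB; apply: contrapT => nF; apply: nB; split=> // q q0.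
  rewrite ltNge; apply/negP; rewrite ge_max => /andP[d1 d2]; apply: nF.
  exists q => //; case: q q0 d1 d2 => // q _ d1 d2; split=> //; rewrite /phi le_max.
    by rewrite d1 orbT.
  by rewrite d2 orbT.
have : (mu `[0%R, 1%R] <= mu (badB psi kappa) + delta%:E)%E.
  apply: (@le_trans _ _ (mu (\bigcup_n F n))); first exact: le_outer_measure.
  apply: le_trans (outer_measure_sigma_subadditive mu F) _.
  apply: lime_le; first by apply: is_cvg_nneseries => *; exact: outer_measure_ge0.
  apply: nearW => n; case: n => [|n].
    rewrite big_geq//; apply: adde_ge0; first exact: outer_measure_ge0.
    rewrite lee_fin; apply: le_trans sd; apply: addr_ge0; last by lra.
    by apply: mulr_ge0; [rewrite /excess_cst; lra|exact: sqr_ge0].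
  rewrite big_ltn//; apply: leeD => //.
  apply: le_trans (_ : ((\sum_(1 <= q < n.+1)
     (24 * excess_cst R * phi q ^+ 2 + 2 * phi q * Num.sqrt (excess R q)))%:E <= _)%E).
    rewrite -sumEFin [leLHS]big_nat_cond [leRHS]big_nat_cond; apply: lee_sum => q.
    by rewrite andbT => /andP[q0 _]; case: q q0 => // q q0; exact: near_rational_le (p6 _ _).
  by rewrite lee_fin; apply: le_trans (sum_count_bound s0 (fun q _ => p0 q) (psum _)) sd.
rewrite lebesgue_measure_itv/= lte_fin ltr01 sube0 EFinB.
by rewrite leeBlDr.
Qed.

End MeasureBound.

(** * Numerical constants *)

Section Constants.
Local Open Scope classical_set_scope.
Variable R : realType.

(** The triple angle formula at [pi / 6] gives [(s + 1) (2 s - 1) ^ 2 = 0] for [s = sin (pi / 6)],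
    so [s = 1 / 2], and [sin x <= x] concludes. *)
Lemma pi_ge3 : 3 <= pi :> R.
Proof.
have p0 := @pi_gt0 R; pose x : R := pi / 6.
have x0 : 0 <= x by rewrite /x; lra.
have s0 : 0 <= sin x by apply: sin_ge0_pi; rewrite /x; apply/andP; split; lra.
have : sin (x *+ 2 + x) = 1.
  by rewrite -sin_pihalf; congr sin; rewrite /x; field.
rewrite sinD sin_mulr2n cos_mulr2n => triple.
have cs := @cos2Dsin2 R x.
have cubic : (sin x + 1) * (2 * sin x - 1) ^+ 2 = 0.
  have e : cos x ^+ 2 = 1 - sin x ^+ 2 by lra.
  have : 1 = 3 * sin x - 4 * sin x ^+ 3 :> R.
    apply: etrans (esym triple) _.
    have -> : (cos x * sin x) *+ 2 * cos x + (cos x ^+ 2 *+ 2 - 1) * sin x =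
      (4 * cos x ^+ 2 - 1) * sin x by ring.
    by rewrite e; ring.
  by move=> h; rewrite -[RHS](subrr 1) [X in _ = _ - X]h; ring.
have half : sin x = 2^-1.
  have : 2 * sin x - 1 = 0.
    by apply/eqP; rewrite -sqrf_eq0; move/eqP: cubic; rewrite mulf_eq0 gt_eqF//; lra.
  by lra.
by have := sin_le_id x0; rewrite half /x; lra.
Qed.

(** [expR (71 / 100)] is a 16th power, at least [(1 + 71 / 1600) ^ 16 >= 2]. *)
Lemma ln2_le : ln 2 <= 71 / 100 :> R.
Proof.
rewrite -[leRHS]expRK ler_ln ?posrE ?expR_gt0//.
have -> : 71 / 100 = 16%:R * (71 / 1600) :> R by field.
rewrite expRM_natl; have h : 1 + 71 / 1600 <= expR (71 / 1600 : R) by exact: expR_ge1Dx.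
apply: (@le_trans _ _ ((1 + 71 / 1600) ^+ 16)); first by lra.
by apply: lerXn2r h; rewrite nnegrE; [lra|exact: expR_ge0].
Qed.

Lemma sum_riemannR (s : R) n :
  \sum_(0 <= k < n) riemannR s k = \sum_(1 <= q < n.+1) (q%:R `^ s)^-1.
Proof. by rewrite big_add1. Qed.

(** Cauchy condensation: dyadic block [k] is at most [(2 ^ (1 - s)) ^ k]. Convergence makes the
    partial sums lower bounds of [zeta], which is defined as a limit. *)
Lemma cvg_riemannR (s : R) : 1 < s -> cvgn (series (riemannR s)).
Proof.
move=> s1; pose x : R := (2 `^ (s - 1))^-1.
have s0 : 0 <= s by lra.
have y1 : 1 < 2 `^ (s - 1) :> R.
  by rewrite -[ltLHS](powRr0 2) /powR !gt_eqF// ltr_expR ltr_pM2r ?ln_gt0 ?subr_gt0// ltr1n.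
have x0 : 0 < x by rewrite invr_gt0; lra.
have x1 : x < 1 by rewrite invf_lt1; lra.
apply: nondecreasing_is_cvgn.
  by apply: nondecreasing_series => n _ _; exact: ltW (riemannR_gt0 _ s0).
exists (1 - x)^-1 => _ [n _ <-]; rewrite /series /= sum_riemannR.
apply: (@le_trans _ _ (\sum_(1 <= q < 2 ^ n.+1) ((q%:R : R) `^ s)^-1)).
  have nn : (n.+1 <= 2 ^ n.+1)%N by rewrite ltnW// ltn_expl.
  rewrite [leRHS](big_cat_nat _ (n := n.+1))//= lerDl.
  by apply: sumr_ge0 => q _; rewrite invr_ge0 powR_ge0.
rewrite sum_dyadic.
apply: (@le_trans _ _ (\sum_(k < n.+1) x ^+ k)); last first.
  rewrite -(@ler_pM2l _ (1 - x)) ?subr_gt0// mulfV ?gt_eqF ?subr_gt0//.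
  by rewrite -opprB mulNr -subrX1 opprB gerBl exprn_ge0// ltW.
apply: ler_sum => k _.
apply: (@le_trans _ _ (\sum_(t < 2 ^ k) (((2 ^ k)%:R : R) `^ s)^-1)).
  apply: ler_sum => t _; rewrite lef_pV2 ?posrE ?powR_gt0 ?ltr0n ?addn_gt0 ?expn_gt0//.
  by apply: ge0_ler_powR; rewrite ?nnegrE// ler_nat leq_addr.
rewrite sumr_const card_ord -[leLHS]mulr_natl natrX.
have -> : ((2 : R) ^+ k) `^ s = 2 ^+ k * (2 `^ (s - 1)) ^+ k.
  have e : 2 * 2 `^ (s - 1) = 2 `^ s :> R.
    by rewrite -[X in X * _ `^ _]powRr1// -powRD ?pnatr_eq0 ?implybT// addrC subrK.
  by rewrite -exprMn e -(powR_mulrn k (powR_ge0 2 s)) -powRrM mulrC powRrM powR_mulrn.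
by rewrite invfM mulrA mulfV ?mul1r ?exprVn// gt_eqF// exprn_gt0.
Qed.

(** For [n <= 2 ^ 11], [n ^ (12 / 11) <= 2 n], so each of the 11 dyadic blocks contributes at least
    [1 / 4]; the term [n = 1] adds 1. *)
Lemma zeta_ge : 15 / 4 <= zeta (12 / 11 : R).
Proof.
have s1 : 1 < 12 / 11 :> R by lra.
have s0 : 0 <= 12 / 11 :> R by lra.
apply: le_trans (nondecreasing_cvgn_le _ (cvg_riemannR s1) (2 ^ 11)%N); last first.
  by apply: nondecreasing_series => n _ _; exact: ltW (riemannR_gt0 _ s0).
have N0 : (0 < 2 ^ 11)%N by rewrite expn_gt0.
rewrite /series /= (big_ltn N0) sum_dyadic.
have -> : riemannR (12 / 11) 0%N = 1 :> R by rewrite /riemannR mulr1n powR1 invr1.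
have blk (k : nat) : (k < 11)%N -> 4^-1 <= \sum_(t < 2 ^ k) riemannR (12 / 11 : R) (2 ^ k + t)%N.
  move=> k11; apply: (@le_trans _ _ (\sum_(t < 2 ^ k) (2 * (2 ^ k.+1)%:R)^-1)).
    rewrite sumr_const card_ord -[leRHS]mulr_natl expnS natrM.
    have : 0 < (2 ^ k)%:R :> R by rewrite ltr0n expn_gt0.
    by move: (2 ^ k)%:R => K K0; rewrite le_eqVlt; apply/orP; left; apply/eqP; field; rewrite gt_eqF.
  apply: ler_sum => t _; rewrite /riemannR.
  have mE : ((2 ^ k + t).+1 <= 2 ^ k.+1)%N by rewrite expnS mul2n -addnn ltn_add2l.
  have m11 : ((2 ^ k + t).+1 <= 2 ^ 11)%N by rewrite (leq_trans mE)// leq_exp2l.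
  set m := (2 ^ k + t).+1%N in mE m11 *.
  have m0 : 0 < m%:R :> R by rewrite ltr0n.
  rewrite lef_pV2 ?posrE ?mulr_gt0 ?powR_gt0 ?ltr0n ?expn_gt0//.
  have -> : 12 / 11 = 11^-1 + 1 :> R by field.
  rewrite powRD ?gt_eqF ?implybT// powRr1 ?(ltW m0)//; apply: ler_pM; [exact: powR_ge0|exact: ltW| |].
  - have e2 : 2 = (2 ^+ 11) `^ 11^-1 :> R.
      by rewrite -powR_mulrn// -powRrM mulfV ?pnatr_eq0// powRr1.
    rewrite e2; apply: ge0_ler_powR; rewrite ?nnegrE ?(ltW m0) ?exprn_ge0//.
    by rewrite -natrX ler_nat.
  - by rewrite ler_nat.
have : \sum_(k < 11) 4^-1 <= \sum_(k < 11) \sum_(t < 2 ^ k) riemannR (12 / 11 : R) (2 ^ k + t)%N.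
  by apply: ler_sum => k _; exact: blk.
by rewrite sumr_const card_ord -[leLHS]mulr_natl; lra.
Qed.

(** [sqrt 6 <= 2.45], [ln 2 <= 0.71], [pi >= 3] and [sqrt zeta >= 1.93] give about [3.4 / 10 ^ 4],
    under the [3.5 / 10 ^ 4] claimed. *)
Lemma kappa_const_le : 2 * Num.sqrt 6 * (5 * ln 2) ^+ 4 /
  (3 * pi ^+ 3 * Num.sqrt (zeta (12 / 11)) * 11 ^+ 4) <= 7 / (2 * 10 ^+ 4) :> R.
Proof.
have l0 : 0 <= ln 2 :> R by rewrite ln_ge0// ler1n.
have s6 : Num.sqrt 6 <= 49 / 20 :> R.
  rewrite -[leRHS]ger0_norm; last lra.
  by rewrite -sqrtr_sqr ler_sqrt; lra.
have sz : 193 / 100 <= Num.sqrt (zeta (12 / 11)) :> R.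
  rewrite -[leLHS]ger0_norm; last lra.
  by rewrite -sqrtr_sqr; apply: ler_wsqrtr; apply: le_trans zeta_ge; lra.
have s0 : 0 <= Num.sqrt 6 :> R by exact: sqrtr_ge0.
have num : 2 * Num.sqrt 6 * (5 * ln 2) ^+ 4 <= 49 / 10 * (71 / 20) ^+ 4 :> R.
  apply: ler_pM; [by rewrite mulr_ge0|by rewrite exprn_ge0// mulr_ge0|lra|].
  by apply: lerXn2r; rewrite ?nnegrE; [exact: mulr_ge0|lra|have := ln2_le; lra].
have den : 3 * 3 ^+ 3 * (193 / 100) * 11 ^+ 4 <=
    3 * pi ^+ 3 * Num.sqrt (zeta (12 / 11)) * 11 ^+ 4 :> R.
  have p3 : 3 ^+ 3 <= pi ^+ 3 :> R.
    by apply: lerXn2r pi_ge3; rewrite nnegrE//; exact: pi_ge0.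
  apply: ler_wpM2r; first exact: exprn_ge0.
  by apply: ler_pM sz; [rewrite mulr_ge0// exprn_ge0|lra|lra].
have den0 : 0 < 3 * pi ^+ 3 * Num.sqrt (zeta (12 / 11)) * 11 ^+ 4 :> R.
  by apply: lt_le_trans den; lra.
rewrite ler_pdivrMr//; apply: le_trans num _.
have c0 : 0 <= 7 / (2 * 10 ^+ 4) :> R by lra.
by apply: le_trans (ler_wpM2l c0 den); lra.
Qed.

End Constants.

(** The second entry of the minimum, cleared of its denominator. That entry is infinite when
    [S = 0], and then the left side is 0. *)
Lemma kappa_mul_sqrt_le (R : realType) (psi : nat -> R) (delta kappa : R) :
  0 < delta -> (kappa%:E < kappa_bound psi delta)%E ->
  kappa * Num.sqrt (limn (series (psi_sq psi))) <= 7 / (2 * 10 ^+ 4) * delta.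
Proof.
move=> d0; rewrite /kappa_bound !lt_min => /andP[/andP[/andP[_ +] _] _].
set s := Num.sqrt (limn _).
have [-> _|s0] := eqVneq s 0.
  by rewrite mulr0 mulr_ge0 ?(ltW d0)//; lra.
have {}s0 : 0 < s by rewrite lt_def s0 sqrtr_ge0.
rewrite inver gt_eqF// -!EFinM lte_fin => kd.
have c1 := ler_wpM2l (ltW (divr_gt0 d0 s0)) (kappa_const_le R).
have := ler_wpM2r (ltW s0) (le_trans (ltW kd) c1).
by congr (_ <= _); field; rewrite gt_eqF.
Qed.

Local Open Scope classical_set_scope.
Local Open Scope ring_scope.

Theorem theorem4 (R : realType) (psi : nat -> R)
    (psi_ge0 : forall q : nat, (0 < q)%N -> 0 <= psi q)
    (S_psi_cvg : cvgn (series (psi_sq psi)))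
    (delta : R) (delta01 : 0 < delta < 1)
    (kappa : R) (kappa_lt : (kappa%:E < kappa_bound psi delta)%E) :
  ((1 - delta)%:E <= lebesgue_measure (badB psi kappa))%E.
Proof.
case/andP: delta01 => d0 d1.
have ks := kappa_mul_sqrt_le d0 kappa_lt.
pose sigma := 7 / (2 * 10 ^+ 4) * delta.
have s0 : 0 < sigma by rewrite /sigma mulr_gt0//; lra.
apply: (@badB_measure_ge R psi kappa sigma) => //.
- by rewrite /sigma; lra.
- move=> n; have [k0|k0] := leP kappa 0.
    rewrite big_nat_cond big1 ?sqr_ge0// => q /andP[/andP[q0 _] _].
    by rewrite max_l ?expr0n// mulr_le0_ge0// psi_ge0.
  have S_ge : \sum_(1 <= q < n) psi q ^+ 2 <= limn (series (psi_sq psi)).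
    apply: (@le_trans _ _ (series (psi_sq psi) n.-1)).
      by rewrite /series /= /psi_sq; case: n => [|n]; [rewrite !big_geq|rewrite big_add1].
    apply: nondecreasing_cvgn_le S_psi_cvg _.
    by apply: nondecreasing_series => m _ _; exact: sqr_ge0.
  have S0 : 0 <= limn (series (psi_sq psi)).
    by apply: le_trans S_ge; apply: sumr_ge0 => *; exact: sqr_ge0.
  apply: (@le_trans _ _ ((kappa * Num.sqrt (limn (series (psi_sq psi)))) ^+ 2)).
    rewrite exprMn sqr_sqrtr//.
    apply: le_trans (ler_wpM2l (sqr_ge0 kappa) S_ge).
    rewrite mulr_sumr big_nat_cond [leRHS]big_nat_cond; apply: ler_sum => q.
    rewrite andbT => /andP[q0 _].
    by rewrite max_r ?exprMn// mulr_ge0 ?psi_ge0// ltW.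
  by apply: lerXn2r ks; rewrite nnegrE ?(ltW s0)// mulr_ge0 ?sqrtr_ge0// ltW.
(* The first term is below [0.471 delta ^ 2], the second is [0.49 delta]. *)
- rewrite /sigma /excess_cst.
  have : delta ^+ 2 <= delta by rewrite expr2 ler_piMr// ltW.
  by lra.
Qed.
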